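(* Consider the Burgers--Schwarzschild equation $$\partial_tu+\Big(1-\frac{2M}{r}\Big)\partial_r\Big(\frac{u^2}{2}\Big)=\frac{M}{r^2}(u^2-1),\qquad r>r_*,$$ with stationary random boundary condition $u_\omega(t,r_* )=\phi(t,\omega)=\phi(\theta^t\omega)$. Let $\rho\le0$ be the constant such that, with probability $1$, $\lim_{t_0\to-\infty}\frac{S^{t_0,t_1}}{t_1-t_0}=\rho$. If $\rho\ne0$ (equivalently, $\rho<0$), then there exists a stationary global solution.
   Context: Setting: $M>0$, $r_*>2M$, $u_E(r)=\sqrt{2M/r}$. $(\Omega,\mathcal{F},\mathsf{P})$ is a probability space with an ergodic flow $(\theta^t)_{t\in\mathbb{R}}$ of $\mathsf{P}$-preserving measurable transformations, $\phi:\Omega\to(-1,1)$ is a random variable, $\phi(t)=\phi(t,\omega)=\phi(\theta^t\omega)$, $\phi_+=\max(\phi,0)$. A characteristic is a curve $\chi$ with velocity $u(t)=\dot\chi(t)/(1-u_E^2(\chi(t)))\in(-1,1)$ satisfying $u'(t)=\frac{M}{\chi(t)^2}(u(t)^2-1)$. Along it $\frac{u^2-2M/\chi}{1-2M/\chi}$ is constant. A path on $[t_0,t_1]$ is a Lipschitz curve $\chi:[t_0,t_1]\to[r_*,\infty)$ consisting of finitely many consecutive parts, alternately characteristics (with endpoints on $\{t=t_0\}$, $\{t=t_1\}$ or $\{r=r_*\}$) and parts where $\chi=r_*$. For a path put $$K^{t_0,t_1}(\chi)=\frac12\int_{t_0}^{t_1}\frac{u^2(t)-u_E^2(\chi(t))}{1-u_E^2(\chi(t))}\mathbf{1}_{\chi(t)>r_*}dt,\quad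 P^{t_0,t_1}(\chi)=\int_{t_0}^{t_1}\frac{2M}{\chi(t)-2M}\mathbf{1}_{\chi(t)>r_*}dt,$$ $$B^{t_0,t_1}(\chi)=\frac12\int_{t_0}^{t_1}\frac{\phi_+(t)^2-u_E^2(r_* )}{1-u_E^2(r_* )}\mathbf{1}_{\chi(t)=r_*}dt,\quad A_W^{t_0,t_1}(\chi)=W(\chi(t_0))+K^{t_0,t_1}(\chi)+P^{t_0,t_1}(\chi)-B^{t_0,t_1}(\chi).$$ For $t_0<t_1$, $r_0,r_1\ge r_*$, $A^{t_0,t_1}(r_0,r_1)=\inf(K^{t_0,t_1}+P^{t_0,t_1}-B^{t_0,t_1})(\chi)$ over paths with $\chi(t_0)=r_0$, $\chi(t_1)=r_1$, and $S^{t_0,t_1}=A^{t_0,t_1}(r_*,r_* )$. The a.s. limit $\rho$ exists, is deterministic, and $\rho\le0$. $\mathbb{U}$ is the set of $w\in L^1_{\mathrm{loc}}([r_*,+\infty))$ with values in $(-1,1)$ (then automatically $\liminf_{x\to+\infty}\frac1x\int_{r_*}^xw>-\infty$); $\mathbb{D}$ is the set of c\`adl\`ag functions. The evolution operator $\Phi_\omega^{t_0,t_1}:\mathbb{U}\to\mathbb{U}\cap\mathbb{D}$ maps $w$ to the solution $u(t_1,\cdot)$ with initial condition $w$ at time $t_0$ and boundary condition $\phi(\cdot,\omega)$: $u(t_1,r)=(1-2M/r)^2\partial_rU(t_1,r)$ (right-continuous version), where $U(t_1,r_1)=\min_{\chi:\chi(t_1)=r_1}A_W^{t_0,t_1}(\chi)$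 over paths on $[t_0,t_1]$ and $W(r)=\int_{r_*}^r(1-2M/r')^{-2}w(r')\,dr'$. A global solution is a $\mathbb{U}$-valued process $u_\omega(t,\cdot)$, $t\in\mathbb{R}$, such that for $\mathsf{P}$-a.e. $\omega$ and all $t_0<t_1$, $\Phi_\omega^{t_0,t_1}u_\omega(t_0,\cdot)=u_\omega(t_1,\cdot)$; it is stationary if $u_\omega(t,\cdot)=u_{\theta^t\omega}(0,\cdot)$. *)

(* Defs.v *)
From HB Require Import structures.
From mathcomp Require Import all_boot all_order all_algebra.
From mathcomp Require Import all_classical all_reals all_analysis.

Set Implicit Arguments.
Unset Strict Implicit.
Unset Printing Implicit Defensive.

Import Order.TTheory GRing.Theory Num.Theory.
Import numFieldNormedType.Exports.

Local Open Scope classical_set_scope.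
Local Open Scope ring_scope.

Section deterministic.
Context {R : realType}.
Local Notation mu := (@lebesgue_measure R).

(* [M] and [rs] are the parameters M and r_*; [ph : R -> R] is one sample path
   t |-> phi(t, omega) of the boundary condition. Curves and profiles are total
   functions R -> R, of which only the restriction to [t0, t1], respectively
   to [rs, +oo[, is meaningful. *)
Implicit Types (M rs t r : R) (ph chi w v : R -> R).

Definition uE M r : R := Num.sqrt (2 * M / r).

Definition velocity M chi t : R := derive1 chi t / (1 - uE M (chi t) ^+ 2).

(* The equation is imposed on the open interval; the conserved quantity
   (u^2 - uE^2) / (1 - uE^2) then keeps u in (-1, 1) up to the endpoints. *)
Definition characteristic M chi (a b : R) : Prop :=
  forall t, a < t < b ->
    [/\ derivable chi t 1,
        -1 < velocity M chi t < 1
      & is_derive t 1 (velocity M chi)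
          (M / chi t ^+ 2 * (velocity M chi t ^+ 2 - 1))].

(* The parts are the intervals [s i, s i.+1] for i < n. They may be reduced to
   one point, so that two characteristics may be joined at a point of
   {r = rs}, and paths meeting at rs may be concatenated. *)
Definition is_path M rs t0 t1 chi : Prop :=
  [/\ [lipschitz chi t | t in `[t0, t1]],
      (forall t, t0 <= t <= t1 -> rs <= chi t)
    & exists (n : nat) (s : nat -> R) (b : bool),
        [/\ s 0%N = t0, s n = t1,
            (forall i, (i < n)%N -> s i <= s i.+1)
          & forall i, (i < n)%N ->
              if b (+) odd i then
                [/\ characteristic M chi (s i) (s i.+1),
                    s i = t0 \/ chi (s i) = rs
                  & s i.+1 = t1 \/ chi (s i.+1) = rs]
              else forall t, s i <= t <= s i.+1 -> chi t = rs]].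

(* derive1 chi may be a junk value at the finitely many times where two parts
   meet and at t0, t1, which does not affect the integral. *)
Definition Kact M rs t0 t1 chi : R :=
  2^-1 * \int[mu]_(t in `[t0, t1])
    ((velocity M chi t ^+ 2 - uE M (chi t) ^+ 2) / (1 - uE M (chi t) ^+ 2)
     * \1_[set t' | rs < chi t'] t).

Definition Pact M rs t0 t1 chi : R :=
  \int[mu]_(t in `[t0, t1])
    (2 * M / (chi t - 2 * M) * \1_[set t' | rs < chi t'] t).

Definition Bact M rs ph t0 t1 chi : R :=
  2^-1 * \int[mu]_(t in `[t0, t1])
    ((Num.max (ph t) 0 ^+ 2 - uE M rs ^+ 2) / (1 - uE M rs ^+ 2)
     * \1_[set t' | chi t' = rs] t).

Definition Wpot M rs w r : R :=
  \int[mu]_(x in `[rs, r]) ((1 - 2 * M / x) ^- 2 * w x).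

Definition action M rs ph w t0 t1 chi : R :=
  Wpot M rs w (chi t0) + Kact M rs t0 t1 chi + Pact M rs t0 t1 chi
  - Bact M rs ph t0 t1 chi.

(* A^{t0,t1}(r0, r1); it is +oo if no path joins the two points. *)
Definition ptp_action M rs ph t0 t1 r0 r1 : \bar R :=
  ereal_inf [set (Kact M rs t0 t1 chi + Pact M rs t0 t1 chi
                  - Bact M rs ph t0 t1 chi)%:E
            | chi in [set chi | [/\ is_path M rs t0 t1 chi,
                                    chi t0 = r0 & chi t1 = r1]]].

Definition Sact M rs ph t0 t1 : \bar R := ptp_action M rs ph t0 t1 rs rs.

(* L^1_loc([rs, +oo[) with values in (-1, 1); profiles are defined up to null
   sets, so the range condition is an almost everywhere one. *)
Definition in_U rs w : Prop :=
  (forall b, mu.-integrable `[rs, b] (EFin \o w)) /\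
  {ae mu, forall r, rs <= r -> -1 < w r < 1}.

(* Cadlag in the open domain r > rs of the equation; at rs the value is the
   boundary condition, which need not be the limit from the right. *)
Definition in_D rs v : Prop :=
  forall r, rs < r ->
    (v x @[x --> r^'+] --> v r) /\ cvg (v x @[x --> r^'-]).

(* U(t1, r1), as an infimum over a nonempty set of reals which is bounded
   below when w is in_U and |ph| < 1; it is the minimum whenever the minimum
   is attained. *)
Definition value M rs ph w t0 t1 r1 : R :=
  inf [set action M rs ph w t0 t1 chi
      | chi in [set chi | is_path M rs t0 t1 chi /\ chi t1 = r1]].

(* The graph of Phi^{t0,t1}: Phi^{t0,t1} w = v. By right-continuity, v is
   determined by w at every r > rs. *)
Definition evolution M rs ph t0 t1 w v : Prop :=
  [/\ in_U rs v, in_D rs v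
    & {ae mu, forall r, rs < r ->
        derivable (value M rs ph w t0 t1) r 1 /\
        v r = (1 - 2 * M / r) ^+ 2 * derive1 (value M rs ph w t0 t1) r}].

End deterministic.

Section random.
Context {d : measure_display} {Omega : measurableType d} {R : realType}.
Local Notation mu := (@lebesgue_measure R).
Implicit Types (P : probability Omega R) (theta : R -> Omega -> Omega)
  (phi : Omega -> R) (u : Omega -> R -> R -> R).

Definition measure_preserving_flow P theta : Prop :=
  [/\ forall o, theta 0 o = o,
      forall s t o, theta (s + t) o = theta s (theta t o),
      measurable_fun [set: measurableTypeR R * Omega]
        (fun p => theta p.1 p.2)
    & forall t A, measurable A -> P (theta t @^-1` A) = P A].

Definition ergodic_flow P theta : Prop :=
  measure_preserving_flow P theta /\
  forall A, measurable A -> (forall t, theta t @^-1` A = A) ->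
    P A = 0%E \/ P A = 1%E.

Definition sample_path theta phi (o : Omega) : R -> R :=
  fun t => phi (theta t o).

(* [u o t] is the profile u_omega(t, .). The second condition is measurability
   for the Borel sigma-algebra of the separable space L^1_loc([rs, +oo[),
   which is generated by the balls {w | \int_rs^b |w - g| < e}. *)
Definition U_process rs u : Prop :=
  (forall o t, in_U rs (u o t)) /\
  forall t b (g : R -> R), mu.-integrable `[rs, b] (EFin \o g) ->
    measurable_fun [set: Omega]
      (fun o => \int[mu]_(r in `[rs, b]) `|u o t r - g r|).

Definition global_solution M rs P theta phi u : Prop :=
  U_process rs u /\
  {ae P, forall o, forall t0 t1, t0 < t1 ->
    evolution M rs (sample_path theta phi o) t0 t1 (u o t0) (u o t1)}.

Definition stationary rs theta u : Prop :=
  forall o t r, rs <= r -> u o t r = u (theta t o) 0 r.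

End random.

(* Main.v *)
Require Import Defs.
From HB Require Import structures.
From mathcomp Require Import all_boot all_order all_algebra.
From mathcomp Require Import all_classical all_reals all_analysis.
From mathcomp Require Import measurable_realfun.
From mathcomp Require Import ring lra.
Set Implicit Arguments.
Unset Strict Implicit.
Unset Printing Implicit Defensive.
Import Order.TTheory GRing.Theory Num.Theory.
Import numFieldNormedType.Exports.
Local Open Scope classical_set_scope.
Local Open Scope ring_scope.

(** In the coordinate y = Y(r) of [ycoord], the integral from r_* to r of
    (1 - 2M/x)^(-3/2), the integrand of K + P along a path is the Lagrangian
    y'^2/2 + Q(y), where Q = M/(r - 2M) is a convex decreasing function of y.
    Characteristics are the solutions of y'' = Q'(y) whose energy y'^2/2 - Q(y)
    is below 1/2, the energy of light. As the Lagrangian is convex, every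
    solution of this equation minimizes the action among all curves with the
    same ends, be they slower or faster than light ([curve_cost_ge]). Let
    cost(s, y) be the least action from the wall y = 0 to y in time s.

    A motion from the wall to the wall is a chain of loops and of stays, which
    earn the gain of the boundary. The least cost S(T, t) of such motions
    ([wallS]) satisfies a crossing inequality, because interlacing loops meet
    and can be exchanged there ([loop_monge], [wallS_cross]). Hence the
    differences S(T, t) - S(T, s) decrease as T goes to the past; their limits
    are the increments of a Busemann function Z of the time ([wallZ]).

    If rho < 0, then S(T, 0) tends to -oo as T goes to -oo for almost every
    sample path ([good_of_rate]), so Z tends to +oo in the past. Therefore the
    Hopf-Lax formula U(t, y) = inf_s Z(t - s) + cost(s, y) ([wallU]) has
    minimizers. They make U(t, .) semiconcave ([wallU_semiconcave]), and its
    right derivative, rescaled, is the solution at time t ([profile]).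

    This family is carried into itself by the evolution ([value_profile]): no
    path does better than U, part by part ([wallU_le_path]), and nearly optimal
    motions with their nearly optimal pasts can be cut at any earlier time
    ([wallZ_past], [path_near_wallU]). Its values are below the speed of light
    almost everywhere ([profile_lt1]): leaving the wall earlier must not pay, so
    the energy of a minimizer is at most the rate of gain at its departure
    ([wallU_min_een]), which is below 1/2 wherever it exists. It fails to exist
    at a null set of times only, and the light rays leaving at these times
    arrive at a null set of radii ([light_ae]).

    Since U depends, up to a function of time, on the increments of the gain
    only, a translation of the boundary condition translates the solution
    ([wallU_shift]), which gives stationarity; and since the infima involved can
    be taken over countable families ([ccost_rat]), the solution is measurable
    ([past_profile_meas]). *)

(** * Derivatives and primitives *)

Section calculus.
Context {R : realType}.
Implicit Types (f g F G : R -> R) (a b c t x y : R).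

Lemma is_derive_cont t f a : is_derive t 1 f a -> {for t, continuous f}.
Proof.
by move=> [d _]; apply/differentiable_continuous; rewrite -derivable1_diffP.
Qed.

Lemma dD t f g a b : is_derive t 1 f a -> is_derive t 1 g b ->
  is_derive t 1 (fun x => f x + g x) (a + b).
Proof. exact: is_deriveD. Qed.

Lemma dB t f g a b : is_derive t 1 f a -> is_derive t 1 g b ->
  is_derive t 1 (fun x => f x - g x) (a - b).
Proof. exact: is_deriveB. Qed.

Lemma dN t f a : is_derive t 1 f a -> is_derive t 1 (fun x => - f x) (- a).
Proof. exact: is_deriveN. Qed.

Lemma dM t f g a b : is_derive t 1 f a -> is_derive t 1 g b ->
  is_derive t 1 (fun x => f x * g x) (a * g t + f t * b).
Proof.
move=> da db; have := is_deriveM da db; rewrite addrC.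
by rewrite (_ : g t *: a = a * g t) // /GRing.scale /= mulrC.
Qed.

Lemma dC t c : is_derive t 1 (fun _ : R => c) 0.
Proof. exact: is_derive_cst. Qed.

Lemma dI t : is_derive t 1 (fun x : R => x) 1.
Proof. exact: is_derive_id. Qed.

Lemma dZ t c f a : is_derive t 1 f a -> is_derive t 1 (fun x => c * f x) (c * a).
Proof.
by move=> da; apply: is_derive_eq (dM (dC t c) da) _; rewrite mul0r add0r.
Qed.

Lemma dcomp t f g a b : is_derive t 1 f a -> is_derive (f t) 1 g b ->
  is_derive t 1 (fun x => g (f x)) (b * a).
Proof.
move=> da db; have [d1 e1] := da; have [d2 e2] := db.
have d12 : derivable (g \o f) t 1.
  by apply/derivable1_diffP/differentiable_comp; exact/derivable1_diffP.
have := derive1_comp d1 d2; rewrite !derive1E e1 e2 => e12.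
exact: DeriveDef d12 e12.
Qed.

Lemma is_derive_near t f g a : (\forall x \near t, f x = g x) ->
  is_derive t 1 f a -> is_derive t 1 g a.
Proof.
exact: near_eq_is_derive.
Qed.

Lemma near_in_oo a b t (P : R -> Prop) : a < t < b ->
  (forall x, a < x < b -> P x) -> \forall x \near t, P x.
Proof.
move=> tab aP; have : t \in `]a, b[ by rewrite in_itv.
move=> /near_in_itvoo; apply: filterS => x; rewrite in_itv /=; exact: aP.
Qed.

Lemma is_derive_ext_oo a b t f g l : a < t < b ->
  (forall x, a < x < b -> f x = g x) ->
  is_derive t 1 f l -> is_derive t 1 g l.
Proof. by move=> tab fg; apply: is_derive_near; apply: near_in_oo tab _. Qed.

Lemma within_cont f a b : (forall x, a <= x <= b -> {for x, continuous f}) ->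
  {within `[a, b], continuous f}.
Proof.
move=> cf; apply/continuous_in_subspaceT => x; rewrite inE/= in_itv/=; exact: cf.
Qed.

Lemma withinS f a b c d : c <= a -> b <= d ->
  {within `[c, d], continuous f} -> {within `[a, b], continuous f}.
Proof.
move=> ca bd; apply: continuous_subspaceW => x /=.
by rewrite !in_itv/= => /andP[ax xb]; rewrite (le_trans ca)//= (le_trans xb).
Qed.

Lemma lip_cont f t L r : 0 <= L -> 0 < r ->
  (forall z, `|t - z| < r -> `|f t - f z| <= L * `|t - z|) -> {for t, continuous f}.
Proof.
move=> L0 r0 h; apply/cvgrPdist_lt => /= e e0; have L1 : 0 < L + 1 by rewrite ltr_wpDl.
exists (Num.min r (e / (L + 1))); first by rewrite /= lt_min r0 divr_gt0.
move=> z /=; rewrite lt_min ltr_pdivlMr// => /andP[/h hz].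
by apply: le_lt_trans; apply: le_trans hz _; rewrite mulrC ler_wpM2l// lerDl.
Qed.

(** The derivative is used in the open interval only, because the velocity of a
    path need not exist at the ends of its parts. *)
Lemma mono_le F f a b : a <= b -> {within `[a, b], continuous F} ->
  (forall x, a < x < b -> is_derive x 1 F (f x)) ->
  (forall x, a < x < b -> 0 <= f x) -> F a <= F b.
Proof.
move=> ab cF dF f0.
have [->|ab'] := eqVneq a b; first by [].
have {}ab' : a < b by rewrite lt_neqAle ab' ab.
have dF' x : x \in `]a, b[ -> is_derive x 1 F (f x).
  by rewrite in_itv /=; exact: dF.
have [c cab E] := MVT ab' dF' cF.
rewrite -subr_ge0 E mulr_ge0 ?subr_ge0//.
by apply: f0; rewrite in_itv/= in cab.
Qed.

Lemma zero_derive_const F a b : a <= b -> {within `[a, b], continuous F} ->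
  (forall x, a < x < b -> is_derive x 1 F 0) -> F b = F a.
Proof.
move=> ab cF dF; apply/eqP; rewrite eq_le; apply/andP; split; last first.
  exact: (mono_le (f := fun=> 0) ab cF dF).
rewrite -lerN2; apply: (mono_le (F := fun x => - F x) (f := fun=> - 0) ab).
- by move=> x; apply: cvgN; exact: cF.
- by move=> x xab; exact: dN (dF x xab).
- by move=> x _; rewrite oppr0.
Qed.

Lemma dmono_le F f a b : a <= b ->
  (forall x, a <= x <= b -> is_derive x 1 F (f x)) ->
  (forall x, a <= x <= b -> 0 <= f x) -> F a <= F b.
Proof.
move=> ab dF f0; apply: (mono_le (f := f)) => //.
- by apply: within_cont => x xab; apply: is_derive_cont (dF _ xab).
- by move=> x /andP[ax xb]; apply: dF; rewrite !ltW.
- by move=> x /andP[ax xb]; apply: f0; rewrite !ltW.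
Qed.

Lemma dmono_lt F f a b : a < b ->
  (forall x, a <= x <= b -> is_derive x 1 F (f x)) ->
  (forall x, a <= x <= b -> 0 < f x) -> F a < F b.
Proof.
move=> ab dF f0.
have dF' x : x \in `]a, b[ -> is_derive x 1 F (f x).
  by rewrite in_itv /= => /andP[ax xb]; apply: dF; rewrite !ltW.
have cF : {within `[a, b], continuous F}.
  by apply: within_cont => x xab; apply: is_derive_cont (dF _ xab).
have [c cab E] := MVT ab dF' cF.
rewrite -subr_gt0 E mulr_gt0 ?subr_gt0//.
by apply: f0; move: cab; rewrite in_itv/= => /andP[? ?]; rewrite !ltW.
Qed.

Lemma dcmp_le F f G g a b : a <= b ->
  (forall x, a <= x <= b -> is_derive x 1 F (f x)) ->
  (forall x, a <= x <= b -> is_derive x 1 G (g x)) ->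
  (forall x, a <= x <= b -> f x <= g x) -> F b - F a <= G b - G a.
Proof.
move=> ab dF dG fg.
suff : G a - F a <= G b - F b by lra.
apply: (dmono_le (F := fun x => G x - F x) (f := fun x => g x - f x)) => // x xab.
  by apply: dB; [exact: dG|exact: dF].
by rewrite subr_ge0 fg.
Qed.

Lemma deriv_eq F G f a b : a <= b ->
  (forall x, a <= x <= b -> is_derive x 1 F (f x)) ->
  (forall x, a <= x <= b -> is_derive x 1 G (f x)) -> F b - F a = G b - G a.
Proof. by move=> ab dF dG; apply/eqP; rewrite eq_le !(dcmp_le ab dF dG, dcmp_le ab dG dF). Qed.

End calculus.

(** A primitive on the whole line, so that gains and actions over arbitrary time
    intervals are increments of one function; locked, because unfolding it makes
    unification compute with integrals. *)
HB.lock Definition prim (R : realType) (f : R -> R) (t : R) : R :=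
  if 0 <= t then \int[lebesgue_measure]_(x in `[0, t]) f x
  else - \int[lebesgue_measure]_(x in `[t, 0]) f x.

Section primitive.
Context {R : realType}.
Local Notation mu := (@lebesgue_measure R).
Implicit Types (f g : R -> R) (a b c t : R).

Definition locint f := forall a b, mu.-integrable `[a, b] (EFin \o f).

Lemma Rint_split f a b c : a <= b -> b <= c ->
  mu.-integrable `[a, c] (EFin \o f) ->
  \int[mu]_(x in `[a, c]) f x =
  \int[mu]_(x in `[a, b]) f x + \int[mu]_(x in `[b, c]) f x.
Proof.
move=> ab bc fi.
have := Rintegral_itvB (x := b) fi; rewrite !bnd_simp => /(_ ab bc).
rewrite Rintegral_itv_obnd_cbnd; first by move=> <-; rewrite addrC subrK.
apply: integrableS fi => //; apply: subset_itv; by rewrite bnd_simp.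
Qed.

Lemma prim_itv f a c : locint f -> a <= c ->
  prim f c - prim f a = \int[mu]_(x in `[a, c]) f x.
Proof.
move=> fi ac; rewrite prim.unlock.
case: (leP 0 c) => c0; case: (leP 0 a) => a0.
- by rewrite (Rint_split a0 ac (fi 0 c)); ring.
- by rewrite opprK (Rint_split (ltW a0) c0 (fi a c)) addrC.
- by move: (le_lt_trans a0 (le_lt_trans ac c0)); rewrite ltxx.
- by rewrite opprK (Rint_split ac (ltW c0) (fi a 0)); ring.
Qed.

Lemma prim0 f : prim f 0 = 0.
Proof. by rewrite prim.unlock lexx set_itv1 Rintegral_set1. Qed.

Lemma primC0 t : prim (fun _ : R => 0) t = 0.
Proof. by rewrite prim.unlock; case: ifP => _; rewrite Rintegral_cst// ?mul0r ?oppr0. Qed.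

Lemma prim_near f a t : locint f -> a < t ->
  \forall x \near t, prim f a + \int[mu]_(y in `[a, x]) f y = prim f x.
Proof.
move=> fi at_; apply: (@near_in_oo _ a (t + 1)); first by rewrite at_ ltrDl ltr01.
by move=> x /andP[ax _]; rewrite -prim_itv ?(ltW ax)//; lra.
Qed.

Lemma is_derive_prim f t : locint f -> {for t, continuous f} ->
  is_derive t 1 (prim f) (f t).
Proof.
move=> fi cf; have h : t - 1 < t by lra.
have h2 : t < t + 1 by lra.
have [d e] := continuous_FTC1_closed h2 (fi (t - 1) (t + 1)) h cf.
rewrite derive1E in e; have D := DeriveDef d e.
apply: is_derive_near (prim_near fi h) _.
exact: is_derive_eq (dD (dC t _) D) (add0r _).
Qed.

Lemma continuous_locint f : continuous f -> locint f.
Proof.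
move=> cf a b; apply: continuous_compact_integrable; first exact: segment_compact.
exact: continuous_subspaceT.
Qed.

Lemma is_derive_primc f t : continuous f -> is_derive t 1 (prim f) (f t).
Proof. by move=> cf; apply: is_derive_prim; [exact: continuous_locint|exact: cf]. Qed.

End primitive.

(** * Newton's equation with a convex potential *)

(** A force directed towards the origin which does not increase with the
    distance: the potential is then convex. Everything is defined on the whole
    line, also behind the wall y = 0, so that no domain has to be carried
    along. *)
Record convex_potential (R : realType) := ConvexPotential {
  pot : R -> R;
  force : R -> R;
  force_max : R;
  force_lip : R;
  pot_derive : forall y, is_derive y (1 : R) pot (- force y);
  pot_ge0 : forall y, 0 <= pot y;
  force_gt0 : forall y, 0 < force y;
  force_le : forall y, force y <= force_max;
  force_nincr : forall y z, y <= z -> force z <= force y;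
  force_lip_gt0 : 0 < force_lip;
  forceL : forall y z, `|force y - force z| <= force_lip * `|y - z| }.

Section picard.
Context {R : realType} (p : convex_potential R).
Local Notation f := (force p).
Local Notation lam := (force_lip p + 1).
Local Notation ex := (fun t : R => expR (lam * t)).
Implicit Types (g h : R -> R) (v t A : R).

Lemma force_cont : continuous f.
Proof.
move=> y; apply: (lip_cont (ltW (force_lip_gt0 p)) ltr01) => z _; exact: forceL.
Qed.

Lemma lam_ge1 : 1 <= lam.
Proof. by have := force_lip_gt0 p; lra. Qed.

Lemma d_ex t : is_derive t 1 ex (lam * ex t).
Proof.
have h : is_derive t 1 (fun x => lam * x) lam.
  exact: is_derive_eq (dZ lam (dI t)) (mulr1 _).
have := dcomp h (is_derive_expR (lam * t)).
by rewrite mulrC.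
Qed.

Lemma ex_ge t : 0 <= t -> t <= ex t.
Proof.
move=> t0; have := expR_ge1Dx (lam * t); have := lam_ge1.
have : t <= lam * t by rewrite ler_peMl// lam_ge1.
lra.
Qed.

Lemma ex_gt0 t : 0 < ex t. Proof. exact: expR_gt0. Qed.

Lemma prim_le_ex h1 h2 B : continuous h1 -> continuous h2 -> 0 <= B ->
  (forall t, 0 <= t -> `|h1 t - h2 t| <= B * ex t) ->
  forall t, 0 <= t -> `|prim h1 t - prim h2 t| <= B / lam * ex t.
Proof.
move=> c1 c2 B0 hB t t0.
have l1 := lam_ge1.
have l0 : 0 < lam by lra.
have dE x : 0 <= x <= t -> is_derive x 1 (fun x => B / lam * ex x) (B * ex x).
  move=> _; apply: is_derive_eq (dZ (B / lam) (d_ex x)) _.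
  by rewrite mulrA divfK// gt_eqF.
have dP x : 0 <= x <= t ->
    is_derive x 1 (fun x => prim h1 x - prim h2 x) (h1 x - h2 x).
  by move=> _; apply: dB; exact: is_derive_primc.
have dP' x : 0 <= x <= t ->
    is_derive x 1 (fun x => - (prim h1 x - prim h2 x)) (- (h1 x - h2 x)).
  by move=> xt; apply: dN; exact: dP.
have c x : 0 <= x <= t -> h1 x - h2 x <= B * ex x.
  by move=> /andP[x0 _]; apply: le_trans (ler_norm _) (hB x x0).
have c' x : 0 <= x <= t -> - (h1 x - h2 x) <= B * ex x.
  by move=> /andP[x0 _]; apply: le_trans (hB x x0); rewrite -normrN ler_norm.
have := dcmp_le t0 dP dE c; have := dcmp_le t0 dP' dE c'.
rewrite !prim0 mulr0 expR0 mulr1 !subr0 oppr0 subr0.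
have Bl : 0 <= B / lam by rewrite divr_ge0// ltW.
rewrite ler_norml; set a := prim h1 t - _; set b := _ * expR _; set d := B / lam in Bl *.
by move=> *; apply/andP; split; lra.
Qed.

(** Clipping the time makes the iterates continuous functions on the line, while
    they are controlled for nonnegative times only. *)
Definition clip0 t : R := Num.max t 0.

Lemma clip0_cont : continuous clip0.
Proof. by move=> t; apply: continuous_max; [exact: cvg_id|exact: cvg_cst]. Qed.

Lemma clip0E t : 0 <= t -> clip0 t = t.
Proof. by move=> t0; rewrite /clip0; apply/max_idPl. Qed.

Lemma clip0_ge0 t : 0 <= clip0 t.
Proof. by rewrite /clip0 le_max lexx orbT. Qed.

Definition acc g t := f (g (clip0 t)).

Lemma acc_cont g : continuous g -> continuous (acc g).
Proof.
move=> cg t; apply: (@continuous_comp _ _ _ (g \o clip0) f); last exact: force_cont.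
by apply: continuous_comp; [exact: clip0_cont|exact: cg].
Qed.

Definition picard v g t := v * t - prim (prim (acc g)) t.

Lemma picardE v g t : picard v g t = v * t - prim (prim (acc g)) t.
Proof. by []. Qed.

Lemma primc_cont h : continuous h -> continuous (prim h).
Proof. by move=> ch t; apply: is_derive_cont (is_derive_primc t ch). Qed.

Lemma d_picard v g t : continuous g ->
  is_derive t 1 (picard v g) (v - prim (acc g) t).
Proof.
move=> cg; apply: dB.
  exact: is_derive_eq (dZ v (dI t)) (mulr1 _).
by apply: is_derive_primc; apply: primc_cont; exact: acc_cont.
Qed.

Lemma picard_cont v g : continuous g -> continuous (picard v g).
Proof. by move=> cg t; apply: is_derive_cont (d_picard v t cg). Qed.

Lemma lam2 : force_lip p / lam / lam <= 2^-1.
Proof.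
have := force_lip_gt0 p => k0; set k := force_lip p in k0 *.
have l0 : 0 < k + 1 by lra.
rewrite !ler_pdivrMr//; nra.
Qed.

(** The weight exp (lam t) makes the Picard map a contraction of ratio 1/2. *)
Lemma picard_contract v1 v2 g1 g2 A : continuous g1 -> continuous g2 -> 0 <= A ->
  (forall t, 0 <= t -> `|g1 t - g2 t| <= A * ex t) ->
  forall t, 0 <= t ->
    `|picard v1 g1 t - picard v2 g2 t| <= `|v1 - v2| * t + A / 2 * ex t.
Proof.
move=> c1 c2 A0 hA t t0.
have l1 := lam_ge1; have k0 := force_lip_gt0 p.
have h1 : forall q, 0 <= q -> `|acc g1 q - acc g2 q| <= force_lip p * A * ex q.
  move=> q q0; rewrite /acc clip0E//; apply: (le_trans (forceL p _ _)).
  by rewrite -mulrA ler_pM2l// hA.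
have B0 : 0 <= force_lip p * A by rewrite mulr_ge0// ltW.
have B1 : 0 <= force_lip p * A / lam by rewrite divr_ge0//; lra.
have h2 := prim_le_ex (acc_cont c1) (acc_cont c2) B0 h1.
have h3 := prim_le_ex (primc_cont (acc_cont c1)) (primc_cont (acc_cont c2)) B1 h2 t0.
rewrite /picard.
set P1 := prim (prim (acc g1)) t in h3 *; set P2 := prim (prim (acc g2)) t in h3 *.
have -> : v1 * t - P1 - (v2 * t - P2) = (v1 - v2) * t - (P1 - P2) by ring.
apply: (le_trans (ler_normB _ _)); rewrite normrM (ger0_norm t0) lerD2l.
apply: (le_trans h3); rewrite ler_pM2r ?ex_gt0//.
have -> : force_lip p * A / lam / lam = A * (force_lip p / lam / lam) by ring.
by rewrite ler_wpM2l// lam2.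
Qed.

#[local] Opaque picard.

Lemma picard_contract0 v g1 g2 A : continuous g1 -> continuous g2 -> 0 <= A ->
  (forall t, 0 <= t -> `|g1 t - g2 t| <= A * ex t) ->
  forall t, 0 <= t -> `|picard v g1 t - picard v g2 t| <= A / 2 * ex t.
Proof.
move=> c1 c2 A0 h t t0; have := picard_contract v v c1 c2 A0 h t0.
have -> : `|v - v| * t = 0 by rewrite subrr normr0 mul0r.
by rewrite [0 + _]add0r.
Qed.

Fixpoint picardn v n : R -> R :=
  if n is n'.+1 then picard v (picardn v n') else (fun=> 0).

Lemma picardn_cont v n : continuous (picardn v n).
Proof. by elim: n => [|n IH] /=; [move=> t; exact: cvg_cst|exact: picard_cont]. Qed.

Let amp v := `|v| + force_max p.

Lemma fmax_ge0 : 0 <= force_max p.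
Proof. by have := force_gt0 p 0; have := force_le p 0; lra. Qed.

Lemma amp_ge0 v : 0 <= amp v.
Proof. by rewrite addr_ge0// fmax_ge0. Qed.

Lemma picardn_step v n t : 0 <= t ->
  `|picardn v n.+1 t - picardn v n t| <= amp v * 2^-1 ^+ n * ex t.
Proof.
have l1 := lam_ge1; have F0 := fmax_ge0.
elim: n t => [|n IH] t t0.
  rewrite /= expr0 mulr1 subr0 picardE.
  have c0 : continuous (fun _ : R => 0 : R) by move=> x; apply: cvg_cst.
  have h1 : forall q, 0 <= q -> `|acc (fun=> 0) q - (fun=> 0) q| <= force_max p * ex q.
    move=> q q0; rewrite subr0 /acc gtr0_norm ?force_gt0//.
    apply: (le_trans (force_le p _)); rewrite ler_peMr//.
    by rewrite -[leLHS]expR0 ler_expR mulr_ge0//; lra.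
  have h2 := prim_le_ex (acc_cont c0) c0 F0 h1.
  have F1 : 0 <= force_max p / lam by rewrite divr_ge0//; lra.
  have h3 := prim_le_ex (primc_cont (acc_cont c0)) (primc_cont c0) F1 h2 t0.
  have z1 : prim (prim (fun _ : R => 0 : R)) t = 0.
    have -> : prim (fun _ : R => 0 : R) = (fun _ : R => 0 : R).
      by apply/funext => x; exact: primC0.
    exact: primC0.
  rewrite z1 subr0 in h3.
  apply: (le_trans (ler_normB _ _)); rewrite normrM (ger0_norm t0) /amp mulrDl.
  apply: lerD; first by rewrite ler_wpM2l// ex_ge.
  apply: (le_trans h3); rewrite ler_pM2r ?ex_gt0// ler_pdivrMr; last by lra.
  rewrite ler_pdivrMr; last lra.
  by rewrite -mulrA ler_peMr// -[leLHS]mulr1 ler_pM.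
have A0 : 0 <= amp v * 2^-1 ^+ n by rewrite mulr_ge0 ?amp_ge0// exprn_ge0//; lra.
have h := picard_contract0 v (@picardn_cont v n.+1) (@picardn_cont v n) A0 IH t0.
apply: (le_trans h).
by rewrite exprSr mulrA.
Qed.

(** The limit of the Picard iterates, as a supremum: the sequence corrected by
    twice its geometric error is nondecreasing. *)
Definition picardl v t : R :=
  sup [set picardn v n (clip0 t) - 2 * amp v * 2^-1 ^+ n * ex (clip0 t) | n in setT].

Lemma picardl_err v n t : 0 <= t ->
  `|picardl v t - picardn v n t| <= 2 * amp v * 2^-1 ^+ n * ex t.
Proof.
move=> t0; rewrite /picardl clip0E//.
pose u m := picardn v m t.
pose e m := 2 * amp v * 2^-1 ^+ m * ex t.
have e_ge0 m : 0 <= e m.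
  by rewrite !mulr_ge0 ?amp_ge0 ?exprn_ge0 ?expR_ge0//; lra.
have eS m : e m - e m.+1 = amp v * 2^-1 ^+ m * ex t by rewrite /e exprS; field.
have st m : `|u m.+1 - u m| <= e m - e m.+1 by rewrite eS; exact: picardn_step.
have incr m k : u m - e m <= u (m + k)%N - e (m + k)%N.
  elim: k => [|k IH]; rewrite ?addn0// addnS; apply: (le_trans IH).
  by have := st (m + k)%N; rewrite ler_norml; lra.
have decr m k : u (m + k)%N + e (m + k)%N <= u m + e m.
  elim: k => [|k IH]; rewrite ?addn0// addnS; apply: le_trans IH.
  by have := st (m + k)%N; rewrite ler_norml; lra.
set S := [set _ | _ in _].
have ubS m : ubound S (u m + e m).
  move=> _ [k _ <-]; rewrite -/(u k) -/(e k).
  case: (leqP m k) => [mk|/ltnW km].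
    by have := decr m (k - m)%N; rewrite subnKC//; have := e_ge0 k; lra.
  by have := incr k (m - k)%N; rewrite subnKC//; have := e_ge0 m; lra.
have S0 : S !=set0 by exists (u 0%N - e 0%N); exists 0%N.
have hi := ge_sup S0 (ubS n).
have lo : u n - e n <= sup S.
  by apply: ub_le_sup; [exists (u 0%N + e 0%N); exact: ubS|exists n].
by rewrite -/(u n) -/(e n) ler_norml; apply/andP; split; lra.
Qed.

Lemma picardl_clip v t : picardl v (clip0 t) = picardl v t.
Proof. by rewrite /picardl (clip0E (clip0_ge0 t)). Qed.

Lemma half_small (x B : R) : 0 <= x -> (forall n, x <= B * 2^-1 ^+ n) -> x = 0.
Proof.
move=> x0 h; apply/eqP; rewrite eq_le x0 andbT.
have c : (B * 2^-1 ^+ n) @[n --> \oo] --> B * 0.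
  apply: cvgM; first exact: cvg_cst.
  by apply: cvg_expr; rewrite gtr0_norm; lra.
rewrite mulr0 in c.
rewrite -(cvg_lim _ c)//; apply: limr_ge; first by apply/cvg_ex; exists 0.
by near=> n; exact: h.
Unshelve. all: by end_near. Qed.

Lemma half_lt (B e : R) : 0 < e -> exists n, B * 2^-1 ^+ n < e.
Proof.
move=> e0.
have c : (B * 2^-1 ^+ n) @[n --> \oo] --> B * 0.
  apply: cvgM; first exact: cvg_cst.
  by apply: cvg_expr; rewrite gtr0_norm; lra.
rewrite mulr0 in c; move/cvgrPdist_lt: c => /(_ e e0)[n _ h].
exists n; have := h n (leqnn n); rewrite /= sub0r normrN; apply: le_lt_trans.
exact: ler_norm.
Qed.

Lemma picardl_cont v : continuous (picardl v).
Proof.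
move=> t; apply/cvgrPdist_lt => /= e e0.
pose T := `|t| + 1.
have clT s : `|t - s| < 1 -> ex (clip0 s) <= ex T.
  have l1 := lam_ge1.
  move=> ts; rewrite ler_expR ler_pM2l; last lra.
  rewrite /clip0 ge_max /T; apply/andP; split; last by rewrite addr_ge0.
  have := ler_norm t; have : s - t <= `|t - s| by rewrite distrC ler_norm.
  lra.
have [n hn] := half_lt (2 * amp v * ex T) (divr_gt0 e0 (ltr0n _ 3)).
have err s : `|t - s| < 1 -> `|picardl v s - picardn v n (clip0 s)| < e / 3.
  move=> ts; have := picardl_err v n (clip0_ge0 s).
  rewrite picardl_clip => h.
  apply: (le_lt_trans h); apply: le_lt_trans hn.
  rewrite mulrAC; apply: ler_wpM2r; first by rewrite exprn_ge0//; lra.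
  by apply: ler_wpM2l; [rewrite mulr_ge0// amp_ge0|exact: clT].
have cn : {for t, continuous (picardn v n \o clip0)}.
  by apply: continuous_comp; [exact: clip0_cont|exact: picardn_cont].
move/cvgrPdist_lt: cn => /(_ _ (divr_gt0 e0 (ltr0n _ 3))) cn.
near=> s.
have s1 : `|t - s| < 1.
  by near: s; exists 1 => //=.
have t1 : `|t - t| < 1 by rewrite subrr normr0 ltr01.
have := err s s1; have := err t t1.
have : `|(picardn v n \o clip0) t - (picardn v n \o clip0) s| < e / 3 by near: s.
rewrite /= !ltr_norml; lra.
Unshelve. all: by end_near. Qed.

Definition psol v := picard v (picardl v).
Definition pvel v t := v - prim (acc (picardl v)) t.

Lemma psolE v t : 0 <= t -> psol v t = picardl v t.
Proof.
move=> t0; apply/eqP; rewrite -subr_eq0 -normr_eq0; apply/eqP.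
apply: (half_small (B := 2 * amp v * ex t)) => // n.
have A0 : 0 <= 2 * amp v * 2^-1 ^+ n.
  by rewrite !mulr_ge0 ?amp_ge0// exprn_ge0//; lra.
have h1 := picard_contract0 v (@picardl_cont v) (@picardn_cont v n) A0
  (fun q => @picardl_err v n q) t0.
have h2 := picardl_err v n.+1 t0; rewrite distrC in h2.
apply: (le_trans (ler_distD (picardn v n.+1 t) _ _)).
apply: (le_trans (lerD h1 h2)).
by rewrite exprS le_eqVlt; apply/orP; left; apply/eqP; field.
Qed.

Lemma psol0 v : psol v 0 = 0.
Proof. by rewrite /psol picardE mulr0 prim0 subr0. Qed.

Lemma pvel0 v : pvel v 0 = v.
Proof. by rewrite /pvel prim0 subr0. Qed.

Lemma d_psol v t : is_derive t 1 (psol v) (pvel v t).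
Proof. by apply: d_picard; exact: picardl_cont. Qed.

Lemma d_pvel v t : 0 <= t -> is_derive t 1 (pvel v) (- f (psol v t)).
Proof.
move=> t0; rewrite psolE// -[- _]add0r -[t in f (_ t)]clip0E//.
apply: (dB (dC t v)); apply: is_derive_primc.
by apply: acc_cont; exact: picardl_cont.
Qed.

(** The iterates that start from two velocities stay close, uniformly in their
    number, by the same contraction estimate. *)
Lemma psol_lip v1 v2 t : 0 <= t -> `|psol v1 t - psol v2 t| <= 2 * `|v1 - v2| * ex t.
Proof.
move=> t0; rewrite !psolE//.
have it n q : 0 <= q -> `|picardn v1 n q - picardn v2 n q| <= 2 * `|v1 - v2| * ex q.
  elim: n q => [|n IH] q q0.
    by rewrite subrr normr0 !mulr_ge0// ?expR_ge0.
  have D0 : 0 <= 2 * `|v1 - v2| by rewrite mulr_ge0.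
  have := picard_contract v1 v2 (@picardn_cont v1 n) (@picardn_cont v2 n) D0 IH q0.
  rewrite [2 * _]mulrC mulfK// => h; apply: (le_trans h).
  have : `|v1 - v2| * q <= `|v1 - v2| * ex q by rewrite ler_wpM2l// ex_ge.
  set a := _ * q; set b := _ * ex q; rewrite mulrAC -/b; lra.
rewrite leNgt; apply/negP; rewrite -subr_gt0 => hlt.
have [n hn] := half_lt ((2 * amp v1 + 2 * amp v2) * ex t) hlt.
have := picardl_err v1 n t0; have := picardl_err v2 n t0; have := it n t t0.
have E : (2 * amp v1 + 2 * amp v2) * ex t * 2^-1 ^+ n =
  2 * amp v1 * 2^-1 ^+ n * ex t + 2 * amp v2 * 2^-1 ^+ n * ex t by ring.
move=> h3 h2 h1; move: hn; rewrite {}E; apply/negP; rewrite -leNgt lerBlDr.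
apply: (le_trans (ler_distD (picardn v1 n t) _ _)).
apply: (le_trans (lerD h1 (ler_distD (picardn v2 n t) _ _))).
rewrite [`|picardn v2 n t - _|]distrC.
move: h2 h3; set a := `|_|; set b := `|_|; set c := `|v1 - v2|.
set d := 2 * amp v1 * _ * _; set d' := 2 * amp v2 * _ * _; set e := _ * ex t.
lra.
Qed.

Lemma psol_contv t : 0 <= t -> continuous (psol ^~ t).
Proof.
move=> t0 v; have k0 : 0 <= 2 * ex t by rewrite mulr_ge0 ?(ltW (ex_gt0 _)).
by apply: (lip_cont k0 ltr01) => z _; rewrite mulrAC; exact: psol_lip.
Qed.

(** The flow of Newton's equation from the origin. The sigma type hides its
    construction from unification. *)
Lemma flow_sig : {yw : (R -> R -> R) * (R -> R -> R) |
  [/\ (forall v, yw.1 v 0 = 0 /\ yw.2 v 0 = v),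
      (forall v t, is_derive t 1 (yw.1 v) (yw.2 v t)),
      (forall v t, 0 <= t -> is_derive t 1 (yw.2 v) (- f (yw.1 v t)))
    & (forall t, 0 <= t -> continuous (yw.1 ^~ t))]}.
Proof.
exists (psol, pvel); split => /=.
- by move=> v; rewrite psol0 pvel0.
- exact: d_psol.
- exact: d_pvel.
- exact: psol_contv.
Qed.

Definition sol : R -> R -> R := (projT1 flow_sig).1.
Definition vel : R -> R -> R := (projT1 flow_sig).2.

Lemma sol0 v : sol v 0 = 0.
Proof. by rewrite /sol; case: (projT2 flow_sig) => /(_ v)[]. Qed.

Lemma vel0 v : vel v 0 = v.
Proof. by rewrite /vel; case: (projT2 flow_sig) => /(_ v)[]. Qed.

Lemma d_sol v t : is_derive t 1 (sol v) (vel v t).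
Proof. by rewrite /sol /vel; case: (projT2 flow_sig). Qed.

Lemma d_vel v t : 0 <= t -> is_derive t 1 (vel v) (- f (sol v t)).
Proof. by rewrite /sol /vel; case: (projT2 flow_sig) => _ _ h _; exact: h. Qed.

Lemma sol_contv t : 0 <= t -> continuous (sol ^~ t).
Proof. by rewrite /sol; case: (projT2 flow_sig) => _ _ _; exact. Qed.

Lemma dlin c t : is_derive t 1 (fun x => c * x) c.
Proof. exact: is_derive_eq (dZ c (dI t)) (mulr1 _). Qed.

Lemma vel_le v t : 0 <= t -> vel v t <= v.
Proof.
move=> t0.
have d1 x : 0 <= x <= t -> is_derive x 1 (vel v) (- f (sol v x)).
  by move=> /andP[x0 _]; exact: d_vel.
have := dcmp_le t0 d1 (fun x _ => dC x 0); rewrite vel0 subrr => h.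
by rewrite -subr_le0; apply: h => x _; rewrite oppr_le0 ltW// force_gt0.
Qed.

Lemma vel_ge v t : 0 <= t -> v - force_max p * t <= vel v t.
Proof.
move=> t0.
have d1 x : 0 <= x <= t -> is_derive x 1 (vel v) (- f (sol v x)).
  by move=> /andP[x0 _]; exact: d_vel.
have := dcmp_le t0 (fun x _ => dlin (- force_max p) x) d1; rewrite vel0 mulr0 subr0 => h.
suff : - force_max p * t <= vel v t - v by lra.
by apply: h => x _; rewrite lerN2 force_le.
Qed.

(** Shooting: the force is bounded, so slow and fast initial velocities
    undershoot and overshoot any target. *)
Lemma two_point s y : 0 < s -> exists v, sol v s = y.
Proof.
move=> s0; have s0' := ltW s0; have F0 := fmax_ge0.
have up v : sol v s <= v * s.
  have := dcmp_le s0' (fun x _ => d_sol v x) (fun x _ => dlin v x).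
  by rewrite sol0 mulr0 !subr0; apply=> x /andP[x0 _]; exact: vel_le.
have lo v : (v - force_max p * s) * s <= sol v s.
  have := dcmp_le s0' (fun x _ => dlin (v - force_max p * s) x) (fun x _ => d_sol v x).
  rewrite sol0 mulr0 !subr0; apply=> x /andP[x0 xs].
  apply: (le_trans _ (vel_ge v x0)).
  by rewrite lerD2l lerN2 ler_wpM2l.
have le12 : y / s <= y / s + force_max p * s by rewrite lerDl mulr_ge0.
have h1 := up (y / s); rewrite divfK ?gt_eqF// in h1.
have h2 := lo (y / s + force_max p * s); rewrite addrK divfK ?gt_eqF// in h2.
have [|w _ e] := @IVT R (sol ^~ s) _ _ y le12
  (continuous_subspaceT (@sol_contv s s0')); last by exists w.
by apply/andP; split; [rewrite ge_min|rewrite le_max]; apply/orP; [left|right].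
Qed.

End picard.

(** * Least action *)

Section mechanics.
Context {R : realType} (p : convex_potential R).
Local Notation f := (force p).
Local Notation Q := (pot p).
Local Notation sol := (sol p).
Local Notation vel := (vel p).
Implicit Types (v t s y a b c tau : R).

Lemma pot_cont : continuous Q.
Proof. by move=> y; apply: is_derive_cont (pot_derive p y). Qed.

Lemma pot_tangent y z : Q y - f y * (z - y) <= Q z.
Proof.
case: (leP y z) => [yz|/ltW zy].
  have := dcmp_le yz (fun x _ => dlin (- f y) x) (fun x _ => pot_derive p x) => h.
  suff : - f y * z - - f y * y <= Q z - Q y by lra.
  by apply: h => x /andP[yx _]; rewrite lerN2 force_nincr.
have := dcmp_le zy (fun x _ => pot_derive p x) (fun x _ => dlin (- f y) x) => h.
suff : Q y - Q z <= - f y * y - - f y * z by lra.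
by apply: h => x /andP[_ xy]; rewrite lerN2 force_nincr.
Qed.

Lemma pot_upper y z : Q z <= Q y - f y * (z - y) + force_lip p * (z - y) ^+ 2.
Proof.
have k0 := force_lip_gt0 p.
have := pot_tangent z y => h.
suff : (f y - f z) * (z - y) <= force_lip p * (z - y) ^+ 2 by lra.
apply: (le_trans (ler_norm _)); rewrite normrM.
have -> : (z - y) ^+ 2 = `|z - y| * `|z - y|.
  by rewrite -normrM -expr2 ger0_norm ?sqr_ge0.
by rewrite mulrA ler_wpM2r// [`|z - y|]distrC forceL.
Qed.

Lemma pot_le y z : y <= z -> Q z <= Q y.
Proof.
move=> yz; have := dcmp_le yz (fun x _ => pot_derive p x) (fun x _ => dC x 0).
rewrite subrr subr_le0; apply=> x _; by rewrite oppr_le0 ltW// force_gt0.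
Qed.

Lemma sol_cont v : continuous (sol v).
Proof. by move=> t; apply: is_derive_cont (d_sol p v t). Qed.

Lemma potsol_cont v : continuous (Q \o sol v).
Proof. by move=> t; apply: continuous_comp; [exact: sol_cont|exact: pot_cont]. Qed.

(** The Lagrangian is kinetic part plus [pot], so the conserved quantity is their
    difference. *)
Definition en v : R := v ^+ 2 / 2 - Q 0.
Definition potint v t : R := prim (Q \o sol v) t.
(** By conservation of energy, the integral of the Lagrangian along a solution. *)
Definition act v t : R := 2 * potint v t + en v * t.

Lemma dX2 t (g : R -> R) a : is_derive t 1 g a ->
  is_derive t 1 (fun x => g x ^+ 2) (2 * g t * a).
Proof.
move=> da; apply: is_derive_eq (dM da da) _ => //.
by ring.
Qed.

Lemma energy v t : 0 <= t -> vel v t ^+ 2 / 2 - Q (sol v t) = en v.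
Proof.
move=> t0.
have d1 x : 0 <= x <= t ->
    is_derive x 1 (fun x => 2^-1 * vel v x ^+ 2 - Q (sol v x)) 0.
  move=> /andP[x0 _].
  have dv := dZ 2^-1 (dX2 (d_vel p v x0)).
  have dq := dcomp (d_sol p v x) (pot_derive p (sol v x)).
  by apply: is_derive_eq (dB dv dq) _; field.
have := deriv_eq t0 d1 (fun x _ => dC x 0); rewrite subrr => /eqP.
rewrite subr_eq0 => /eqP; rewrite vel0 sol0 => E.
by rewrite mulrC E /en mulrC.
Qed.

Lemma d_potint v t : is_derive t 1 (potint v) (Q (sol v t)).
Proof. exact: is_derive_primc (@potsol_cont v). Qed.

Lemma d_act v t : 0 <= t -> is_derive t 1 (act v) (vel v t ^+ 2 / 2 + Q (sol v t)).
Proof.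
move=> t0; apply: is_derive_eq (dD (dZ 2 (d_potint v t)) (dlin (en v) t)) _.
by rewrite -(energy v t0); ring.
Qed.

Lemma potint0 v : potint v 0 = 0. Proof. exact: prim0. Qed.
Lemma act0 v : act v 0 = 0. Proof. by rewrite /act potint0 !mulr0 addr0. Qed.

Lemma potint_ge0 v t : 0 <= t -> 0 <= potint v t.
Proof.
move=> t0; have := dmono_le t0 (fun x _ => d_potint v x).
by rewrite potint0; apply=> x _; exact: pot_ge0.
Qed.

Lemma actE v t : act v t = 2 * potint v t + en v * t. Proof. by []. Qed.

Lemma act_mono v a b : 0 <= a -> a <= b -> act v a <= act v b.
Proof.
move=> a0 ab.
apply: (dmono_le (f := fun x => vel v x ^+ 2 / 2 + Q (sol v x)) ab) => x /andP[ax _].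
  by apply: d_act; exact: le_trans a0 ax.
by rewrite addr_ge0 ?pot_ge0// divr_ge0// sqr_ge0.
Qed.

Lemma act_ge0 v t : 0 <= t -> 0 <= act v t.
Proof. by move=> t0; rewrite -(act0 v); exact: act_mono. Qed.

Lemma dshift t tau (g : R -> R) l : is_derive (t - tau) 1 g l ->
  is_derive t 1 (fun x => g (x - tau)) l.
Proof.
move=> dg; have h := dB (dI t) (dC t tau).
by apply: is_derive_eq (dcomp h dg) _; rewrite subr0 mulr1.
Qed.

(** [Phi] increases at least at the rate of the action. The inequality allows for
    crude bounds along simple curves, such as straight lines. *)
Definition curve_cost (chi Phi : R -> R) a b : Prop :=
  [/\ {within `[a, b], continuous chi}, {within `[a, b], continuous Phi}
    & exists chi' phi : R -> R, forall t, a < t < b ->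
      [/\ is_derive t 1 chi (chi' t), is_derive t 1 Phi (phi t)
        & chi' t ^+ 2 / 2 + Q (chi t) <= phi t]].

(** Convexity of the Lagrangian: a solution of Newton's equation minimizes, up
    to boundary terms. *)
Lemma curve_cost_ge v tau a b (chi Phi : R -> R) : tau <= a -> a <= b ->
  curve_cost chi Phi a b ->
  act v (b - tau) - act v (a - tau)
  + vel v (b - tau) * (chi b - sol v (b - tau))
  - vel v (a - tau) * (chi a - sol v (a - tau)) <= Phi b - Phi a.
Proof.
move=> ta ab [cchi cPhi [chi' [phi H]]].
pose F t := Phi t - (act v (t - tau) + vel v (t - tau) * (chi t - sol v (t - tau))).
suff : F a <= F b by rewrite /F; lra.
have dsol t : is_derive t 1 (fun t => sol v (t - tau)) (vel v (t - tau)).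
  by apply: dshift; exact: d_sol.
have dvel t : a <= t -> is_derive t 1 (fun t => vel v (t - tau)) (- f (sol v (t - tau))).
  by move=> at_; apply: dshift; apply: d_vel; rewrite subr_ge0 (le_trans ta).
have dact t : a <= t -> is_derive t 1 (fun t => act v (t - tau))
    (vel v (t - tau) ^+ 2 / 2 + Q (sol v (t - tau))).
  by move=> at_; apply: dshift; apply: d_act; rewrite subr_ge0 (le_trans ta).
apply: (mono_le (f := fun t => phi t - (vel v (t - tau) ^+ 2 / 2 + Q (sol v (t - tau))
  + (- f (sol v (t - tau)) * (chi t - sol v (t - tau))
     + vel v (t - tau) * (chi' t - vel v (t - tau)))))) => //.
- have cs : {within `[a, b], continuous (fun t => sol v (t - tau))}.
    by apply: within_cont => x /andP[ax _]; exact: is_derive_cont (dsol x).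
  have cv : {within `[a, b], continuous (fun t => vel v (t - tau))}.
    by apply: within_cont => x /andP[ax _]; exact: is_derive_cont (dvel x ax).
  have ca : {within `[a, b], continuous (fun t => act v (t - tau))}.
    by apply: within_cont => x /andP[ax _]; exact: is_derive_cont (dact x ax).
  move=> x; apply: cvgB; first exact: cPhi.
  apply: cvgD; first exact: ca.
  apply: cvgM; first exact: cv.
  by apply: cvgB; [exact: cchi|exact: cs].
- move=> t /[dup] tab /andP[/ltW at_ _]; have [d1 d2 _] := H t tab.
  exact: (dB d2 (dD (dact t at_) (dM (dvel t at_) (dB d1 (dsol t))))).
- move=> t /[dup] tab /andP[/ltW at_ _]; have [_ _ h] := H t tab.
  have h2 := pot_tangent (sol v (t - tau)) (chi t).
  have h3 : 0 <= (chi' t - vel v (t - tau)) ^+ 2 by exact: sqr_ge0.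
  move: h h2 h3; set x := chi' t; set w := vel _ _; set ff := f _.
  set q := Q _; set q' := Q _; set z := chi t - _; nra.
Qed.

Lemma sol_curve v tau a b : tau <= a -> a <= b ->
  curve_cost (fun t => sol v (t - tau)) (fun t => act v (t - tau)) a b.
Proof.
move=> ta ab; have tg t : a <= t -> 0 <= t - tau by move=> ?; rewrite subr_ge0 (le_trans ta).
split.
- apply: within_cont => x /andP[ax _].
  by apply: is_derive_cont (dshift (d_sol p v (x - tau))).
- apply: within_cont => x /andP[ax _].
  by apply: is_derive_cont (dshift (d_act v (tg _ ax))).
exists (fun t => vel v (t - tau)).
exists (fun t => vel v (t - tau) ^+ 2 / 2 + Q (sol v (t - tau))).
move=> t /andP[/ltW at_ _]; split => //.
  by apply: dshift; exact: d_sol.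
by apply: dshift; exact: d_act (tg _ at_).
Qed.

Lemma shoot_sig s y : {v | 0 < s -> sol v s = y}.
Proof.
apply: cid; have [s0|s0] := ltP 0 s; last by exists 0.
by have [v e] := two_point p y s0; exists v.
Qed.

Definition shoot s y : R := projT1 (shoot_sig s y).

Lemma shootE s y : 0 < s -> sol (shoot s y) s = y.
Proof. exact: (projT2 (shoot_sig s y)). Qed.

(** Any initial velocity that reaches y at time s gives the same action, the
    least one, by [curve_cost_ge]. *)
Definition cost s y : R := act (shoot s y) s.

Lemma cost0 y : cost 0 y = 0. Proof. exact: act0. Qed.

Lemma cost_ge0 s y : 0 <= s -> 0 <= cost s y.
Proof. exact: act_ge0. Qed.

(** Going on along any curve from the end of an optimal motion costs at least
    as much as the optimal motion to the end of the curve. *)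
Lemma cost_extend tau a b (chi Phi : R -> R) : tau <= a -> a <= b ->
  (tau = a -> chi a = 0) -> curve_cost chi Phi a b ->
  cost (b - tau) (chi b) <= cost (a - tau) (chi a) + (Phi b - Phi a).
Proof.
move=> ta ab h0 cc.
have [tb|] := ltP tau b; last first.
  move=> bt; have ? : a = b by apply/eqP; rewrite eq_le ab (le_trans bt ta).
  by subst b; rewrite (subrr (Phi a)) addr0.
set v := shoot (b - tau) (chi b).
have e : sol v (b - tau) = chi b by apply: shootE; rewrite subr_gt0.
have h := curve_cost_ge v ta ab cc; rewrite e (subrr (chi b)) mulr0 addr0 in h.
suff : act v (a - tau) + vel v (a - tau) * (chi a - sol v (a - tau))
       <= cost (a - tau) (chi a) by rewrite /cost -/v; lra.
have [ta'|at'] := ltP tau a; last first.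
  have ? : tau = a by apply/eqP; rewrite eq_le ta at'.
  by subst tau; rewrite (subrr a) act0 cost0 h0// sol0 (subrr 0) mulr0 addr0.
set w := shoot (a - tau) (chi a).
have ew : sol w (a - tau) = chi a by apply: shootE; rewrite subr_gt0.
have := curve_cost_ge v (lexx tau) ta (sol_curve w (lexx tau) ta).
by rewrite ew (subrr tau) !sol0 !act0 (subrr 0) mulr0 !subr0.
Qed.

Lemma cost_le a b (chi Phi : R -> R) : a <= b -> chi a = 0 ->
  curve_cost chi Phi a b -> cost (b - a) (chi b) <= Phi b - Phi a.
Proof.
move=> ab h0 cc; have := cost_extend (lexx a) ab (fun _ => h0) cc.
by rewrite (subrr a) cost0 add0r.
Qed.

Lemma cost_sol v t : 0 <= t -> cost t (sol v t) <= act v t.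
Proof.
move=> t0; have := cost_le t0 _ (sol_curve v (lexx 0) t0).
by rewrite !subr0 sol0 act0 subr0; apply.
Qed.

(** Convexity in the final position, with the final velocity as slope. *)
Lemma cost_tangent s y z : 0 < s ->
  cost s y + vel (shoot s y) s * (z - y) <= cost s z.
Proof.
move=> s0; set v := shoot s y.
have := curve_cost_ge v (lexx 0) (ltW s0) (sol_curve (shoot s z) (lexx 0) (ltW s0)).
by rewrite !subr0 !shootE// !act0 !sol0 (subrr 0) mulr0 !subr0.
Qed.

(** Running through an optimal motion in another time multiplies the kinetic part
    of the action by s / s' and its potential part by s' / s. *)
Lemma cost_scale s s' y v : 0 < s -> 0 < s' -> v = shoot s y ->
  cost s' y <= s / s' * (potint v s + en v * s) + s' / s * potint v s.
Proof.
move=> s0 s0' vE; pose k := s / s'.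
have k0 : 0 < k by rewrite divr_gt0.
have dk t : is_derive t 1 (fun t => k * t) k by exact: dlin.
pose chi t := sol v (k * t).
pose Phi t := k * (potint v (k * t) + en v * (k * t)) + k^-1 * potint v (k * t).
have dchi t : is_derive t 1 chi (vel v (k * t) * k).
  exact: dcomp (dk t) (d_sol p v _).
have dpi t : is_derive t 1 (fun t => potint v (k * t)) (Q (sol v (k * t)) * k).
  exact: dcomp (dk t) (d_potint v _).
have dPhi t : is_derive t 1 Phi (k * (Q (sol v (k * t)) * k + en v * k)
    + k^-1 * (Q (sol v (k * t)) * k)).
  apply: dD; apply: dZ => //; apply: dD => //; exact: dZ (dk t).
have cc : curve_cost chi Phi 0 s'.
  split.
  - by apply: within_cont => x _; exact: is_derive_cont (dchi x).
  - by apply: within_cont => x _; exact: is_derive_cont (dPhi x).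
  do 2 eexists; move=> t /andP[t0 _]; split; [exact: dchi|exact: dPhi|].
  have kt : 0 <= k * t by rewrite mulr_ge0// ltW.
  rewrite -(energy v kt) /chi.
  rewrite le_eqVlt; apply/orP; left; apply/eqP; field.
  by rewrite gt_eqF.
have e : k * s' = s by rewrite /k divfK// gt_eqF.
have := cost_le (ltW s0') _ cc; rewrite /chi /Phi mulr0 sol0 => /(_ erefl).
rewrite e potint0 !(mulr0, addr0, subr0) vE shootE//.
by rewrite /k invf_div.
Qed.

Lemma kinint_ge0 v t : 0 <= t -> 0 <= potint v t + en v * t.
Proof.
move=> t0.
have d x : 0 <= x <= t ->
    is_derive x 1 (fun t => potint v t + en v * t) (Q (sol v x) + en v).
  by move=> _; apply: dD; [exact: d_potint|exact: dlin].
have := dmono_le t0 d; rewrite potint0 mulr0 addr0; apply=> x /andP[x0 _].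
by rewrite -(energy v x0) addrC subrK divr_ge0 ?sqr_ge0.
Qed.

Lemma cost_scale_le s s' y : 0 < s -> 0 < s' -> s' <= 2 * s -> s <= 2 * s' ->
  cost s' y - cost s y <= 2 / s * cost s y * `|s' - s|.
Proof.
move=> s0 s0' h1 h2; have := cost_scale s0 s0' (erefl (shoot s y)).
rewrite /cost; move: (shoot s y) => v; set k := potint v s + _; set q := potint v s.
have k0 : 0 <= k by exact: kinint_ge0 (ltW _).
have q0 : 0 <= q by exact: potint_ge0 (ltW _).
have -> : act v s = k + q by rewrite actE /k /q; ring.
move=> h; apply: (le_trans (lerB h (lexx _))).
have a1 : s / s' - 1 <= 2 / s * `|s' - s|.
  have -> : s / s' - 1 = (s - s') / s' by field; rewrite gt_eqF.
  rewrite ler_pdivrMr//.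
  have h3 : 1 <= 2 / s * s' by rewrite mulrAC ler_pdivlMr// mul1r.
  apply: (le_trans (ler_norm _)); rewrite distrC mulrAC ler_peMl//.
have a2 : s' / s - 1 <= 2 / s * `|s' - s|.
  have -> : s' / s - 1 = (s' - s) / s by field; rewrite gt_eqF.
  rewrite mulrAC ler_pM2r ?invr_gt0//.
  have := ler_norm (s' - s); have := normr_ge0 (s' - s); lra.
have := ler_wpM2r k0 a1; have := ler_wpM2r q0 a2.
have -> : 2 / s * (k + q) * `|s' - s| = 2 / s * `|s' - s| * (k + q) by ring.
set z := 2 / s * `|s' - s|; move: (s / s') (s' / s) => x1 x2; lra.
Qed.

Lemma cost_conts y s : 0 < s -> {for s, continuous (cost ^~ y)}.
Proof.
move=> s0; have c0 : 0 <= cost s y := cost_ge0 y (ltW s0).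
have K0 : 0 <= 8 / s * cost s y by rewrite mulr_ge0// divr_ge0// ltW.
apply: (lip_cont K0 (divr_gt0 s0 (ltr0n _ 2))) => s' hs.
have [h1 h2] : s / 2 < s' /\ s' < 3 / 2 * s by move: hs; rewrite ltr_norml; lra.
have s0' : 0 < s' by lra.
have c0' : 0 <= cost s' y := cost_ge0 y (ltW s0').
have g1 : s' <= 2 * s by lra.
have g2 : s <= 2 * s' by lra.
have u1 := cost_scale_le y s0 s0' g1 g2.
have u2 := cost_scale_le y s0' s0 g2 g1.
rewrite distrC in u1.
have ss : `|s - s'| <= s / 2 by exact: ltW.
have inv : 2 / s' <= 4 / s.
  by rewrite ler_pdivrMr// mulrAC ler_pdivlMr//; lra.
have b1 : cost s' y <= 2 * cost s y.
  have : 2 / s * cost s y * `|s - s'| <= 2 / s * cost s y * (s / 2).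
    by rewrite ler_wpM2l// mulr_ge0// divr_ge0// ltW.
  have -> : 2 / s * cost s y * (s / 2) = cost s y by field; rewrite gt_eqF.
  lra.
have b2 : 2 / s' * cost s' y <= 8 / s * cost s y.
  have := ler_pM _ c0' inv b1 => h; apply: (le_trans (h _)).
    by rewrite divr_ge0// ltW.
  by rewrite le_eqVlt; apply/orP; left; apply/eqP; ring.
have b3 : 2 / s * cost s y <= 8 / s * cost s y.
  by rewrite ler_wpM2r// ler_wpM2r ?invr_ge0 ?(ltW s0)// ler_nat.
have n0 := normr_ge0 (s - s').
have := ler_wpM2r n0 b2; have := ler_wpM2r n0 b3.
by rewrite ler_norml; set z := `|s - s'| in u1 u2 *; lra.
Qed.

(** Adding a linear ramp to the end of an optimal motion, during a time l, changes
    its end; hence the bound is uniform for durations above l. *)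
Lemma cost_semiconcave l s y z : 0 < l -> l <= s ->
  cost s z <= cost s y + vel (shoot s y) s * (z - y)
              + ((2 * l)^-1 + force_lip p * l) * (z - y) ^+ 2.
Proof.
move=> l0 ls; have s0 : 0 < s by lra.
set v := shoot s y; set eta := z - y; set kap := force_lip p.
have kap0 : 0 < kap := force_lip_gt0 p.
pose th t := eta / l * (t - (s - l)).
pose chi t := sol v t + th t.
pose K := (eta / l) ^+ 2 / 2 + kap * eta ^+ 2.
pose Phi t := act v t + vel v t * th t + K * t.
have a0 : 0 <= s - l by lra.
have ab : s - l <= s by lra.
have dth t : is_derive t 1 th (eta / l).
  apply: is_derive_eq (dZ (eta / l) (dB (dI t) (dC t _))) _.
  by rewrite subr0 mulr1.
have dchi t : is_derive t 1 chi (vel v t + eta / l).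
  exact: (dD (d_sol p v t) (dth t)).
have dPhi t : s - l <= t -> is_derive t 1 Phi (vel v t ^+ 2 / 2 + Q (sol v t)
    + (- f (sol v t) * th t + vel v t * (eta / l)) + K).
  move=> st; have t0 : 0 <= t by lra.
  exact: (dD (dD (d_act v t0) (dM (d_vel p v t0) (dth t))) (dlin K t)).
have cc : curve_cost chi Phi (s - l) s.
  split.
  - by apply: within_cont => x _; exact: is_derive_cont (dchi x).
  - by apply: within_cont => x /andP[ax _]; exact: is_derive_cont (dPhi x ax).
  do 2 eexists; move=> t /andP[t1 t2]; split; [exact: dchi|exact: dPhi (ltW t1)|].
  have := pot_upper (sol v t) (chi t); rewrite -/kap /chi [sol v t + _ - _]addrAC (subrr (sol v t)) add0r.
  have : th t ^+ 2 <= eta ^+ 2.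
    rewrite -(real_normK (num_real (th t))) -(real_normK (num_real eta)) ler_sqr ?nnegrE//.
    rewrite /th -mulrA normrM ler_piMr// normrM gtr0_norm ?invr_gt0//.
    rewrite gtr0_norm; last by lra.
    by rewrite mulrC ler_pdivrMr// mul1r; lra.
  move=> h; have := ler_wpM2l (ltW kap0) h; rewrite /K.
  by set w := vel v t; set x := eta / l; set q1 := Q _; set q2 := Q _; set T := th t; nra.
have h0 : 0 = s - l -> chi (s - l) = 0.
  by move=> e; rewrite /chi -e sol0 /th -e (subrr 0) mulr0 addr0.
have := cost_extend a0 ab h0 cc; rewrite !subr0.
have thl : th (s - l) = 0 by rewrite /th (subrr (s - l)) mulr0.
have ths : th s = eta by rewrite /th opprB addrC subrK divfK// gt_eqF.
have -> : chi s = z by rewrite /chi ths shootE// /eta addrC subrK.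
have -> : chi (s - l) = sol v (s - l) by rewrite /chi thl addr0.
have := cost_sol v a0; rewrite /Phi thl ths mulr0 addr0 /cost -/v.
have -> : K * s = K * (s - l) + ((2 * l)^-1 + kap * l) * eta ^+ 2.
  by rewrite /K; field; rewrite gt_eqF.
set A := K * (s - l); lra.
Qed.

End mechanics.

(** * Loops at the wall and the speed of light *)

Section mechanics2.
Context {R : realType} (p : convex_potential R).
Local Notation f := (force p).
Local Notation Q := (pot p).
Local Notation sol := (sol p).
Local Notation vel := (vel p).
Local Notation act := (act p).
Local Notation en := (en p).
Local Notation cost := (cost p).
Local Notation shoot := (shoot p).
Implicit Types (v t s y a b c tau : R).

Lemma vel_decr v a b : 0 <= a -> a < b -> vel v b < vel v a.
Proof.
move=> a0 ab; rewrite -ltrN2.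
apply: (dmono_lt (F := fun x => - vel v x) (f := fun x => f (sol v x)) ab) => x /andP[ax _].
  by apply: is_derive_eq (dN (d_vel p v (le_trans a0 ax))) _; rewrite opprK.
exact: force_gt0.
Qed.

(** The force points to the origin, so a motion between two nonnegative
    positions never becomes negative. *)
Lemma sol_gt0 v s t : 0 < t -> t < s -> 0 <= sol v s -> 0 < sol v t.
Proof.
move=> t0 ts ys; rewrite ltNge; apply/negP => yt.
have D x : is_derive x (1 : R) (sol v) (vel v x) by exact: d_sol.
have C a b : {within `[a, b], continuous (sol v)}.
  by apply: within_cont => x _; exact: is_derive_cont (D x).
have [x1 /[!in_itv]/= /andP[x10 x1t] e1] := MVT t0 (fun x _ => D x) (@C 0 t).
have [x2 /[!in_itv]/= /andP[x2t x2s] e2] := MVT ts (fun x _ => D x) (@C t s).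
rewrite sol0 !subr0 in e1.
have h1 : vel v x1 <= 0.
  by rewrite -(pmulr_lle0 _ t0) -e1.
have h2 : 0 <= vel v x2.
  by rewrite -(pmulr_lge0 _ (_ : 0 < s - t)) ?subr_gt0// -e2 subr_ge0 (le_trans yt).
have := vel_decr v (ltW x10) (lt_trans x1t x2t); lra.
Qed.

Lemma sol_ge0 v s t : 0 <= t -> t <= s -> 0 <= sol v s -> 0 <= sol v t.
Proof.
rewrite le_eqVlt => /predU1P[<-|t0]; first by rewrite sol0.
rewrite le_eqVlt => /predU1P[->//|ts] h; exact/ltW/(sol_gt0 t0 ts h).
Qed.

Lemma cost_le_line s y : 0 < s -> 0 <= y ->
  cost s y <= y ^+ 2 / (2 * s) + Q 0 * s.
Proof.
move=> s0 y0; pose k := y / s.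
have cc : curve_cost p (fun t => k * t) (fun t => (k ^+ 2 / 2 + Q 0) * t) 0 s.
  split; try by apply: within_cont => x _; exact: is_derive_cont (dlin _ x).
  do 2 eexists; move=> t /andP[t0 _]; split; [exact: dlin|exact: dlin|].
  by rewrite lerD2l pot_le// mulr_ge0 ?divr_ge0// ltW.
have := cost_le (ltW s0) (mulr0 k) cc; rewrite !(mulr0, subr0) divfK ?gt_eqF//.
move=> h; apply: (le_trans h); rewrite le_eqVlt; apply/orP; left; apply/eqP.
by rewrite /k; field; rewrite gt_eqF.
Qed.

Lemma cost_ge_kin s y : 0 < s -> y ^+ 2 / (2 * s) <= cost s y.
Proof.
move=> s0; rewrite /(cost s y); have := shootE p y s0; move: (shoot s y) => v yE.
pose k := y / s.
have dF x : 0 <= x <= s ->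
    is_derive x 1 (fun t => k * sol v t - (k ^+ 2 / 2) * t) (k * vel v x - k ^+ 2 / 2).
  by move=> _; exact: (dB (dZ k (d_sol p v x)) (dlin _ x)).
have dG x : 0 <= x <= s -> is_derive x 1 (act v) (vel v x ^+ 2 / 2 + Q (sol v x)).
  by move=> /andP[x0 _]; exact: d_act.
have := dcmp_le (ltW s0) dF dG; rewrite yE sol0 act0 !(mulr0, subr0) => h.
apply: le_trans (h _).
  by rewrite le_eqVlt; apply/orP; left; apply/eqP; rewrite /k; field; rewrite gt_eqF.
move=> x _; have := pot_ge0 p (sol v x); move: (vel v x) (Q _) => w q.
by have := sqr_ge0 (w - k); nra.
Qed.

Definition loop s : R := cost s 0.

Lemma loop_ge0 s : 0 <= s -> 0 <= loop s.
Proof. exact: cost_ge0. Qed.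

Lemma loop_le s : 0 <= s -> loop s <= Q 0 * s.
Proof.
rewrite le_eqVlt => /predU1P[<-|s0]; first by rewrite mulr0 /loop cost0.
by have := cost_le_line s0 (lexx 0); rewrite expr0n mul0r add0r.
Qed.

(** Two loops whose time intervals interlace meet; exchanging them there gives
    one longer and one shorter motion. *)
Lemma loop_monge p1 p2 q1 q2 : p1 <= p2 -> p2 <= q1 -> q1 <= q2 ->
  loop (q2 - p1) + loop (q1 - p2) <= loop (q1 - p1) + loop (q2 - p2).
Proof.
move=> p12 pq q12.
have [e1|n1] := eqVneq p1 q1.
  have e2 : p2 = p1 by lra.
  by rewrite e2 -e1 addrC.
have [e2|n2] := eqVneq p2 q2.
  have e1 : q1 = p2 by lra.
  by rewrite e1 -e2.
have lt1 : 0 < q1 - p1 by rewrite subr_gt0 lt_neqAle n1 (le_trans p12).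
have lt2 : 0 < q2 - p2 by rewrite subr_gt0 lt_neqAle n2 (le_trans pq).
have z1 := shootE p 0 lt1; have z2 := shootE p 0 lt2.
have -> : loop (q1 - p1) = act (shoot (q1 - p1) 0) (q1 - p1) by [].
have -> : loop (q2 - p2) = act (shoot (q2 - p2) 0) (q2 - p2) by [].
move: (shoot (q1 - p1) 0) z1 (shoot (q2 - p2) 0) z2 => v1 z1 v2 z2.
pose g1 t := sol v1 (t - p1); pose g2 t := sol v2 (t - p2).
have cg v tau : continuous (fun t => sol v (t - tau)).
  by move=> x; apply: is_derive_cont (dshift (d_sol p v (x - tau))).
have cD : {within `[p2, q1], continuous (fun t => g1 t - g2 t)}.
  by apply: continuous_subspaceT => x; apply: cvgB; exact: cg.
have [|c /[!in_itv]/= /andP[pc cq] ec] := @IVT R (fun t => g1 t - g2 t) p2 q1 0 pq cD.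
  have f1 : g1 q1 - g2 q1 <= 0.
    rewrite /g1 /g2 z1 sub0r oppr_le0.
    have a1 : 0 <= q1 - p2 by rewrite subr_ge0.
    have a2 : q1 - p2 <= q2 - p2 by rewrite lerD2r.
    have a3 : 0 <= sol v2 (q2 - p2) by rewrite z2.
    exact: (sol_ge0 a1 a2 a3).
  have f2 : 0 <= g1 p2 - g2 p2.
    rewrite /g1 /g2 (subrr p2) sol0 subr0.
    have a1 : 0 <= p2 - p1 by rewrite subr_ge0.
    have a2 : p2 - p1 <= q1 - p1 by rewrite lerD2r.
    have a3 : 0 <= sol v1 (q1 - p1) by rewrite z1.
    exact: (sol_ge0 a1 a2 a3).
  by apply/andP; split; [rewrite ge_min|rewrite le_max]; apply/orP; [right|left].
move/eqP: ec; rewrite subr_eq0 => /eqP ec.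
have h1 : loop (q2 - p1) <= act v1 (c - p1) + (act v2 (q2 - p2) - act v2 (c - p2)).
  have a1 : p1 <= c by lra.
  have a2 : c <= q2 by lra.
  have := cost_extend a1 a2 _ (sol_curve p v2 pc a2); rewrite z2 -/(loop _) => h.
  apply: le_trans (h _) _; first by move=> e; rewrite -/(g2 c) -ec /g1 e (subrr c) sol0.
  rewrite lerD2r -/(g2 c) -ec; apply: cost_sol; lra.
have h2 : loop (q1 - p2) <= act v2 (c - p2) + (act v1 (q1 - p1) - act v1 (c - p1)).
  have a1 : p1 <= c by lra.
  have := cost_extend pc cq _ (sol_curve p v1 a1 cq); rewrite z1 -/(loop _) => h.
  apply: le_trans (h _) _; first by move=> e; rewrite -/(g1 c) ec /g2 e (subrr c) sol0.
  rewrite lerD2r -/(g1 c) ec; apply: cost_sol; lra.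
move: h1 h2; move: (loop _) (loop _) (act v1 _) (act v2 _) (act v1 _) (act v2 _).
by move=> *; lra.
Qed.

(** [loop_monge] makes [loop] concave along arithmetic progressions: a decrease
    would repeat itself for ever, against [loop_ge0]. *)
Lemma loop_nondecr a b : 0 <= a -> a <= b -> loop a <= loop b.
Proof.
move=> a0 ab; rewrite leNgt; apply/negP => h.
pose x := b - a; pose u n := loop (a + n%:R * x).
have x0 : 0 <= x by rewrite subr_ge0.
have u_ge0 n : 0 <= u n by rewrite loop_ge0// addr_ge0// mulr_ge0.
have conc n : u n.+2 + u n <= u n.+1 + u n.+1.
  have nx : 0 <= n%:R * x by rewrite mulr_ge0.
  have := @loop_monge 0 x (a + n.+1%:R * x) (a + n.+2%:R * x).
  rewrite /u -!natr1 !mulrDl !mul1r !subr0.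
  have -> : a + (n%:R * x + x) - x = a + n%:R * x by ring.
  have -> : a + (n%:R * x + x + x) - x = a + (n%:R * x + x) by ring.
  by apply; lra.
pose d := u 0%N - u 1%N.
have d0 : 0 < d.
  rewrite /d /u mul0r addr0 /x (_ : a + 1%:R * (b - a) = b) ?subr_gt0//.
  by rewrite mulr1n; ring.
have dec n : u n.+1 <= u n - d.
  by elim: n => [|n IH]; [rewrite /d; lra|have := conc n; lra].
have lin n : u n <= u 0%N - n%:R * d.
  elim: n => [|n IH]; first by rewrite mul0r subr0.
  by have := dec n; rewrite -natr1 mulrDl mul1r; lra.
have [N hN] : exists N, u 0%N / d < N%:R.
  by exists (Num.bound (u 0%N / d)); apply: archi_boundP; rewrite divr_ge0// ltW.
have := lin N; have := u_ge0 N; move: hN; rewrite ltr_pdivrMr//; lra.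
Qed.

(** The speed at energy 1/2, which is that of light. *)
Definition cspeed y : R := Num.sqrt (1 + 2 * Q y).

Lemma cspeed2 y : cspeed y ^+ 2 = 1 + 2 * Q y.
Proof. by rewrite sqr_sqrtr// addr_ge0// mulr_ge0// pot_ge0. Qed.

Lemma cspeed_gt0 y : 0 < cspeed y.
Proof. by rewrite sqrtr_gt0 ltr_wpDr// mulr_ge0// pot_ge0. Qed.

Lemma icspeed_cont : continuous (fun y => (cspeed y)^-1).
Proof.
move=> y; apply: continuousV; first by rewrite gt_eqF ?cspeed_gt0.
apply: (@continuous_comp _ _ _ (fun y => 1 + 2 * Q y) Num.sqrt); last exact: sqrt_continuous.
apply: cvgD; first exact: cvg_cst.
by apply: cvgM; [exact: cvg_cst|exact: pot_cont].
Qed.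

(** The travel time of light from 0 to y. *)
Definition light y : R := prim (fun y => (cspeed y)^-1) y.

Lemma d_light y : is_derive y 1 light (cspeed y)^-1.
Proof. exact: (is_derive_primc y icspeed_cont). Qed.

Lemma light0 : light 0 = 0. Proof. exact: prim0. Qed.

Lemma light_lt y z : y < z -> light y < light z.
Proof.
move=> yz; apply: (dmono_lt yz (fun x _ => d_light x)) => x _.
by rewrite invr_gt0 cspeed_gt0.
Qed.

Lemma light_gt0 y : 0 < y -> 0 < light y.
Proof. by move=> y0; rewrite -light0 light_lt. Qed.

Lemma vel2 v t : 0 <= t -> vel v t ^+ 2 = 2 * en v + 2 * Q (sol v t).
Proof. by move=> t0; rewrite -(energy p v t0); field. Qed.

Lemma d_lightsol v t : is_derive t 1 (fun t => light (sol v t))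
  (vel v t / cspeed (sol v t)).
Proof.
by apply: is_derive_eq (dcomp (d_sol p v t) (d_light (sol v t))) _; rewrite mulrC.
Qed.

Lemma subluminal_time v s : 0 <= s -> en v <= 2^-1 -> light (sol v s) <= s.
Proof.
move=> s0 e1.
have := dcmp_le s0 (fun x _ => d_lightsol v x) (fun x _ => dI x).
rewrite sol0 light0 !subr0; apply=> x /andP[x0 _].
rewrite ler_pdivrMr ?cspeed_gt0// mul1r; apply: (le_trans (ler_norm _)).
rewrite -ler_sqr ?nnegrE ?(ltW (cspeed_gt0 _))// real_normK ?num_real//.
by rewrite vel2// cspeed2; lra.
Qed.

(** With energy at least 1/2 the velocity never vanishes, and it is positive
    because the motion ends at a nonnegative position. *)
Lemma superluminal_time v s : 0 < s -> 0 <= sol v s -> 2^-1 <= en v ->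
  s <= light (sol v s).
Proof.
move=> s0 ys e1.
have v0 : 0 < v.
  rewrite ltNge; apply/negP => v0.
  have : sol v s < 0.
    have h2 : 0 < s / 2 by rewrite divr_gt0.
    have h3 : s / 2 < s by lra.
    have h : forall x, 0 <= x -> vel v x <= 0 by move=> x x0; exact: le_trans (vel_le p v x0) v0.
    have m a b : 0 <= a -> a <= b -> sol v b <= sol v a.
      move=> a0 ab; have := dcmp_le ab (fun x _ => d_sol p v x) (fun x _ => dC x 0).
      by rewrite subrr subr_le0; apply=> x /andP[ax _]; exact: h (le_trans a0 ax).
    have D x : is_derive x (1 : R) (sol v) (vel v x) by exact: d_sol.
    have C : {within `[0, s], continuous (sol v)}.
      by apply: within_cont => x _; exact: is_derive_cont (D x).
    have [x1 /[!in_itv]/= /andP[x10 _] e] := MVT s0 (fun x _ => D x) C.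
    rewrite sol0 !subr0 in e; rewrite e nmulr_rlt0//.
    by have := vel_decr v (lexx 0) x10; rewrite vel0; lra.
  by rewrite ltNge ys.
have vp t : 0 <= t -> 0 < vel v t.
  move=> t0; rewrite ltNge; apply/negP => vt.
  have cv : {within `[0, t], continuous (vel v)}.
    by apply: within_cont => x /andP[x0 _]; exact: is_derive_cont (d_vel p v x0).
  have [|c /[!in_itv]/= /andP[c0 _] ec] := @IVT R (vel v) 0 t 0 t0 cv.
    by rewrite vel0 ge_min vt orbT le_max (ltW v0).
  have := vel2 v c0; rewrite ec expr0n /=; have := pot_ge0 p (sol v c); lra.
have := dcmp_le (ltW s0) (fun x _ => dI x) (fun x _ => d_lightsol v x).
rewrite sol0 light0 !subr0; apply=> x /andP[x0 _].
rewrite ler_pdivlMr ?cspeed_gt0// mul1r.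
rewrite -ler_sqr ?nnegrE ?(ltW (cspeed_gt0 _)) ?(ltW (vp _ _))//.
by rewrite vel2// cspeed2; lra.
Qed.

Definition fvel s y : R := vel (shoot s y) s.
Definition een s y : R := en (shoot s y).

Lemma een_lt s y : 0 < s -> 0 <= y -> light y < s -> een s y < 2^-1.
Proof.
move=> s0 y0 ls; rewrite ltNge; apply/negP => h.
have := superluminal_time s0 _ h; rewrite shootE// => /(_ y0); lra.
Qed.

Lemma een_le s y : 0 < s -> 0 <= y -> een s y <= 2^-1 -> light y <= s.
Proof. by move=> s0 y0 h; have := subluminal_time (ltW s0) h; rewrite shootE. Qed.

Lemma een_eq s y : 0 < s -> 0 <= y -> een s y = 2^-1 -> s = light y.
Proof.
move=> s0 y0 h; have h1 : light y <= s by apply: een_le => //; rewrite h.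
have h2 : 2^-1 <= en (shoot s y) by rewrite -/(een s y) h.
by have := superluminal_time s0 _ h2; rewrite shootE// => /(_ y0); lra.
Qed.

Lemma fvel2 s y : 0 < s -> fvel s y ^+ 2 = 2 * een s y + 2 * Q y.
Proof. by move=> s0; rewrite /fvel vel2 ?shootE// ltW. Qed.

(** The energy is minus the derivative of the cost in the duration, by
    [cost_scale]. *)
Lemma cost_later s y : 0 < s -> exists2 K, 0 <= K &
  forall d, 0 <= d -> cost (s + d) y <= cost s y - een s y * d + K * d ^+ 2.
Proof.
move=> s0; have := fun s' s0' => @cost_scale R p s s' y _ s0 s0' erefl.
rewrite /een /(cost s y); move: (shoot s y) => v H.
have k0 := kinint_ge0 p v (ltW s0).
exists ((potint p v s + en v * s) / s ^+ 2).
  by rewrite divr_ge0// sqr_ge0.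
move=> d d0; have sd : 0 < s + d by rewrite ltr_wpDr.
apply: (le_trans (H _ sd)); rewrite actE.
set k := potint p v s; set e := en v in k0 *.
have sn : s != 0 by rewrite gt_eqF.
have sdn : s + d != 0 by rewrite gt_eqF.
rewrite -subr_ge0.
have -> : 2 * k + e * s - e * d + (k + e * s) / s ^+ 2 * d ^+ 2
  - (s / (s + d) * (k + e * s) + (s + d) / s * k) =
  (k + e * s) * d ^+ 3 / (s ^+ 2 * (s + d)).
  by field; rewrite sn sdn.
by rewrite divr_ge0 ?mulr_ge0 ?exprn_ge0// ltW.
Qed.

Lemma cost_conty s : 0 < s -> continuous (cost s).
Proof.
move=> s0 y; pose K := (2 * s)^-1 + force_lip p * s.
have K0 : 0 <= K.
  by rewrite addr_ge0 ?mulr_ge0 ?invr_ge0 ?mulr_ge0 ?(ltW s0)// ltW ?force_lip_gt0.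
apply: (lip_cont (addr_ge0 (normr_ge0 (fvel s y)) K0) ltr01) => z h1.
have u1 := cost_tangent p y z s0.
have u2 := cost_semiconcave p y z s0 (lexx s).
rewrite -/(fvel s y) -/K in u1 u2.
have b1 : `|fvel s y * (z - y)| <= `|fvel s y| * `|y - z| by rewrite normrM [`|z - y|]distrC.
have b2 : (z - y) ^+ 2 <= `|y - z|.
  by rewrite -(real_normK (num_real (z - y))) distrC expr2 ler_piMr// ltW.
have b3 := ler_wpM2l K0 b2.
have : 0 <= K * `|y - z| by rewrite mulr_ge0.
rewrite (mulrDl `|fvel s y|); move: b1 u1 u2 b3; rewrite !ler_norml.
move: (cost s y) (cost s z) (fvel s y * _) (`|fvel s y| * _) (K * _) (K * _) => *.
lra.
Qed.

End mechanics2.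

(** * Chains of loops and the Busemann function of the wall *)

Section infimum.
Context {R : realType}.
Implicit Types (A : set R) (m x e : R).

Lemma inf_le A m x : lbound A m -> A x -> inf A <= x.
Proof. by move=> lm Ax; apply: ge_inf => //; exists m. Qed.

Lemma le_inf A m : A !=set0 -> lbound A m -> m <= inf A.
Proof. by move=> A0 lm; exact: lb_le_inf. Qed.

Lemma inf_near A m e : A !=set0 -> lbound A m -> 0 < e ->
  exists2 x, A x & x < inf A + e.
Proof.
move=> A0 lm e0; have h : has_inf A by split => //; exists m.
by have [x Ax xe] := inf_adherent e0 h; exists x.
Qed.

Lemma inf_eq A m : lbound A m -> (forall e, 0 < e -> exists2 x, A x & x <= m + e) ->
  inf A = m.
Proof.
move=> lm h; have [x0 Ax0 _] := h 1 ltr01.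
have A0 : A !=set0 by exists x0.
apply/eqP; rewrite eq_le (le_inf A0 lm) andbT.
apply/ler_addgt0Pr => e e0; have [x Ax xe] := h e e0.
exact: le_trans (inf_le lm Ax) xe.
Qed.
End infimum.

Section chains.
Context {R : realType} (p : convex_potential R) (beta : R -> R).
Local Notation G := (loop p).
Implicit Types (a b c s t T e : R) (l : seq (R * R)).

(** A motion that starts and ends at the wall is encoded by the time intervals
    of its excursions; during the other times it earns the increments of
    [beta]. *)
Fixpoint ccost a b l : R :=
  if l is (u, v) :: l' then beta a - beta u + G (v - u) + ccost v b l'
  else beta a - beta b.

Fixpoint cvalid a b l : bool :=
  if l is (u, v) :: l' then [&& a <= u, u <= v & cvalid v b l'] else a <= b.

Definition wallS a b : R := inf [set ccost a b l | l in [set l | cvalid a b l]].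

Lemma cvalid_le a b l : cvalid a b l -> a <= b.
Proof.
elim: l a => [//|[u v] l IH] a /= /and3P[au uv /IH vb].
exact: le_trans au (le_trans uv vb).
Qed.

Lemma ccost_cat a b c l1 l2 : cvalid a b l1 -> cvalid b c l2 ->
  exists2 l, cvalid a c l & ccost a c l = ccost a b l1 + ccost b c l2.
Proof.
elim: l1 a => [|[u v] l1 IH] a /=.
  case: l2 => [|[u v] l2] /= ab; [move=> bc|move=> /and3P[bu uv vc]].
    by exists [::] => /=; [exact: le_trans bc|ring].
  exists ((u, v) :: l2) => /=; last by ring.
  by rewrite (le_trans ab bu) uv.
move=> /and3P[au uv v1] v2; have [l vl el] := IH v v1 v2.
by exists ((u, v) :: l) => /=; [rewrite au uv|rewrite el; ring].
Qed.

Lemma G0 : G 0 = 0.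
Proof. by apply/eqP; rewrite eq_le (le_trans (loop_le p (lexx 0))) ?mulr0 ?loop_ge0. Qed.

(** Cutting a chain at a time T cuts at most one loop; if T falls into a stay, the
    loop over T is the trivial one. *)
Lemma ccost_split a b T l : a <= T -> T <= b -> cvalid a b l ->
  exists u v l1 l2, [/\ [/\ a <= u, u <= T, T <= v & v <= b],
    cvalid a u l1, cvalid v b l2 &
    ccost a u l1 + G (v - u) + ccost v b l2 = ccost a b l].
Proof.
move=> aT Tb; elim: l a aT => [|[u v] l IH] a aT /=.
  move=> _; exists T, T, [::], [::]; split=> //=.
  by rewrite subrr G0; ring.
move=> /and3P[au uv vl]; have vb := cvalid_le vl.
have [Tu|uT] := leP T u.
  exists T, T, [::], ((u, v) :: l); split=> //=; first by rewrite Tu uv vl.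
  by rewrite subrr G0; ring.
have [Tv|vT] := leP T v.
  by exists u, v, [::], l; split=> //=; split => //; exact: ltW.
have [u' [v' [l1 [l2 [[h1 h2 h3 h4] h5 h6 h7]]]]] := IH v (ltW vT) vl.
exists u', v', ((u, v) :: l1), l2; split => //=.
- by split=> //; exact: le_trans au (le_trans uv h1).
- by rewrite au uv h5.
- by rewrite -h7; ring.
Qed.

Variable betap : R -> R.
Hypothesis betap_dom : forall s t, s <= t -> beta t - beta s <= betap t - betap s.
Hypothesis betap_ge : forall s t, s <= t -> betap s <= betap t.
Hypothesis beta_ge : forall s t, s <= t -> - (pot p 0) * (t - s) <= beta t - beta s.

Lemma ccost_ge a b l : cvalid a b l -> betap a - betap b <= ccost a b l.
Proof.
elim: l a => [|[u v] l IH] a /=; first by move=> /betap_dom; lra.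
move=> /and3P[au uv /IH]; have := betap_dom au; have := betap_ge uv.
have := @loop_ge0 _ p (v - u); rewrite subr_ge0 => /(_ uv); lra.
Qed.

Let lbS a b : lbound [set ccost a b l | l in [set l | cvalid a b l]] (betap a - betap b).
Proof. by move=> _ [l vl <-]; exact: ccost_ge. Qed.

Let neS a b : a <= b -> [set ccost a b l | l in [set l | cvalid a b l]] !=set0.
Proof. by move=> ab; exists (ccost a b [::]), [::]. Qed.

Lemma wallS_le a b l : cvalid a b l -> wallS a b <= ccost a b l.
Proof. by move=> vl; apply: (inf_le (@lbS a b)); exists l. Qed.

Lemma wallS_ge a b : a <= b -> betap a - betap b <= wallS a b.
Proof. by move=> ab; exact: le_inf (neS ab) (@lbS a b). Qed.

Lemma wallS_near a b e : a <= b -> 0 < e ->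
  exists2 l, cvalid a b l & ccost a b l < wallS a b + e.
Proof.
by move=> ab e0; have [_ [l vl <-] h] := inf_near (neS ab) (@lbS a b) e0; exists l.
Qed.

Lemma wallS_stay a b : a <= b -> wallS a b <= beta a - beta b.
Proof. by move=> ab; exact: (@wallS_le a b [::]). Qed.

Lemma wallS_loop a b : a <= b -> wallS a b <= G (b - a).
Proof.
move=> ab; have := @wallS_le a b [:: (a, b)]; rewrite /= !lexx ab => /(_ isT).
by rewrite !subrr addr0 add0r.
Qed.

Lemma wallS_refl a : wallS a a = 0.
Proof.
apply/eqP; rewrite eq_le; have := wallS_stay (lexx a); have := wallS_ge (lexx a).
by rewrite !subrr => -> ->.
Qed.

Lemma wallS_tri a b c : a <= b -> b <= c -> wallS a c <= wallS a b + wallS b c.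
Proof.
move=> ab bc; apply/ler_addgt0Pr => e e0; have e20 : 0 < e / 2 by rewrite divr_gt0.
have [l1 v1 h1] := wallS_near ab e20; have [l2 v2 h2] := wallS_near bc e20.
have [l vl el] := ccost_cat v1 v2; have := wallS_le vl; rewrite el; lra.
Qed.

Lemma wallS_split a b T e : a <= T -> T <= b -> 0 < e ->
  exists u v, [/\ [/\ a <= u, u <= T, T <= v & v <= b] &
    wallS a u + G (v - u) + wallS v b <= wallS a b + e].
Proof.
move=> aT Tb e0; have [l vl hl] := wallS_near (le_trans aT Tb) e0.
have [u [v [l1 [l2 [h h1 h2 E]]]]] := ccost_split aT Tb vl.
exists u, v; split => //.
have := wallS_le h1; have := wallS_le h2; lra.
Qed.

(** Take the loop (u, v) over time T of a nearly optimal chain from T' to s, and the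
    loop (n, m) over time v of one from T to t. They interlace, u <= n <= v <= m,
    and [loop_monge] exchanges them, and with them the ends of the chains. *)
Lemma wallS_cross T' T s t : T' <= T -> T <= s -> s <= t ->
  wallS T' t + wallS T s <= wallS T' s + wallS T t.
Proof.
move=> TT Ts st; apply/ler_addgt0Pr => e e0.
have e20 : 0 < e / 2 by rewrite divr_gt0.
have [u [v [[Tu uT Tv vs] h1]]] := wallS_split TT Ts e20.
have [n [m [[Tn nv vm mt] h2]]] := wallS_split Tv (le_trans vs st) e20.
have un : u <= n by exact: le_trans uT Tn.
have um : u <= m by rewrite (le_trans un)// (le_trans nv).
have ut : u <= t by exact: le_trans um mt.
have ns : n <= s by exact: le_trans nv vs.
have g := loop_monge p un nv vm.
have a1 := wallS_tri Tu ut; have a2 := wallS_tri um mt; have a3 := wallS_loop um.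
have b1 := wallS_tri Tn ns; have b2 := wallS_tri nv vs; have b3 := wallS_loop nv.
lra.
Qed.

(** Ending the chain early at time s costs at most the gain that the remaining
    time could bring, since the loop that is cut at s only becomes shorter. *)
Lemma wallS_back a s t : a <= s -> s <= t -> wallS a s <= wallS a t + (betap t - betap s).
Proof.
move=> as_ st; apply/ler_addgt0Pr => e e0.
have [u [v [[au us sv vt] h]]] := wallS_split as_ st e0.
have h1 := wallS_tri au us; have h2 := wallS_loop us.
have h3 : G (s - u) <= G (v - u) by apply: loop_nondecr; lra.
have h4 := wallS_ge vt; have h5 := betap_ge sv; lra.
Qed.

(** By [wallS_cross] the increments of wallS T decrease as T goes to the past, so
    that this infimum is their limit for T to -oo. *)
Definition busemann s t : R := inf [set wallS T t - wallS T s | T in [set T | T <= s]].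

Let lbB s t : s <= t ->
  lbound [set wallS T t - wallS T s | T in [set T | T <= s]] (betap s - betap t).
Proof. by move=> st _ [T /= Ts <-]; have := wallS_back Ts st; lra. Qed.

Let neB s t : [set wallS T t - wallS T s | T in [set T | T <= s]] !=set0.
Proof. by exists (wallS s t - wallS s s), s => /=. Qed.

Lemma busemann_le T s t : T <= s -> s <= t -> busemann s t <= wallS T t - wallS T s.
Proof. by move=> Ts st; apply: (inf_le (lbB st)); exists T. Qed.

Lemma busemann_ge s t : s <= t -> betap s - betap t <= busemann s t.
Proof. by move=> st; exact: le_inf (neB s t) (lbB st). Qed.

Lemma busemann_near s t e : s <= t -> 0 < e ->
  exists2 T0, T0 <= s & forall T, T <= T0 -> wallS T t - wallS T s < busemann s t + e.
Proof.
move=> st e0; have [_ [T0 /= T0s <-] h] := inf_near (neB s t) (lbB st) e0.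
exists T0 => // T TT; apply: le_lt_trans h; have := wallS_cross TT T0s st; lra.
Qed.

Lemma busemann_le_wallS s t : s <= t -> busemann s t <= wallS s t.
Proof. by move=> st; have := busemann_le (lexx s) st; rewrite wallS_refl subr0. Qed.

Lemma busemann_add s t u : s <= t -> t <= u ->
  busemann s u = busemann s t + busemann t u.
Proof.
move=> st tu; have su := le_trans st tu.
apply/eqP; rewrite eq_le; apply/andP; split.
  apply/ler_addgt0Pr => e e0; have e20 : 0 < e / 2 by rewrite divr_gt0.
  have [T1 T1s h1] := busemann_near st e20.
  have [T2 T2t h2] := busemann_near tu e20.
  have m1 : Num.min T1 T2 <= T1 by rewrite ge_min lexx.
  have m2 : Num.min T1 T2 <= T2 by rewrite ge_min lexx orbT.
  have := busemann_le (le_trans m1 T1s) su.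
  have := h1 _ m1; have := h2 _ m2; lra.
apply: le_inf (neB s u) _ => _ [T /= Ts <-].
have := busemann_le Ts st; have := busemann_le (le_trans Ts st) tu; lra.
Qed.

(** A primitive of the increments [busemann], normalized at time 0. *)
Definition wallZ t : R := if 0 <= t then busemann 0 t else - busemann t 0.

Lemma busemann_refl t : busemann t t = 0.
Proof. by have := busemann_add (lexx t) (lexx t); lra. Qed.

Lemma wallZ0 : wallZ 0 = 0.
Proof. by rewrite /wallZ lexx busemann_refl. Qed.

Lemma wallZB s t : s <= t -> wallZ t - wallZ s = busemann s t.
Proof.
rewrite /wallZ; have [s0|s0] := leP 0 s; have [t0|t0] := leP 0 t => st.
- by rewrite (busemann_add s0 st); ring.
- by move: (lt_le_trans t0 s0); rewrite ltNge st.
- by rewrite (busemann_add (ltW s0) t0); ring.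
- by rewrite (busemann_add st (ltW t0)); ring.
Qed.

Lemma wallZ_stay s t : s <= t -> wallZ t <= wallZ s + (beta s - beta t).
Proof.
move=> st; have := wallZB st; have := busemann_le_wallS st.
by have := wallS_stay st; lra.
Qed.

Lemma wallZ_loop s t : s <= t -> wallZ t <= wallZ s + G (t - s).
Proof.
move=> st; have := wallZB st; have := busemann_le_wallS st.
by have := wallS_loop st; lra.
Qed.

Lemma wallZ_back s t : s <= t -> wallZ s <= wallZ t + (betap t - betap s).
Proof. by move=> st; have := wallZB st; have := busemann_ge st; lra. Qed.

Lemma wallZ_up s t : s <= t -> wallZ t <= wallZ s + pot p 0 * (t - s).
Proof. by move=> st; have := wallZ_stay st; have := beta_ge st; lra. Qed.

Hypothesis wallS_Ny : forall N, exists L, forall T, T <= L -> wallS T 0 <= - N.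

Lemma wallZ_Ny N : exists L, forall T, T <= L -> N <= wallZ T.
Proof.
have [L h] := wallS_Ny N; exists (Num.min L 0) => T; rewrite le_min => /andP[TL T0].
have := wallZB T0; have := busemann_le_wallS T0; have := h T TL; rewrite wallZ0; lra.
Qed.

Lemma wallS_Ny_at t0 N : exists2 L, L <= t0 & forall T, T <= L -> wallS T t0 <= - N.
Proof.
have [t00|t00] := leP 0 t0.
  have [L h] := wallS_Ny (N + wallS 0 t0).
  exists (Num.min L 0); first by rewrite ge_min t00 orbT.
  move=> T; rewrite le_min => /andP[TL T0].
  have := h T TL; have := wallS_tri T0 t00; lra.
have [L h] := wallS_Ny (N + (betap 0 - betap t0)).
exists (Num.min L t0); first by rewrite ge_min lexx orbT.
move=> T; rewrite le_min => /andP[TL T0].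
have := h T TL; have := wallS_back T0 (ltW t00); lra.
Qed.

(** Waiting at the wall for a long time is profitable, so nearly optimal pasts of
    (t, wall) cross time t0 in a loop which starts in a bounded time interval,
    and there [busemann] is approximated uniformly. *)
Lemma wallZ_past t0 t e : t0 <= t -> 0 < e ->
  exists u v l, [/\ [/\ u <= t0, t0 <= v & v <= t], cvalid v t l &
    wallZ u + G (v - u) + ccost v t l <= wallZ t + e].
Proof.
move=> t0t e0; have e30 : 0 < e / 3 by rewrite divr_gt0.
have [L Lt0 hL] := wallS_Ny_at t0 (pot p 0 * (t - t0) + e).
have [T0 T0L hT] := busemann_near (le_trans Lt0 t0t) e30.
have aT : T0 <= t0 by exact: le_trans Lt0.
have [u [v [[Tu ut0 tv vt] h]]] := wallS_split aT t0t e30.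
have [l vl hl] := wallS_near vt e30.
exists u, v, l; split => //.
(* If the loop started before L, waiting at the wall until its end v would have
   been cheaper by more than the error. *)
have Lu : L <= u.
  rewrite leNgt; apply/negP => uL.
  have uv : u <= v by exact: le_trans ut0 tv.
  have := @loop_ge0 _ p (v - u); rewrite subr_ge0 => /(_ uv) g0.
  have a1 := hL u (ltW uL); have a2 := wallS_tri ut0 tv.
  have a3 := wallS_stay tv; have a4 := beta_ge tv.
  have a5 : pot p 0 * (v - t0) <= pot p 0 * (t - t0).
    by rewrite ler_wpM2l ?pot_ge0// lerD2r.
  have a6 := wallS_tri Tu uv; have a7 := wallS_tri (le_trans Tu uv) vt.
  lra.
have ut : u <= t by exact: le_trans ut0 t0t.
have b1 := hT T0 (lexx _); have b2 := busemann_le T0L Lu.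
have b3 := busemann_add Lu ut; have b4 := wallZB ut.
lra.
Qed.

End chains.

(** * The value function *)

Section one_sided.
Context {R : realType}.

Lemma derive_left_le (f : R -> R) (t b e : R) : is_derive t 1 f b -> 0 < e ->
  exists2 dl, 0 < dl & forall d, 0 < d -> d < dl -> f t - f (t - d) <= (b + e) * d.
Proof.
move=> [/cvg_ex[l +] <-] e0; rewrite /derive => dl; rewrite (cvg_lim _ dl)//.
have /cvgrPdist_lt/(_ e e0)[r /= r0 hr] := dl.
exists r => // d d0 dr.
have := hr (- d); rewrite /ball_ /= sub0r opprK gtr0_norm// oppr_eq0 gt_eqF//.
move=> /(_ dr isT); rewrite [- d *: 1]mulr1 [- d + t]addrC.
rewrite /GRing.scale /= invrN mulNr -mulrN opprB.
rewrite ltr_norml => /andP[h _].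
have : d^-1 * (f t - f (t - d)) <= l + e by lra.
by rewrite mulrC ler_pdivrMr.
Qed.
End one_sided.

Section value_function.
Context {R : realType} (p : convex_potential R) (Z : R -> R).
Local Notation Q0 := (pot p 0).
Implicit Types (a b s t T y z e : R).

(** The Hopf-Lax formula: the last departure from the wall is at time t - s. *)
Definition wallU t y : R := inf [set Z (t - s) + cost p s y | s in [set s | 0 < s]].

Variable betap : R -> R.
Hypothesis betap_half : forall s t, s <= t -> betap t - betap s <= (t - s) / 2.
Hypothesis Z_up : forall s t, s <= t -> Z t <= Z s + Q0 * (t - s).
Hypothesis Z_back : forall s t, s <= t -> Z s <= Z t + (betap t - betap s).
Hypothesis Z_loop : forall s t, s <= t -> Z t <= Z s + loop p (t - s).
Hypothesis Z_Ny : forall N, exists L, forall T, T <= L -> N <= Z T.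

Lemma Z_lb t : exists m, forall s, 0 <= s -> m <= Z (t - s).
Proof.
have [L hL] := Z_Ny 0; exists (Num.min 0 (Z t - Q0 * `|t - L|)) => s s0.
have [tL|Lt] := leP (t - s) L; first by rewrite ge_min hL.
have st : t - s <= t by lra.
rewrite ge_min; apply/orP; right; have := Z_up st.
have : Q0 * (t - (t - s)) <= Q0 * `|t - L|.
  rewrite ler_wpM2l ?pot_ge0//; apply: le_trans (ler_norm _); lra.
lra.
Qed.

Let neU t y : [set Z (t - s) + cost p s y | s in [set s | 0 < s]] !=set0.
Proof. by exists (Z (t - 1) + cost p 1 y), 1 => //=. Qed.

Let lbU t y : exists m, lbound [set Z (t - s) + cost p s y | s in [set s | 0 < s]] m.
Proof.
have [m hm] := Z_lb t; exists m => _ [s /= s0 <-].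
by have := hm s (ltW s0); have := cost_ge0 p y (ltW s0); lra.
Qed.

Lemma wallU_le t s y : 0 < s -> wallU t y <= Z (t - s) + cost p s y.
Proof. by move=> s0; have [m hm] := lbU t y; apply: (inf_le hm); exists s. Qed.

Lemma wallU_ge t y m : (forall s, 0 < s -> m <= Z (t - s) + cost p s y) ->
  m <= wallU t y.
Proof. by move=> h; apply: le_inf (neU t y) _ => _ [s /= s0 <-]; exact: h. Qed.

Lemma wallU_near t y e : 0 < e ->
  exists2 s, 0 < s & Z (t - s) + cost p s y < wallU t y + e.
Proof.
move=> e0; have [m hm] := lbU t y.
by have [_ [s s0 <-] h] := inf_near (neU t y) hm e0; exists s.
Qed.

Lemma wallU_extend a b (chi Phi : R -> R) : a <= b -> curve_cost p chi Phi a b ->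
  wallU b (chi b) <= wallU a (chi a) + (Phi b - Phi a).
Proof.
move=> ab cc; apply/ler_addgt0Pr => e e0.
have [s s0 h] := wallU_near a (chi a) e0.
have as_ : a - s <= a by lra.
have h0 : a - s = a -> chi a = 0 by move=> ?; exfalso; lra.
have := cost_extend as_ ab h0 cc.
have bs : 0 < b - (a - s) by lra.
have := wallU_le b (chi b) bs.
have -> : b - (b - (a - s)) = a - s by ring.
have -> : a - (a - s) = s by ring.
lra.
Qed.

(** Loops are free competitors for [Z], and departures just before time t cost
    little. *)
Lemma wallU_wall t : wallU t 0 = Z t.
Proof.
apply/eqP; rewrite eq_le; apply/andP; split; last first.
  apply: wallU_ge => s s0; have ts : t - s <= t by lra.
  have := Z_loop ts; have -> : t - (t - s) = s by ring.
  by rewrite /loop.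
apply/ler_addgt0Pr => e e0; pose s := e / (1 + Q0).
have q0 := pot_ge0 p 0; have q1 : 0 < 1 + Q0 by lra.
have s0 : 0 < s by rewrite divr_gt0.
have ts : t - s <= t by lra.
have := wallU_le t 0 s0; have := Z_back ts; have := betap_half ts.
have := loop_le p (ltW s0); rewrite /loop.
have : s * (1 + Q0) = e by rewrite divfK ?gt_eqF.
lra.
Qed.

(** Straight motions of speed one join the wall and the position y in time y: to y
    they bound U from above, and back to the wall from below. *)
Lemma wallU_near_wall t y : 0 < y -> `|wallU t y - Z t| <= (1 + Q0) * y.
Proof.
move=> y0; have q0 := pot_ge0 p 0.
have up : wallU t y <= Z t + (1 + Q0) * y.
  have ty : t - y <= t by lra.
  have := wallU_le t y y0; have := Z_back ty; have := betap_half ty.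
  have := cost_le_line p y0 (ltW y0).
  have -> : y ^+ 2 / (2 * y) = y / 2 by field; rewrite gt_eqF.
  lra.
have lo : Z t <= wallU t y + (1 + Q0) * y.
  have ty : t <= t + y by lra.
  pose chi q := y - (q - t); pose Phi q := (2^-1 + Q0) * (q - t).
  have dchi q : is_derive q (1 : R) chi (- 1).
    apply: is_derive_eq (dB (dC q y) (dB (dI q) (dC q t))) _; ring.
  have dPhi q : is_derive q (1 : R) Phi (2^-1 + Q0).
    apply: is_derive_eq (dZ (2^-1 + Q0) (dB (dI q) (dC q t))) _; ring.
  have cc : curve_cost p chi Phi t (t + y).
    split.
    - by apply: within_cont => x _; exact: is_derive_cont (dchi x).
    - by apply: within_cont => x _; exact: is_derive_cont (dPhi x).
    exists (fun=> -1), (fun=> 2^-1 + Q0) => q /andP[tq qt]; split => //.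
    by rewrite sqrrN expr1n mul1r lerD2l pot_le// /chi; lra.
  have := wallU_extend ty cc; rewrite /chi /Phi.
  have -> : y - (t + y - t) = 0 by ring.
  rewrite wallU_wall !subrr subr0 mulr0 subr0.
  have := Z_back ty; have := betap_half ty.
  have -> : t + y - t = y by ring.
  lra.
by rewrite ler_norml; apply/andP; split; lra.
Qed.

Lemma Z_cont : continuous Z.
Proof.
have q0 := pot_ge0 p 0.
have lip a b : a <= b -> `|Z a - Z b| <= (1 + Q0) * `|a - b|.
  move=> ab; have := Z_back ab; have := betap_half ab; have := Z_up ab => h1 h2 h3.
  rewrite distrC [`|a - b|]distrC (ger0_norm (_ : 0 <= b - a)); last by lra.
  have : 0 <= Q0 * (b - a) by rewrite mulr_ge0//; lra.
  by rewrite ler_norml => ?; apply/andP; split; lra.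
have L0 : 0 <= 1 + Q0 by lra.
move=> t; apply: (lip_cont L0 ltr01) => x _.
by have [tx|/ltW xt] := leP t x; [|rewrite distrC [`|t - x|]distrC]; exact: lip.
Qed.

Lemma hopf_conts t y s : 0 < s ->
  {for s, continuous (fun s => Z (t - s) + cost p s y)}.
Proof.
move=> s0; apply: cvgD; last exact: cost_conts.
apply: (@continuous_comp _ _ _ (fun s => t - s) Z); last exact: Z_cont.
by apply: cvgB; [exact: cvg_cst|exact: cvg_id].
Qed.

(** Short motions cost too much kinetic energy, long ones start where [Z] is large;
    in between there is a minimum by continuity. *)
Lemma wallU_min t y : 0 < y -> exists2 s, 0 < s & wallU t y = Z (t - s) + cost p s y.
Proof.
move=> y0; pose m s := Z (t - s) + cost p s y.
have [lo hlo] := Z_lb t.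
have [L hL] := Z_Ny (m 1).
(* Departures before time t - sb pay more than m 1 for Z alone, and motions
   shorter than sa pay more than m 1 - lo for their kinetic part. *)
pose sb := Num.max 1 (t - L).
pose sa := Num.min 1 (y ^+ 2 / (2 * (`|m 1 - lo| + 1))).
have y20 : 0 < y ^+ 2 by rewrite exprn_gt0.
have k0 : 0 < `|m 1 - lo| + 1 by rewrite ltr_wpDl.
have sa0 : 0 < sa by rewrite lt_min ltr01 divr_gt0// mulr_gt0.
have sa1 : sa <= 1 by rewrite ge_min lexx.
have sb1 : 1 <= sb by rewrite le_max lexx.
have sab : sa <= sb by exact: le_trans sa1 sb1.
have cm : {within `[sa, sb], continuous m}.
  by apply: within_cont => x /andP[sx _]; apply: hopf_conts; exact: lt_le_trans sx.
have [c /[!in_itv]/= /andP[ac cb] hc] := EVT_min sab cm.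
have c0 : 0 < c by exact: lt_le_trans ac.
have h1 : m c <= m 1 by apply: hc; rewrite in_itv/= sa1 sb1.
exists c => //; apply/eqP; rewrite eq_le wallU_le//=.
apply: wallU_ge => s s0; rewrite -/(m s) -/(m c).
have [bs|sb'] := ltP sb s.
  apply: (le_trans h1); have := cost_ge0 p y (ltW s0).
  have : m 1 <= Z (t - s).
    by apply: hL; move: bs; rewrite /sb gt_max => /andP[_ ?]; lra.
  rewrite /m; lra.
have [sa'|as_] := ltP s sa; last by apply: hc; rewrite in_itv/= as_ sb'.
apply: (le_trans h1); have := cost_ge_kin p y s0; have := hlo s (ltW s0).
have : `|m 1 - lo| + 1 <= y ^+ 2 / (2 * s).
  move: sa'; rewrite /sa lt_min => /andP[_].
  rewrite ltr_pdivlMr ?mulr_gt0// => h.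
  rewrite ler_pdivlMr ?mulr_gt0//; apply: ltW; apply: le_lt_trans h.
  by rewrite le_eqVlt; apply/orP; left; apply/eqP; ring.
have := ler_norm (m 1 - lo); rewrite -[m s]/(Z (t - s) + cost p s y); move: (m 1) (cost p s y) => m1 cs; lra.
Qed.

(** Leaving the wall earlier by d saves the energy times d and forgoes the gain of
    that time. *)
Lemma wallU_min_een t y s : 0 < s -> wallU t y = Z (t - s) + cost p s y ->
  exists2 K, 0 <= K & forall d, 0 <= d ->
    een p s y * d - K * d ^+ 2 <= betap (t - s) - betap (t - s - d).
Proof.
move=> s0 h; have [K K0 hK] := cost_later p y s0; exists K => // d d0.
have sd : 0 < s + d by lra.
have := wallU_le t y sd; rewrite h; have := hK d d0.
have e1 : t - s - d <= t - s by lra.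
have := Z_back e1; rewrite (_ : t - (s + d) = t - s - d); last by ring.
lra.
Qed.

Lemma wallU_min_een_le t y s : 0 < s -> wallU t y = Z (t - s) + cost p s y ->
  een p s y <= 2^-1.
Proof.
move=> s0 /(wallU_min_een s0)[K K0 hK]; rewrite leNgt; apply/negP => he.
pose d := (een p s y - 2^-1) / (K + 1).
have K1 : 0 < K + 1 by lra.
have d0 : 0 < d by rewrite divr_gt0// subr_gt0.
have := hK d (ltW d0).
have e1 : t - s - d <= t - s by lra.
have := betap_half e1; rewrite (_ : t - s - (t - s - d) = d); last by ring.
have : d * (K + 1) = een p s y - 2^-1 by rewrite divfK ?gt_eqF.
move: (een _ _ _) he => e he h1 h2 h3.
have : K * d ^+ 2 < (e - 2^-1) * d.
  by rewrite expr2 mulrA ltr_pM2r// -h1; lra.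
lra.
Qed.

Lemma wallU_min_light t y s : 0 < s -> 0 < y -> wallU t y = Z (t - s) + cost p s y ->
  light p y <= s.
Proof. by move=> s0 y0 h; apply: een_le => //; [exact: ltW|exact: wallU_min_een_le h]. Qed.

Lemma wallU_min_een_lt t y s b : 0 < s -> wallU t y = Z (t - s) + cost p s y ->
  is_derive (t - s) 1 betap b -> b < 2^-1 -> een p s y < 2^-1.
Proof.
move=> s0 h db b1; have [K K0 hK] := wallU_min_een s0 h.
rewrite ltNge; apply/negP => he.
pose e := (2^-1 - b) / 2; have e0 : 0 < e by rewrite /e; lra.
have [dl dl0 hd] := derive_left_le db e0.
pose d := Num.min (dl / 2) (e / 2 / (K + 1)).
have K1 : 0 < K + 1 by lra.
have d0 : 0 < d by rewrite lt_min; apply/andP; split; rewrite divr_gt0// divr_gt0.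
have d1 : d < dl by rewrite gt_min; apply/orP; left; lra.
have d2 : d * (K + 1) <= e / 2 by rewrite -ler_pdivlMr// ge_min lexx orbT.
have := hK d (ltW d0); have := hd d d0 d1.
have : 2^-1 * d <= een p s y * d by rewrite ler_pM2r.
have : K * d ^+ 2 <= e / 2 * d.
  by rewrite expr2 mulrA ler_pM2r//; move: d2; rewrite mulrDr mulr1 mulrC; lra.
have : 0 < e * d by rewrite mulr_gt0.
have : (b + e) * d = 2^-1 * d - e * d by rewrite /e; field.
move: (een _ _ _ * d) => E; lra.
Qed.

(** A minimizer as fast as light becomes slower when it leaves a little earlier,
    which changes the value continuously. *)
Lemma wallU_near_subluminal t y e : 0 < y -> 0 < e ->
  exists s, [/\ 0 < s, light p y < s & Z (t - s) + cost p s y <= wallU t y + e].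
Proof.
move=> y0 e0; have [s s0 h] := wallU_min t y0.
have ls := wallU_min_light s0 y0 h.
have := @hopf_conts t y s s0; move/cvgrPdist_lt => /(_ e e0)[r /= r0 hr].
have ss : s < s + r / 2 by lra.
exists (s + r / 2); split; [exact: lt_trans ss|exact: le_lt_trans ss|].
have := hr (s + r / 2); rewrite /ball_ /= opprD addNKr normrN gtr0_norm ?divr_gt0//.
move=> /(_ _); rewrite -h ltr_norml => H.
have : r / 2 < r by lra.
by move=> /H /andP[]; lra.
Qed.

Definition smin t y : R := xget 0 [set s | 0 < s /\ wallU t y = Z (t - s) + cost p s y].

Lemma sminP t y : 0 < y ->
  0 < smin t y /\ wallU t y = Z (t - smin t y) + cost p (smin t y) y.
Proof.
move=> y0; have [s s0 h] := wallU_min t y0.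
exact: (@xgetPex _ 0 [set s | 0 < s /\ wallU t y = Z (t - s) + cost p s y]
  (ex_intro _ s (conj s0 h))).
Qed.

Definition vmin t y : R := fvel p (smin t y) y.

Lemma vmin2 t y : 0 < y -> vmin t y ^+ 2 <= cspeed p y ^+ 2.
Proof.
move=> y0; have [s0 h] := sminP t y0.
by rewrite /vmin fvel2// cspeed2; have := wallU_min_een_le s0 h; lra.
Qed.

(** The departure time of the minimizer of (t, y) gives a competitor for all (t, z).
    Minimizers last at least as long as light takes to y0, which makes the
    constant uniform. *)
Lemma wallU_semiconcave t y0 : 0 < y0 -> exists2 K, 0 <= K &
  forall y z, y0 <= y ->
    wallU t z <= wallU t y + vmin t y * (z - y) + K * (z - y) ^+ 2.
Proof.
move=> y00; have l0 := light_gt0 p y00; set l := light p y0 in l0 *.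
exists ((2 * l)^-1 + force_lip p * l).
  by rewrite addr_ge0 ?invr_ge0 ?mulr_ge0// ltW// force_lip_gt0.
move=> y z yy; have y0' : 0 < y by exact: lt_le_trans yy.
have [s0 h] := sminP t y0'.
have ls : l <= smin t y.
  apply: le_trans (wallU_min_light s0 y0' h).
  by move: yy; rewrite le_eqVlt => /predU1P[<-//|yy]; exact/ltW/light_lt.
have := cost_semiconcave p y z l0 ls; have := wallU_le t z s0.
rewrite [wallU t y]h /vmin /fvel.
move: (shoot _ _ _) => v; lra.
Qed.

End value_function.

(** * Derivatives of semiconcave functions *)

Section semiconcave.
Context {R : realType} (U : R -> R).
Implicit Types (y z e : R) (v : R -> R).

(** [v] selects supergradients of [U] up to a quadratic term, uniformly away
    from 0: near the wall the minimizers become short. *)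
Definition supergrad v := forall y0, 0 < y0 -> exists2 K, 0 <= K &
  forall y z, y0 <= y -> U z <= U y + v y * (z - y) + K * (z - y) ^+ 2.

Lemma supergrad_mono v y0 : supergrad v -> 0 < y0 -> exists2 K, 0 <= K &
  forall y z, y0 <= y -> y <= z -> v z - K * z <= v y - K * y.
Proof.
move=> sg y00; have [K K0 h] := sg _ y00; exists (2 * K); first by rewrite mulr_ge0.
move=> y z yy; rewrite le_eqVlt => /predU1P[->//|yz].
have h1 := h y z yy; have h2 := h z y (le_trans yy (ltW yz)).
have d : 0 < z - y by lra.
suff : (v z - v y) * (z - y) <= (2 * K * (z - y)) * (z - y).
  by rewrite ler_pM2r//; lra.
have : (y - z) ^+ 2 = (z - y) ^+ 2 by ring.
move=> E; rewrite E in h2; lra.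
Qed.

Lemma supergrad_derive v y l : supergrad v -> 0 < y -> is_derive y 1 U l -> l = v y.
Proof.
move=> sg y0 [/cvg_ex[l' +] <-]; rewrite /derive => dl; rewrite (cvg_lim _ dl)//.
have [K K0 h] := sg _ y0.
have main s : (s = 1 \/ s = -1) -> forall e, 0 < e -> s * l' <= s * v y + e.
  move=> hs e e0.
  have e20 : 0 < e / 2 by rewrite divr_gt0.
  have /cvgrPdist_lt/(_ _ e20)[r /= r0 hr] := dl.
  have K1 : 0 < K + 1 by lra.
  pose d := Num.min (r / 2) (e / 2 / (K + 1)).
  have d0 : 0 < d by rewrite lt_min; apply/andP; split; rewrite divr_gt0// divr_gt0.
  have d1 : d < r by rewrite gt_min; apply/orP; left; lra.
  have d2 : K * d <= e / 2.
    have : d * (K + 1) <= e / 2 by rewrite -ler_pdivlMr// ge_min lexx orbT.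
    lra.
  have s1 : s * s = 1 by case: hs => ->; ring.
  have sn : `|s| = 1 by case: hs => ->; rewrite ?normrN normr1.
  have := hr (s * d); rewrite /ball_ /= sub0r normrN normrM sn mul1r gtr0_norm//.
  have sd : s * d != 0.
    by case: hs => ->; rewrite ?mul1r ?mulN1r ?oppr_eq0 gt_eqF.
  move=> /(_ d1 sd); rewrite [(s * d) *: 1]mulr1 /GRing.scale /= invfM.
  have -> : s^-1 = s by case: hs => ->; rewrite ?invrN invr1.
  have := h y (s * d + y) (lexx y); rewrite addrK exprMn expr2 s1 mul1r.
  set D := U _ - U y; move=> hU.
  have hD : d^-1 * D <= s * v y + K * d.
    rewrite mulrC ler_pdivrMr//; rewrite /D; move: hU; rewrite expr2; lra.
  have n1 : s * (l' - s * d^-1 * D) = s * l' - d^-1 * D.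
    by rewrite mulrBr !mulrA s1 mul1r.
  move=> hn; have : s * l' - d^-1 * D < e / 2.
    rewrite -n1; apply: le_lt_trans hn.
    by apply: (le_trans (ler_norm _)); rewrite normrM sn mul1r.
  lra.
apply/eqP; rewrite eq_le; apply/andP; split; apply/ler_addgt0Pr => e e0.
  by have := main 1 (or_introl erefl) e e0; rewrite !mul1r.
by have := main (-1) (or_intror erefl) e e0; rewrite !mulN1r; lra.
Qed.

Variables (v : R -> R) (B : R).
Hypothesis sgv : supergrad v.
Hypothesis vB : forall y, 0 < y -> `|v y| <= B.

(** By [supergrad_mono] the function [v] differs from a monotone one by a linear
    one, so this limit exists. *)
Definition rgrad y : R := lim (v z @[z --> y^'+]).

Lemma supergrad_cont y : 0 < y -> {for y, continuous U}.
Proof.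
move=> y0; have y20 : 0 < y / 2 by rewrite divr_gt0.
have [K K0 h] := sgv y20.
have B0 : 0 <= B by exact: le_trans (normr_ge0 _) (vB y0).
have r0 : 0 < Num.min 1 (y / 2) by rewrite lt_min ltr01.
apply: (lip_cont (addr_ge0 B0 K0) r0) => z; rewrite lt_min => /andP[h1 h3].
have yz : y / 2 <= z by move: h3; rewrite ltr_norml; lra.
have y2 : y / 2 <= y by lra.
have z0 : 0 < z by lra.
have u1 := h y z y2; have u2 := h z y yz.
have b a x : 0 < a -> `|v a| <= B -> `|v a * x| <= B * `|x|.
  by move=> a0 va; rewrite normrM ler_wpM2r.
have b1 := b y (z - y) y0 (vB y0); have b2 := b z (y - z) z0 (vB z0).
have sq : (z - y) ^+ 2 = `|y - z| * `|y - z|.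
  by rewrite -normrM ger0_norm -?expr2 ?sqr_ge0//; ring.
have sq' : (y - z) ^+ 2 = `|y - z| * `|y - z|.
  by rewrite -normrM ger0_norm -?expr2 ?sqr_ge0.
have n0 := normr_ge0 (y - z).
have k1 : K * (`|y - z| * `|y - z|) <= K * `|y - z|.
  by rewrite ler_wpM2l// ler_piMr// ltW.
rewrite distrC in b1; rewrite {}sq in u1; rewrite {}sq' in u2.
rewrite (mulrDl B); move: b1 b2 u1 u2 k1; rewrite !ler_norml.
move: (v y * _) (v z * _) (K * _) (K * `|_|) (B * _) => *.
apply/andP; split; lra.
Qed.

Lemma rgrad_cvg y : 0 < y -> v z @[z --> y^'+] --> rgrad y.
Proof.
move=> y0; have [K K0 mono] := supergrad_mono sgv y0.
have c : cvg ((fun z => v z - K * z) z @[z --> y^'+]).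
  apply/cvg_ex; eexists.
  apply: (@nonincreasing_at_right_cvgr _ _ _ (BInfty _ false)) => //.
    move=> a b; rewrite !in_itv/= !andbT => ya yb ab.
    by apply: mono => //; exact: ltW.
  exists (v y - K * y) => ? /= [z]; rewrite in_itv/= andbT => yz <-.
  by apply: mono => //; exact: ltW.
apply/cvg_ex; exists (lim ((fun z => v z - K * z) z @[z --> y^'+]) + K * y).
have c2 : (v z - K * z) + K * z @[z --> y^'+] -->
    lim ((fun z => v z - K * z) z @[z --> y^'+]) + K * y.
  apply: cvgD; first exact: c.
  apply: cvgM; first exact: cvg_cst.
  by apply: cvg_at_right_filter; exact: cvg_id.
by move: c2; under eq_fun do rewrite subrK.
Qed.

Lemma rgrad_bound y : 0 < y -> `|rgrad y| <= B.
Proof.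
move=> y0; have c : `|v z| @[z --> y^'+] --> `|rgrad y| by exact: cvg_norm (rgrad_cvg y0).
rewrite -(cvg_lim _ c)//; apply: limr_le; first by apply/cvg_ex; eexists; exact: c.
by near=> z; apply: vB; apply: lt_trans y0 _; near: z; exact: nbhs_right_gt.
Unshelve. all: by end_near. Qed.

Lemma supergrad_rgrad : supergrad rgrad.
Proof.
move=> y0 y00; have [K K0 h] := sgv y00; exists K => // y z yy.
have yp : 0 < y by exact: lt_le_trans yy.
have idr : x @[x --> y^'+] --> y by apply: cvg_at_right_filter; exact: cvg_id.
have c : U x + v x * (z - x) + K * (z - x) ^+ 2 @[x --> y^'+] -->
    U y + rgrad y * (z - y) + K * (z - y) ^+ 2.
  have zx : z - x @[x --> y^'+] --> z - y by apply: cvgB; [exact: cvg_cst|].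
  apply: cvgD; first apply: cvgD.
  - by apply: cvg_at_right_filter; exact: supergrad_cont.
  - by apply: cvgM; [exact: rgrad_cvg|].
  - apply: cvgM; first exact: cvg_cst.
    by under eq_fun do rewrite expr2; rewrite expr2; exact: cvgM.
rewrite -(cvg_lim _ c)//; apply: limr_ge; first by apply/cvg_ex; eexists; exact: c.
near=> x; apply: h; apply: (le_trans yy); apply: ltW.
by near: x; exact: nbhs_right_gt.
Unshelve. all: by end_near. Qed.

Lemma rgrad_right y : 0 < y -> rgrad z @[z --> y^'+] --> rgrad y.
Proof.
move=> y0; apply/cvgrPdist_le => /= e e0.
have /cvgrPdist_le/(_ e e0)[r /= r0 hr] := rgrad_cvg y0.
near=> z.
have yz : y < z by near: z; exact: nbhs_right_gt.
have zr : z < y + r by near: z; apply: nbhs_right_lt; lra.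
have c : `|rgrad y - v x| @[x --> z^'+] --> `|rgrad y - rgrad z|.
  by apply: cvg_norm; apply: cvgB; [exact: cvg_cst|exact: rgrad_cvg (lt_trans y0 yz)].
rewrite -(cvg_lim _ c)//; apply: limr_le; first by apply/cvg_ex; eexists; exact: c.
near=> x.
have zx : z < x by near: x; exact: nbhs_right_gt.
have xr : x < y + r by near: x; exact: nbhs_right_lt.
apply: hr; last exact: lt_trans zx.
rewrite /ball_ /= distrC gtr0_norm; lra.
Unshelve. all: by end_near. Qed.

Lemma rgrad_left y : 0 < y -> cvg (rgrad z @[z --> y^'-]).
Proof.
move=> y0; have y20 : 0 < y / 2 by rewrite divr_gt0.
have [K K0 mono] := supergrad_mono supergrad_rgrad y20.
have near_y : \forall x \near y^'-, y / 2 < x by apply: nbhs_left_gt; lra.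
have c : cvg ((fun z => K * z - rgrad z) z @[z --> y^'-]).
  apply: nondecreasing_at_left_is_cvgr.
    near=> x => a b; rewrite !in_itv/= => /andP[xa ay] /andP[xb by_] ab.
    have x2 : y / 2 < x by near: x.
    have := mono a b (ltW (lt_trans x2 xa)) ab; lra.
  near=> x; exists (K * y - rgrad y) => ? /= [z]; rewrite in_itv/= => /andP[xz zy] <-.
  have x2 : y / 2 < x by near: x.
  have := mono z y (ltW (lt_trans x2 xz)) (ltW zy); lra.
apply/cvg_ex; exists (K * y - lim ((fun z => K * z - rgrad z) z @[z --> y^'-])).
have c2 : K * z - (K * z - rgrad z) @[z --> y^'-] -->
    K * y - lim ((fun z => K * z - rgrad z) z @[z --> y^'-]).
  apply: cvgB; last exact: c.
  apply: cvgM; first exact: cvg_cst.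
  by apply: cvg_at_left_filter; exact: cvg_id.
by move: c2; under eq_fun do rewrite opprB addrC subrK.
Unshelve. all: by end_near. Qed.

(** This expresses [rgrad] by the values of [U] at countably many points. *)
Lemma rgrad_quot y : 0 < y ->
  (fun n : nat => n.+1%:R * (U (y + n.+1%:R^-1) - U y)) n @[n --> \oo] --> rgrad y.
Proof.
move=> y0; have [K K0 h] := supergrad_rgrad y0.
apply/cvgrPdist_le => /= e e0.
have e20 : 0 < e / 2 by rewrite divr_gt0.
have /cvgrPdist_le/(_ _ e20)[r /= r0 hr] := rgrad_right y0.
have hn : n.+1%:R^-1 @[n --> \oo] --> (0 : R) by exact: cvg_harmonic.
have K1 : 0 < K + 1 by lra.
have eK : 0 < e / 2 / (K + 1) by rewrite divr_gt0.
near=> n.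
have dr : n.+1%:R^-1 < r.
  near: n; move/cvgrPdist_lt: hn => /(_ r r0); apply: filterS => n.
  by rewrite sub0r normrN gtr0_norm ?invr_gt0.
have dK : n.+1%:R^-1 < e / 2 / (K + 1).
  near: n; move/cvgrPdist_lt: hn => /(_ _ eK); apply: filterS => n.
  by rewrite sub0r normrN gtr0_norm ?invr_gt0.
have d0 : 0 < n.+1%:R^-1 :> R by rewrite invr_gt0.
have -> : n.+1%:R * (U (y + n.+1%:R^-1) - U y) =
  n.+1%:R^-1^-1 * (U (y + n.+1%:R^-1) - U y) by rewrite invrK.
move: (n.+1%:R^-1) d0 dr dK => d d0 dr; rewrite ltr_pdivlMr// => dK.
have yd : y < y + d by lra.
have u1 := h y (y + d) (lexx y); have u2 := h (y + d) y (ltW yd).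
have := hr (y + d); rewrite /ball_ /= opprD addNKr normrN (gtr0_norm d0).
move=> /(_ dr yd); rewrite ler_norml => /andP[h1 h2].
rewrite (addrC y) addrK in u1.
rewrite opprD addNKr in u2.
have q1 : d^-1 * (U (y + d) - U y) <= rgrad y + K * d.
  by rewrite mulrC ler_pdivrMr// addrC (addrC y); move: u1; rewrite expr2; lra.
have q2 : rgrad (y + d) - K * d <= d^-1 * (U (y + d) - U y).
  rewrite [leRHS]mulrC ler_pdivlMr//; move: u2; rewrite sqrrN expr2.
  by move: (U _) (U _) (rgrad _) => *; lra.
rewrite ler_norml; apply/andP; split; lra.
Unshelve. all: by end_near. Qed.

End semiconcave.

(** * The Schwarzschild potential *)

Section geometry.
Context {R : realType} (M rs : R).
Hypothesis HM : 0 < M.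
Hypothesis Hrs : 2 * M < rs.
Implicit Types (r x y z : R).

(** Behind the wall the metric is frozen, so that the coordinate below maps the
    whole line onto itself. *)
Definition cut r : R := Num.max r rs.
Definition lapse r : R := Num.sqrt (1 - 2 * M / cut r).

Lemma rs_gt0 : 0 < rs.
Proof. by (move: HM Hrs; lra). Qed.

Lemma cut_ge r : rs <= cut r. Proof. by rewrite le_max lexx orbT. Qed.
Lemma cutE r : rs <= r -> cut r = r. Proof. by move=> h; apply/max_idPl. Qed.
Lemma cut_le r r' : r <= r' -> cut r <= cut r'.
Proof. by move=> h; rewrite /cut ge_max !le_max h lexx orbT. Qed.
Lemma cut_gt0 r : 0 < cut r.
Proof. exact: lt_le_trans rs_gt0 (cut_ge r). Qed.

Lemma lapse2_gt0 r : 0 < 1 - 2 * M / cut r.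
Proof.
by rewrite subr_gt0 ltr_pdivrMr ?cut_gt0// mul1r (lt_le_trans Hrs (cut_ge r)).
Qed.

Lemma lapse2 r : lapse r ^+ 2 = 1 - 2 * M / cut r.
Proof. by rewrite sqr_sqrtr// ltW// lapse2_gt0. Qed.

Lemma lapse_gt0 r : 0 < lapse r.
Proof. by rewrite sqrtr_gt0 lapse2_gt0. Qed.

Lemma lapse_le r r' : r <= r' -> lapse r <= lapse r'.
Proof.
move=> h; apply: ler_wsqrtr; rewrite lerD2l lerN2 ler_pM2l ?mulr_gt0//.
by rewrite lef_pV2 ?posrE ?cut_gt0// cut_le.
Qed.

Lemma lapse_le1 r : lapse r <= 1.
Proof.
rewrite -(sqrtr1 R); apply: ler_wsqrtr; rewrite gerBl divr_ge0//.
  by rewrite mulr_ge0// ltW.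
exact: ltW (cut_gt0 r).
Qed.

Lemma cut_cont : continuous cut.
Proof. by move=> r; apply: continuous_max; [exact: cvg_id|exact: cvg_cst]. Qed.

Lemma lapse_cont : continuous lapse.
Proof.
move=> r; apply: (@continuous_comp _ _ _ (fun r => 1 - 2 * M / cut r) Num.sqrt);
  last exact: sqrt_continuous.
apply: cvgB; first exact: cvg_cst.
apply: cvgM; first exact: cvg_cst.
by apply: cvgV; [rewrite gt_eqF ?cut_gt0|exact: cut_cont].
Qed.

Definition stretch r : R := (lapse r ^+ 3)^-1.

Lemma stretch_gt0 r : 0 < stretch r.
Proof. by rewrite invr_gt0 exprn_gt0// lapse_gt0. Qed.

Lemma stretch_ge1 r : 1 <= stretch r.
Proof.
rewrite -[leLHS]invr1 lef_pV2 ?posrE ?exprn_gt0 ?lapse_gt0//.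
by rewrite exprn_ile1 ?lapse_le1// ltW// lapse_gt0.
Qed.

Lemma stretch_le r : stretch r <= stretch rs.
Proof.
rewrite lef_pV2 ?posrE ?exprn_gt0 ?lapse_gt0// ler_pXn2r ?nnegrE ?(ltW (lapse_gt0 _))//.
apply: ler_wsqrtr; rewrite lerD2l lerN2 ler_pM2l ?mulr_gt0//.
by rewrite lef_pV2 ?posrE ?cut_gt0// cutE// cut_ge.
Qed.

Lemma stretch_cont : continuous stretch.
Proof.
move=> r; apply: cvgV; first by rewrite gt_eqF// exprn_gt0// lapse_gt0.
apply: (@continuous_comp _ _ _ lapse (fun x => x ^+ 3)); first exact: lapse_cont.
exact: exprn_continuous.
Qed.

(** In this coordinate the kinetic part of the Lagrangian is half the squared
    velocity: (u^2 - uE^2) / (1 - uE^2) = y'^2 - uE^2 / (1 - uE^2). *)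
Definition ycoord r : R := prim stretch r - prim stretch rs.

Lemma d_ycoord r : is_derive r 1 ycoord (stretch r).
Proof.
apply: is_derive_eq (dB (is_derive_primc r stretch_cont) (dC r (prim stretch rs))) _.
by rewrite subr0.
Qed.

Lemma ycoord_rs : ycoord rs = 0. Proof. by rewrite /ycoord subrr. Qed.

Lemma ycoord_lt r r' : r < r' -> ycoord r < ycoord r'.
Proof.
by move=> h; apply: (dmono_lt h (fun x _ => d_ycoord x)) => x _; exact: stretch_gt0.
Qed.

Lemma ycoord_le r r' : r <= r' -> ycoord r <= ycoord r'.
Proof. by rewrite le_eqVlt => /predU1P[->//|/ycoord_lt/ltW]. Qed.

Lemma ycoord_inj : injective ycoord.
Proof.
by move=> r r' e; case: (ltgtP r r') => // /ycoord_lt; rewrite e ltxx.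
Qed.

Lemma ycoord_expand r r' : r <= r' -> r' - r <= ycoord r' - ycoord r.
Proof.
move=> h; apply: (dcmp_le h (fun x _ => dI x) (fun x _ => d_ycoord x)) => x _.
exact: stretch_ge1.
Qed.

Lemma ycoord_lip r r' : r <= r' -> ycoord r' - ycoord r <= stretch rs * (r' - r).
Proof.
move=> h.
have := dcmp_le h (fun x _ => d_ycoord x) (fun x _ => dlin (stretch rs) x).
by rewrite mulrBr; apply=> x _; exact: stretch_le.
Qed.

Lemma ycoord_cont : continuous ycoord.
Proof. by move=> r; exact: is_derive_cont (d_ycoord r). Qed.

Lemma ycoord_surj y : exists r, ycoord r = y.
Proof.
have c a b : {within `[a, b], continuous ycoord} by apply: continuous_subspaceT; exact: ycoord_cont.
have [y0|y0] := leP 0 y.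
  have h : rs <= rs + y by (move: HM Hrs; lra).
  have e := ycoord_expand h; rewrite ycoord_rs in e.
  have [|r _ e'] := @IVT R ycoord rs (rs + y) y h (@c _ _); last by exists r.
  by rewrite ge_min ycoord_rs y0 le_max; apply/orP; right; (move: HM Hrs; lra).
have h : rs + y <= rs by (move: HM Hrs; lra).
have e := ycoord_expand h; rewrite ycoord_rs in e.
have [|r _ e'] := @IVT R ycoord (rs + y) rs y h (@c _ _); last by exists r.
by rewrite ge_min le_max ycoord_rs (ltW y0) orbT andbT; apply/orP; left; (move: HM Hrs; lra).
Qed.

Lemma rcoord_sig y : {r | ycoord r = y}.
Proof. by apply: cid; exact: ycoord_surj. Qed.

Definition rcoord y : R := projT1 (rcoord_sig y).

Lemma rcoordK : cancel rcoord ycoord.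
Proof. by move=> y; exact: (projT2 (rcoord_sig y)). Qed.

Lemma ycoordK : cancel ycoord rcoord.
Proof. by move=> r; apply: ycoord_inj; rewrite rcoordK. Qed.

Lemma rcoord0 : rcoord 0 = rs.
Proof. by rewrite -ycoord_rs ycoordK. Qed.

Lemma d_rcoord y : is_derive y 1 rcoord (stretch (rcoord y))^-1.
Proof.
rewrite -[y in is_derive y]rcoordK; apply: (@is_derive_inverse _ ycoord).
- by near=> r; exact: ycoordK.
- by near=> r; exact: ycoord_cont.
- exact: d_ycoord.
- by rewrite gt_eqF// stretch_gt0.
Unshelve. all: by end_near. Qed.

Lemma rcoord_lt y z : y < z -> rcoord y < rcoord z.
Proof.
move=> h; rewrite ltNge; apply/negP => /ycoord_le.
by rewrite !rcoordK leNgt h.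
Qed.

Lemma rcoord_le y z : y <= z -> rcoord y <= rcoord z.
Proof. by rewrite le_eqVlt => /predU1P[->//|/rcoord_lt/ltW]. Qed.

Lemma rcoord_contract y z : y <= z -> rcoord z - rcoord y <= z - y.
Proof. by move=> /rcoord_le/ycoord_expand; rewrite !rcoordK. Qed.

Lemma rcoord_ge y : 0 <= y -> rs <= rcoord y.
Proof. by move=> /rcoord_le; rewrite rcoord0. Qed.

Lemma ycoord_gt0 r : rs < r -> 0 < ycoord r.
Proof. by move=> /ycoord_lt; rewrite ycoord_rs. Qed.

(** The acceleration in the new coordinate, extended by a constant behind the
    wall. *)
Definition pull r : R := M / cut r ^+ 2 / lapse r.

Lemma pull_gt0 r : 0 < pull r.
Proof. by rewrite !divr_gt0// ?exprn_gt0 ?cut_gt0 ?lapse_gt0. Qed.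

Lemma pull_nincr r r' : r <= r' -> pull r' <= pull r.
Proof.
move=> h; rewrite /pull ler_pM ?invr_ge0 ?(ltW (lapse_gt0 _))//.
- by rewrite divr_ge0 ?exprn_ge0 ?ltW ?cut_gt0.
- rewrite ler_pM2l// lef_pV2 ?posrE ?exprn_gt0 ?cut_gt0//.
  by rewrite ler_pXn2r ?nnegrE ?(ltW (cut_gt0 _))// cut_le.
- by rewrite lef_pV2 ?posrE ?lapse_gt0// lapse_le.
Qed.

Lemma pull_le r : pull r <= pull rs.
Proof.
have [h|h] := leP rs r; first exact: pull_nincr.
by rewrite /pull /lapse /cut maxxx (max_idPr _) ?(ltW h).
Qed.

Lemma pull_cont : continuous pull.
Proof.
move=> r; apply: cvgM; last first.
  by apply: cvgV; [rewrite gt_eqF ?lapse_gt0|exact: lapse_cont].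
apply: cvgM; first exact: cvg_cst.
apply: cvgV; first by rewrite gt_eqF// exprn_gt0// cut_gt0.
apply: (@continuous_comp _ _ _ cut (fun x => x ^+ 2)); first exact: cut_cont.
exact: exprn_continuous.
Qed.

Lemma dV t (f : R -> R) a : f t != 0 -> is_derive t 1 f a ->
  is_derive t 1 (fun x => (f x)^-1) (- a / f t ^+ 2).
Proof.
move=> f0 da; apply: is_derive_eq (is_deriveV f0 da) _.
by rewrite /GRing.scale /= mulNr mulrC -mulNr.
Qed.

(** Without the cut, so as to differentiate at the wall from both sides. *)
Definition lapse' r : R := Num.sqrt (1 - 2 * M / r).

Lemma lapse'E r : rs <= r -> lapse' r = lapse r.
Proof. by move=> h; rewrite /lapse cutE. Qed.

Lemma d_lapse' r : rs <= r -> is_derive r 1 lapse' (M / r ^+ 2 / lapse r).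
Proof.
move=> h; have r0 : r != 0 by rewrite gt_eqF//; have := rs_gt0; (move: HM Hrs; lra).
have d1 : is_derive r 1 (fun r => 1 - 2 * M * r^-1) (2 * M / r ^+ 2).
  apply: is_derive_eq (dB (dC r 1) (dZ (2 * M) (dV r0 (dI r)))) _.
  by rewrite sub0r mulNr mulrN opprK mul1r.
have pos : 0 < 1 - 2 * M * r^-1 by have := lapse2_gt0 r; rewrite cutE.
apply: is_derive_eq (dcomp d1 (is_derive1_sqrt pos)) _.
rewrite -/(lapse' r) lapse'E//; field.
by rewrite r0 gt_eqF// lapse_gt0.
Qed.

Definition pull_lip : R :=
  2 * M / rs ^+ 3 / lapse rs + M ^+ 2 / rs ^+ 4 / lapse rs ^+ 3.

Lemma pull_lip_gt0 : 0 < pull_lip.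
Proof.
have r0 := rs_gt0; have l0 := lapse_gt0 rs.
by rewrite addr_gt0// !divr_gt0// ?mulr_gt0// ?exprn_gt0.
Qed.

Lemma pull_lipR r r' : rs <= r -> r <= r' -> pull r - pull r' <= pull_lip * (r' - r).
Proof.
move=> h rr.
pose F x := M * ((x ^+ 2)^-1 * (lapse' x)^-1).
have FE x : rs <= x -> pull x = F x.
  by move=> hx; rewrite /pull /F lapse'E// cutE// mulrA.
have d x : r <= x <= r' -> is_derive x 1 F
   (- (2 * M / x ^+ 3 / lapse x + M ^+ 2 / x ^+ 4 / lapse x ^+ 3)).
  move=> /andP[rx _]; have hx : rs <= x by exact: le_trans rx.
  have x0 : x != 0 by rewrite gt_eqF//; have := rs_gt0; (move: HM Hrs; lra).
  have x20 : x ^+ 2 != 0 by rewrite expf_neq0.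
  have l0 : lapse' x != 0 by rewrite lapse'E// gt_eqF// lapse_gt0.
  have d1 := @dV x (fun x => x ^+ 2) _ x20 (dX2 (dI x)); have d2 := dV l0 (d_lapse' hx).
  apply: is_derive_eq (dZ M (dM d1 d2)) _; rewrite lapse'E//.
  rewrite lapse'E// in l0; field; by rewrite x0 l0.
have := dcmp_le rr (fun x _ => dlin (- pull_lip) x) d.
rewrite !FE//; last exact: le_trans rr.
move=> H; suff : - pull_lip * r' - - pull_lip * r <= F r' - F r by (move: HM Hrs; lra).
apply: H => x /andP[rx _]; rewrite lerN2 /pull_lip.
have hx : rs <= x by exact: le_trans rx.
have r0 := rs_gt0; have x0 : 0 < x by (move: HM Hrs; lra).
have lx := lapse_le hx; have l1 := lapse_gt0 rs; have l2 := lapse_gt0 x.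
have iX n : (x ^+ n)^-1 <= (rs ^+ n)^-1.
  by rewrite lef_pV2 ?posrE ?exprn_gt0//; apply: lerXn2r => //; rewrite nnegrE ltW.
have iL n : (lapse x ^+ n)^-1 <= (lapse rs ^+ n)^-1.
  by rewrite lef_pV2 ?posrE ?exprn_gt0//; apply: lerXn2r => //; rewrite nnegrE ltW.
have p1 : 2 * M / x ^+ 3 <= 2 * M / rs ^+ 3 by rewrite ler_pM2l ?mulr_gt0.
have p2 : (lapse x)^-1 <= (lapse rs)^-1 by rewrite lef_pV2 ?posrE.
have p3 : M ^+ 2 / x ^+ 4 <= M ^+ 2 / rs ^+ 4 by rewrite ler_pM2l ?exprn_gt0.
have q1 : 0 <= 2 * M / x ^+ 3 by rewrite divr_ge0 ?mulr_ge0 ?exprn_ge0// ltW.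
have q2 : 0 <= (lapse x)^-1 by rewrite invr_ge0 ltW.
have q3 : 0 <= M ^+ 2 / x ^+ 4 by rewrite divr_ge0 ?exprn_ge0// ltW.
have q4 : 0 <= (lapse x ^+ 3)^-1 by rewrite invr_ge0 exprn_ge0// ltW.
exact: lerD (ler_pM q1 q2 p1 p2) (ler_pM q3 q4 p3 (iL 3)).
Qed.

Definition sforce y : R := pull (rcoord y).

Lemma sforce_cont : continuous sforce.
Proof.
move=> y; apply: (@continuous_comp _ _ _ rcoord pull); last exact: pull_cont.
exact: is_derive_cont (d_rcoord y).
Qed.

Definition spot y : R := M / (rs - 2 * M) - prim sforce y.

Lemma d_spot y : is_derive y 1 spot (- sforce y).
Proof.
apply: is_derive_eq (dB (dC y _) (is_derive_primc y sforce_cont)) _.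
by rewrite sub0r.
Qed.

(** K + P has the potential part -uE^2 / (2 (1 - uE^2)) + 2M / (r - 2M), which
    is M / (r - 2M). *)
Lemma spotE r : rs <= r -> spot (ycoord r) = M / (r - 2 * M).
Proof.
move=> h.
have d1 x : rs <= x <= r -> is_derive x 1 (fun x => spot (ycoord x)) (- M / (x - 2 * M) ^+ 2).
  move=> /andP[hx _].
  apply: is_derive_eq (dcomp (d_ycoord x) (d_spot (ycoord x))) _.
  rewrite /sforce ycoordK /pull /stretch cutE//.
  have x0 : x != 0 by rewrite gt_eqF//; have := rs_gt0; (move: HM Hrs; lra).
  have l0 : lapse x != 0 by rewrite gt_eqF// lapse_gt0.
  have xM : x - 2 * M != 0 by rewrite gt_eqF//; (move: HM Hrs; lra).
  have E : (lapse x ^+ 4) = ((x - 2 * M) / x) ^+ 2.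
    rewrite (_ : lapse x ^+ 4 = (lapse x ^+ 2) ^+ 2); last by rewrite -exprM.
    by rewrite lapse2 cutE//; congr (_ ^+ 2); field.
  have -> : - (M / x ^+ 2 / lapse x) / lapse x ^+ 3 = - M / (x ^+ 2 * lapse x ^+ 4).
    by field; rewrite x0 l0.
  by rewrite E; field; rewrite x0 xM.
have d2 x : rs <= x <= r -> is_derive x 1 (fun x => M * (x - 2 * M)^-1) (- M / (x - 2 * M) ^+ 2).
  move=> /andP[hx _].
  have xM : x - 2 * M != 0 by rewrite gt_eqF//; (move: HM Hrs; lra).
  have d := @dV x (fun x => x - 2 * M) _ xM (dB (dI x) (dC x (2 * M))).
  apply: is_derive_eq (dZ M d) _.
  by rewrite subr0 !mulNr mul1r mulrN.
have := deriv_eq h d1 d2; rewrite ycoord_rs /spot prim0 subr0.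
by move=> /(congr1 (fun x => x + M / (rs - 2 * M))); rewrite !subrK.
Qed.

Lemma spot_ge0 y : 0 <= spot y.
Proof.
have [y0|/ltW y0] := leP 0 y.
  have := spotE (rcoord_ge y0); rewrite rcoordK => ->.
  apply: divr_ge0; first exact: ltW.
  by have := rcoord_ge y0; (move: HM Hrs; lra).
have h : 0 <= spot 0.
  rewrite /spot prim0 subr0; apply: divr_ge0; first exact: ltW.
  by move: HM Hrs; lra.
apply: (le_trans h).
have := dcmp_le y0 (fun x _ => d_spot x) (fun x _ => dC x 0).
rewrite subrr subr_le0; apply=> x _; by rewrite oppr_le0 ltW// pull_gt0.
Qed.

Lemma sforceL y z : `|sforce y - sforce z| <= pull_lip * `|y - z|.
Proof.
wlog yz : y z / y <= z.
  move=> H; have [/H//|/ltW/H] := leP y z.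
  by rewrite distrC [`|z - y|]distrC.
have rr := rcoord_le yz.
rewrite ger0_norm ?subr_ge0 ?pull_nincr// distrC ger0_norm ?subr_ge0//.
have c x : pull x = pull (cut x).
  by rewrite /pull /lapse [cut (cut x)]cutE ?cut_ge.
rewrite /sforce (c (rcoord y)) (c (rcoord z)).
apply: (le_trans (pull_lipR (cut_ge _) (cut_le rr))).
rewrite ler_pM2l ?pull_lip_gt0//; apply: le_trans (rcoord_contract yz).
rewrite /cut; case: (leP rs (rcoord y)) => a; case: (leP rs (rcoord z)) => b; (move: HM Hrs; lra).
Qed.

Definition schw : convex_potential R :=
  @ConvexPotential R spot sforce (pull rs) pull_lip d_spot spot_ge0
    (fun y => pull_gt0 _) (fun y => pull_le _)
    (fun y z yz => pull_nincr (rcoord_le yz)) pull_lip_gt0 sforceL.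

Lemma pot_ycoord r : rs <= r -> pot schw (ycoord r) = M / (r - 2 * M).
Proof. exact: spotE. Qed.

Lemma cspeed_ycoord r : rs <= r -> cspeed schw (ycoord r) = (lapse r)^-1.
Proof.
move=> h; have l0 := lapse_gt0 r.
apply/eqP; rewrite -(eqrXn2 (n := 2))// ?(ltW (cspeed_gt0 _ _)) ?invr_ge0 ?(ltW l0)//.
rewrite cspeed2 pot_ycoord// exprVn lapse2 cutE//.
have r0 := rs_gt0; apply/eqP; field.
apply/andP; split; rewrite gt_eqF//; (move: HM Hrs; lra).
Qed.

Lemma d_light_ycoord r : rs <= r ->
  is_derive r 1 (fun r => light schw (ycoord r)) (lapse r ^+ 2)^-1.
Proof.
move=> h; apply: is_derive_eq (dcomp (d_ycoord r) (d_light schw (ycoord r))) _.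
rewrite cspeed_ycoord// /stretch; field.
by rewrite gt_eqF// lapse_gt0.
Qed.

(** The coordinate speed of light, 1 - 2M / r, is below one. *)
Lemma light_ycoord_expand r r' : rs <= r -> r <= r' ->
  r' - r <= light schw (ycoord r') - light schw (ycoord r).
Proof.
move=> h rr.
have d x : r <= x <= r' -> is_derive x 1 (fun r => light schw (ycoord r)) (lapse x ^+ 2)^-1.
  by move=> /andP[rx _]; apply: d_light_ycoord; exact: le_trans rx.
apply: (dcmp_le rr (fun x _ => dI x) d) => x _.
rewrite -[leLHS]invr1 lef_pV2 ?posrE ?exprn_gt0 ?lapse_gt0//.
by rewrite exprn_ile1 ?lapse_le1// ltW// lapse_gt0.
Qed.

End geometry.

(** * The action of stays and of characteristics *)

Section bounded_measurable.
Context {R : realType}.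
Local Notation mu := (@lebesgue_measure R).
Implicit Types (f g : R -> R) (a b c t K : R).

Definition bmeas f a b := measurable_fun `[a, b] f /\
  exists K, forall t, a <= t <= b -> `|f t| <= K.

Lemma bmeas_integrable f a b : bmeas f a b -> mu.-integrable `[a, b] (EFin \o f).
Proof.
move=> [mf [K hK]]; apply: measurable_bounded_integrable => //.
  by rewrite /= lebesgue_measure_itv/=; case: ifP => _; rewrite ?ltry// -EFinD ltry.
exists K; split; first exact: num_real.
move=> x Kx t /=; rewrite in_itv/= => tab; apply: le_trans (ltW Kx); exact: hK.
Qed.

Lemma bmeas_cat f a b c : a <= b -> b <= c -> bmeas f a b -> bmeas f b c -> bmeas f a c.
Proof.
move=> ab bc [m1 [K1 h1]] [m2 [K2 h2]]; split.
  rewrite (_ : [set` `[a, c]] = [set` `[a, b]] `|` [set` `[b, c]]).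
    by apply/measurable_funU => //; split.
  apply/seteqP; split=> x /=; rewrite !in_itv/=.
    by move=> /andP[ax xc]; have [xb|/ltW bx] := leP x b; [left|right];
      rewrite ?ax ?xb ?bx ?xc.
  move=> [/andP[ax xb]|/andP[bx xc]]; apply/andP; split => //.
    exact: le_trans bc.
  exact: le_trans bx.
exists (Num.max K1 K2) => t /andP[at_ tc].
have [tb|/ltW bt] := leP t b.
  by rewrite le_max h1// at_ tb.
by rewrite le_max h2 ?orbT// bt tc.
Qed.

Lemma bmeas_oo f a b K : a < b -> (forall t, a < t < b -> {for t, continuous f}) ->
  (forall t, a < t < b -> `|f t| <= K) -> bmeas f a b.
Proof.
move=> ab cf hK; split.
  apply/measurable_fun_itv_bndo_bndcP/measurable_fun_itv_obnd_cbndP.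
  apply: open_continuous_measurable_fun; first exact: interval_open.
  by move=> x; rewrite inE/= in_itv/=; exact: cf.
exists (Num.max K (Num.max `|f a| `|f b|)) => t /andP[at_ tb].
rewrite !le_max; have [<-|ta] := eqVneq a t; first by rewrite lexx orbT.
have [->|tb'] := eqVneq t b; first by rewrite lexx !orbT.
by rewrite hK// lt_neqAle ta at_ lt_neqAle tb' tb.
Qed.

Lemma indefinite f a b : a < b -> bmeas f a b ->
  (forall t, a < t < b -> {for t, continuous f}) ->
  let Phi := fun x => \int[mu]_(t in `[a, x]) f t in
  {within `[a, b], continuous Phi} /\
  forall t, a < t < b -> is_derive t 1 Phi (f t).
Proof.
move=> ab bf cf Phi; have fi := bmeas_integrable bf; split.
  exact: parameterized_integral_continuous (ltW ab) fi.
move=> t /[dup] tab /andP[at_ tb].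
have [d e] := continuous_FTC1_closed tb fi at_ (cf t tab).
by rewrite derive1E in e; exact: DeriveDef d e.
Qed.

Lemma cont_near t f g : (\forall x \near t, f x = g x) ->
  {for t, continuous f} -> {for t, continuous g}.
Proof.
move=> fg cf; rewrite /prop_for /continuous_at -(nbhs_singleton fg).
by apply: cvg_trans cf; exact: near_eq_cvg.
Qed.

Lemma prim_le f g s t : locint f -> locint g ->
  (forall x, s <= x <= t -> f x <= g x) -> s <= t ->
  prim f t - prim f s <= prim g t - prim g s.
Proof.
move=> fi gi fg st; rewrite !prim_itv//; apply: le_Rintegral => //.
Qed.

Lemma prim_cst (k s t : R) : s <= t -> prim (fun=> k) t - prim (fun=> k) s = k * (t - s).
Proof.
move=> st; rewrite mulrBr; apply: (deriv_eq st _ (fun x _ => dlin k x)) => x _.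
by apply: is_derive_primc => ?; apply: cvg_cst.
Qed.

Lemma locint_cst (k : R) : locint (fun=> k).
Proof. by apply: continuous_locint => ?; apply: cvg_cst. Qed.

End bounded_measurable.

Section gain.
Context {R : realType} (M rs : R) (ph : R -> R).
Hypothesis HM : 0 < M.
Hypothesis Hrs : 2 * M < rs.
Hypothesis mph : measurable_fun [set: R] ph.
Hypothesis ph1 : forall t, -1 < ph t < 1.
Local Notation mu := (@lebesgue_measure R).
Local Notation p := (schw HM Hrs).

Lemma uE2 r : rs <= r -> uE M r ^+ 2 = 2 * M / r.
Proof.
move=> h; rewrite sqr_sqrtr// divr_ge0// ?mulr_ge0 ?(ltW HM)//.
by apply: le_trans h; exact: ltW (rs_gt0 HM Hrs).
Qed.

Lemma uE_lapse r : rs <= r -> 1 - uE M r ^+ 2 = lapse M rs r ^+ 2.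
Proof. by move=> h; rewrite uE2// lapse2// cutE. Qed.

(** The rate of gain at the wall. *)
Definition gain t : R :=
  2^-1 * ((Num.max (ph t) 0 ^+ 2 - uE M rs ^+ 2) / (1 - uE M rs ^+ 2)).
(** The positive part bounds the profit that any interval of time can bring. *)
Definition gainp t : R := Num.max (gain t) 0.

Lemma gain_lt t : gain t < 2^-1.
Proof.
have l0 : 0 < 1 - uE M rs ^+ 2 by rewrite uE_lapse// exprn_gt0// lapse_gt0.
rewrite /gain -[ltRHS]mulr1 ltr_pM2l ?invr_gt0// ltr_pdivrMr// mul1r ltrD2r.
have /andP[h1 h2] := ph1 t.
have m0 : 0 <= Num.max (ph t) 0 by rewrite le_max lexx orbT.
by rewrite expr_lt1// gt_max; apply/andP; split.
Qed.

Lemma gain_ge t : - pot p 0 <= gain t.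
Proof.
have l0 : 0 < 1 - uE M rs ^+ 2 by rewrite uE_lapse// exprn_gt0// lapse_gt0.
have -> : - pot p 0 = 2^-1 * (- uE M rs ^+ 2 / (1 - uE M rs ^+ 2)).
  rewrite -(ycoord_rs M rs) pot_ycoord// uE2//; have r0 := rs_gt0 HM Hrs.
  field; rewrite !gt_eqF//; move: Hrs; lra.
rewrite /gain ler_pM2l ?invr_gt0// ler_pM2r ?invr_gt0// lerDr.
exact: sqr_ge0.
Qed.

Lemma gainp_lt t : gainp t < 2^-1.
Proof. by rewrite /gainp gt_max gain_lt/= invr_gt0 ltr0n. Qed.

Lemma gainp_ge0 t : 0 <= gainp t.
Proof. by rewrite le_max lexx orbT. Qed.

Lemma gain_meas : measurable_fun [set: R] gain.
Proof.
apply: measurable_funM; first exact: measurable_cst.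
apply: measurable_funM; last exact: measurable_cst.
apply: measurable_funB; last exact: measurable_cst.
by apply: measurable_funX; apply: measurable_maxr => //; exact: measurable_cst.
Qed.

Lemma gain_bmeas a b : bmeas gain a b.
Proof.
split; first exact: measurable_funTS gain_meas.
exists (pot p 0 + 2^-1) => t _; rewrite ler_norml.
have := gain_ge t; have := gain_lt t; have := pot_ge0 p 0.
by move=> *; apply/andP; split; lra.
Qed.

Lemma gain_locint : locint gain.
Proof. by move=> a b; exact: bmeas_integrable (gain_bmeas a b). Qed.

Lemma gainp_locint : locint gainp.
Proof.
move=> a b; apply: bmeas_integrable; split.
  apply: measurable_funTS; apply: measurable_maxr; first exact: gain_meas.
  exact: measurable_cst.
by exists 2^-1 => t _; rewrite ger0_norm ?gainp_ge0//; exact/ltW/gainp_lt.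
Qed.

Definition beta := prim gain.
Definition betap := prim gainp.

Lemma betap_dom s t : s <= t -> beta t - beta s <= betap t - betap s.
Proof.
apply: prim_le; [exact: gain_locint|exact: gainp_locint|].
by move=> x _; rewrite le_max lexx.
Qed.

Lemma betap_ge s t : s <= t -> betap s <= betap t.
Proof.
move=> st; rewrite -subr_ge0 -[0](mul0r (t - s)) -(prim_cst 0 st).
apply: prim_le st; [exact: locint_cst|exact: gainp_locint|].
by move=> x _; exact: gainp_ge0.
Qed.

Lemma betap_half s t : s <= t -> betap t - betap s <= (t - s) / 2.
Proof.
move=> st; rewrite mulrC -(prim_cst 2^-1 st).
apply: prim_le st; [exact: gainp_locint|exact: locint_cst|].
by move=> x _; exact/ltW/gainp_lt.
Qed.

Lemma beta_ge s t : s <= t -> - pot p 0 * (t - s) <= beta t - beta s.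
Proof.
move=> st; rewrite -(prim_cst (- pot p 0) st).
apply: prim_le st; [exact: locint_cst|exact: gain_locint|].
by move=> x _; exact: gain_ge.
Qed.

End gain.

Section arcs.
Context {R : realType} (M rs : R) (ph : R -> R).
Hypothesis HM : 0 < M.
Hypothesis Hrs : 2 * M < rs.
Hypothesis mph : measurable_fun [set: R] ph.
Hypothesis ph1 : forall t, -1 < ph t < 1.
Local Notation mu := (@lebesgue_measure R).
Local Notation p := (schw HM Hrs).
Local Notation Y := (ycoord M rs).
Implicit Types (chi : R -> R) (a b c t : R).

Definition kK chi t : R := (velocity M chi t ^+ 2 - uE M (chi t) ^+ 2)
  / (1 - uE M (chi t) ^+ 2) * \1_[set t' | rs < chi t'] t.
Definition kP chi t : R := 2 * M / (chi t - 2 * M) * \1_[set t' | rs < chi t'] t.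
Definition kB chi t : R := (Num.max (ph t) 0 ^+ 2 - uE M rs ^+ 2)
  / (1 - uE M rs ^+ 2) * \1_[set t' | chi t' = rs] t.

Definition pcost a b chi : R := Kact M rs a b chi + Pact M rs a b chi - Bact M rs ph a b chi.

(** Integrability of the three integrands, for splitting the actions at
    intermediate times. *)
Definition tame chi a b := [/\ bmeas (kK chi) a b, bmeas (kP chi) a b & bmeas (kB chi) a b].

Lemma pcost_split chi a b c : a <= b -> b <= c -> tame chi a c ->
  pcost a c chi = pcost a b chi + pcost b c chi.
Proof.
move=> ab bc [/bmeas_integrable t1 /bmeas_integrable t2 /bmeas_integrable t3].
rewrite /pcost /Kact /Pact /Bact (Rint_split ab bc t1) (Rint_split ab bc t2).
by rewrite (Rint_split ab bc t3); ring.
Qed.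

Lemma pcost_refl chi a : pcost a a chi = 0.
Proof. by rewrite /pcost /Kact /Pact /Bact set_itv1 !Rintegral_set1; ring. Qed.

Lemma tame_refl chi a : tame chi a a.
Proof.
have h f : bmeas f a a.
  split; first by rewrite set_itv1; exact: measurable_fun_set1.
  exists `|f a| => t /andP[h1 h2]; rewrite (_ : t = a)//.
  by apply/eqP; rewrite eq_le h1 h2.
by split.
Qed.

Lemma tame_cat chi a b c : a <= b -> b <= c -> tame chi a b -> tame chi b c -> tame chi a c.
Proof.
by move=> ab bc [h1 h2 h3] [g1 g2 g3]; split; apply: (bmeas_cat ab bc).
Qed.

Lemma eq_bmeas (f g : R -> R) a b : (forall t, a <= t <= b -> f t = g t) ->
  bmeas f a b -> bmeas g a b.
Proof.
move=> fg [mf [K hK]]; split.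
  by apply: eq_measurable_fun mf => t; rewrite inE/= in_itv/=; exact: fg.
by exists K => t tab; rewrite -fg// hK.
Qed.

Lemma stay_cost chi a b : a <= b -> (forall t, a <= t <= b -> chi t = rs) ->
  tame chi a b /\ pcost a b chi = beta M rs ph a - beta M rs ph b.
Proof.
move=> ab st.
have e1 t : a <= t <= b -> kK chi t = 0.
  by move=> /st e; rewrite /kK indicE memNset ?mulr0//= e ltxx.
have e2 t : a <= t <= b -> kP chi t = 0.
  by move=> /st e; rewrite /kP indicE memNset ?mulr0//= e ltxx.
have e3 t : a <= t <= b -> kB chi t = 2 * gain M rs ph t.
  by move=> /st e; rewrite /kB indicE mem_set//= mulr1 /gain mulrA divff ?mul1r.
have z : bmeas (fun=> 0 : R) a b.
  split; first exact: measurable_cst.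
  by exists 0 => t _; rewrite normr0.
have gb := gain_bmeas HM Hrs mph ph1 a b.
have g2 : bmeas (fun t => 2 * gain M rs ph t) a b.
  case: gb => mg [K hK]; split; first exact: measurable_funM (measurable_cst _) mg.
  by exists (2 * K) => t tab; rewrite normrM gtr0_norm// ler_pM2l// hK.
split.
  split.
  - by apply: eq_bmeas z => t /e1.
  - by apply: eq_bmeas z => t /e2.
  - by apply: eq_bmeas g2 => t /e3.
rewrite /pcost /Kact /Pact /Bact.
have int0 f : (forall t, a <= t <= b -> f t = 0) -> \int[mu]_(t in `[a, b]) f t = 0.
  move=> h; rewrite (@eq_Rintegral _ _ _ _ _ (fun=> 0)).
    by rewrite Rintegral_cst// mul0r.
  by move=> t; rewrite inE/= in_itv/=; exact: h.
have E : \int[mu]_(t in `[a, b]) kB chi t = 2 * \int[mu]_(t in `[a, b]) gain M rs ph t.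
  rewrite -RintegralZl//; last exact: bmeas_integrable gb.
  by apply: eq_Rintegral => t; rewrite inE/= in_itv/=; exact: e3.
rewrite (int0 _ e1) (int0 _ e2) E.
by rewrite -(prim_itv (gain_locint HM Hrs mph ph1) ab) /beta; field.
Qed.

Lemma derive_right_le (f : R -> R) t b e : is_derive t 1 f b -> 0 < e ->
  exists2 dl, 0 < dl & forall d, 0 < d -> d < dl -> f (t + d) - f t <= (b + e) * d.
Proof.
move=> df e0.
have dg : is_derive (- t) 1 (fun x => - f (- x)) b.
  have d1 : is_derive (- t) 1 (fun x : R => - x) (-1) by exact: dN (dI _).
  have d2 : is_derive (- - t) 1 f b by rewrite opprK.
  by apply: is_derive_eq (dN (dcomp d1 d2)) _; rewrite mulrN1 opprK.
have [dl dl0 h] := derive_left_le dg e0; exists dl => // d d0 dd.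
have := h d d0 dd; rewrite !opprK (_ : - (- t - d) = t + d); last by ring.
by move: (f t) (f (t + d)) => ? ?; lra.
Qed.

Section one_arc.
Variables (chi : R -> R) (a b : R).
Hypothesis ab : a < b.
Hypothesis cchi : {within `[a, b], continuous chi}.
Hypothesis chi_ge : forall t, a <= t <= b -> rs <= chi t.
Hypothesis char : characteristic M chi a b.
Local Notation v := (velocity M chi).

Let ge t : a < t < b -> rs <= chi t.
Proof. by move=> /andP[/ltW h1 /ltW h2]; apply: chi_ge; rewrite h1 h2. Qed.

Lemma d_chi t : a < t < b -> is_derive t 1 chi (v t * lapse M rs (chi t) ^+ 2).
Proof.
move=> tab; have [d _ _] := char tab; split => //.
by rewrite /velocity derive1E (uE_lapse HM Hrs (ge tab)) divfK// gt_eqF// exprn_gt0// lapse_gt0.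
Qed.

(** Where a characteristic touched the wall its velocity would vanish, and gravity
    would push it behind the wall. *)
Lemma arc_interior t : a < t < b -> rs < chi t.
Proof.
move=> /[dup] tab /andP[at_ tb]; rewrite lt_neqAle ge// andbT; apply/eqP => e.
have m : forall q, q \in `]a, b[ -> chi t <= chi q.
  by move=> q; rewrite in_itv/= -e; exact: ge.
have tin : t \in `]a, b[ by rewrite in_itv/=.
have dr : forall q, q \in `]a, b[ -> derivable chi q 1.
  by move=> q; rewrite in_itv/= => /char[].
have [_ D0] := derive1_at_min (ltW ab) dr tin m.
have v0 : v t = 0 by rewrite /velocity derive1E D0 mul0r.
have [_ _ dv] := char tab.
have k0 : 0 < M / chi t ^+ 2 by rewrite divr_gt0// exprn_gt0// -e (rs_gt0 HM Hrs).
have e0 : 0 < M / chi t ^+ 2 / 2 by rewrite divr_gt0.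
have [dl dl0 h] := derive_right_le dv e0.
pose d := Num.min (dl / 2) ((b - t) / 2).
have d0 : 0 < d by rewrite lt_min !divr_gt0// subr_gt0.
have d1 : d < dl by rewrite gt_min; apply/orP; left; lra.
have d2 : t + d < b.
  have : d <= (b - t) / 2 by rewrite ge_min lexx orbT.
  lra.
have neg q : t < q <= t + d -> v q < 0.
  move=> /andP[tq qd]; have := h (q - t); rewrite (_ : t + (q - t) = q) ?v0 ?subr0; last by ring.
  rewrite subr_gt0 => /(_ tq) H; apply: le_lt_trans (H _) _; first by lra.
  have qt : 0 < q - t by lra.
  rewrite expr0n /= sub0r mulrN1 nmulr_rlt0//; lra.
have D x : x \in `]t, (t + d)[ -> is_derive x 1 chi (v x * lapse M rs (chi x) ^+ 2).
  rewrite in_itv/= => /andP[tx xd]; apply: d_chi.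
  by rewrite (lt_trans at_ tx) (lt_trans xd d2).
have C : {within `[t, (t + d)], continuous chi}.
  by apply: withinS cchi; [exact: ltW|exact: ltW].
have td : t < t + d by rewrite ltrDl.
have [c /[!in_itv]/= /andP[tc cd] E] := MVT td D C.
have : chi (t + d) - chi t < 0.
  rewrite E (_ : t + d - t = d); last by ring.
  rewrite pmulr_llt0// pmulr_llt0 ?exprn_gt0 ?lapse_gt0//.
  by apply: neg; rewrite tc ltW.
rewrite -e subr_lt0 ltNge ge//; apply/andP; split; lra.
Qed.

Let hK t : R := (v t ^+ 2 - 2 * M / chi t) / (1 - 2 * M / chi t).
Let hP t : R := 2 * M / (chi t - 2 * M).

Let kKE t : a < t < b -> kK chi t = hK t.
Proof.
by move=> tab; rewrite /kK indicE mem_set ?mulr1 /= ?arc_interior// (uE2 HM Hrs (ge tab)).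
Qed.

Let kPE t : a < t < b -> kP chi t = hP t.
Proof. by move=> tab; rewrite /kP indicE mem_set ?mulr1 /= ?arc_interior. Qed.

Let kBE t : a < t < b -> kB chi t = 0.
Proof.
move=> tab; rewrite /kB indicE memNset ?mulr0//= => e.
by have := arc_interior tab; rewrite e ltxx.
Qed.

Let v_cont t : a < t < b -> {for t, continuous v}.
Proof. by move=> tab; have [_ _ d] := char tab; exact: is_derive_cont d. Qed.

Let chi_cont t : a < t < b -> {for t, continuous chi}.
Proof. by move=> tab; exact: is_derive_cont (d_chi tab). Qed.

Let den t : a < t < b -> 0 < 1 - 2 * M / chi t.
Proof. by move=> tab; rewrite -(uE2 HM Hrs (ge tab)) (uE_lapse HM Hrs (ge tab)) exprn_gt0// lapse_gt0. Qed.

Let chi_gt0 t : a < t < b -> 0 < chi t.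
Proof. by move=> tab; apply: lt_le_trans (ge tab); exact: rs_gt0 HM Hrs. Qed.

Let den2 t : a < t < b -> 0 < chi t - 2 * M.
Proof. by move=> tab; have := ge tab; move: Hrs; lra. Qed.

Let hK_cont t : a < t < b -> {for t, continuous hK}.
Proof.
move=> tab; apply: cvgM.
  apply: cvgB.
    by apply: (@continuous_comp _ _ _ v (fun x => x ^+ 2));
      [exact: v_cont|exact: exprn_continuous].
  apply: cvgM; first exact: cvg_cst.
  by apply: cvgV; [rewrite gt_eqF ?chi_gt0|exact: chi_cont].
apply: cvgV; first by rewrite gt_eqF ?den.
apply: cvgB; first exact: cvg_cst.
apply: cvgM; first exact: cvg_cst.
by apply: cvgV; [rewrite gt_eqF ?chi_gt0|exact: chi_cont].
Qed.

Let hP_cont t : a < t < b -> {for t, continuous hP}.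
Proof.
move=> tab; apply: cvgM; first exact: cvg_cst.
apply: cvgV; first by rewrite gt_eqF ?den2.
by apply: cvgB; [exact: chi_cont|exact: cvg_cst].
Qed.

Let near_ab t (P : R -> Prop) : a < t < b -> (forall x, a < x < b -> P x) ->
  \forall x \near t, P x.
Proof. exact: near_in_oo. Qed.

Let kK_cont t : a < t < b -> {for t, continuous (kK chi)}.
Proof.
move=> tab; apply: cont_near (hK_cont tab).
by apply: near_ab tab _ => x xab; rewrite kKE.
Qed.

Let kP_cont t : a < t < b -> {for t, continuous (kP chi)}.
Proof.
move=> tab; apply: cont_near (hP_cont tab).
by apply: near_ab tab _ => x xab; rewrite kPE.
Qed.

Let kB_cont t : a < t < b -> {for t, continuous (kB chi)}.
Proof.
move=> tab; apply: (@cont_near _ _ (fun=> 0)); last exact: cvg_cst.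
by apply: near_ab tab _ => x xab; rewrite kBE.
Qed.

Lemma arc_tame : tame chi a b.
Proof.
have l0 : 0 < lapse M rs rs ^+ 2 by rewrite exprn_gt0// lapse_gt0.
split.
- apply: (bmeas_oo (K := (lapse M rs rs ^+ 2)^-1) ab kK_cont) => t tab.
  rewrite kKE// /hK normrM normfV (gtr0_norm (den tab)).
  have [_ /andP[v1 v2] _] := char tab.
  have v2' : v t ^+ 2 < 1.
    by rewrite -(real_normK (num_real _)) expr_lt1// ltr_norml v1.
  have d1 := den tab.
  have u0 : 0 <= 2 * M / chi t.
    by rewrite divr_ge0 ?mulr_ge0 ?(ltW HM)// ltW// chi_gt0.
  have num : `|v t ^+ 2 - 2 * M / chi t| <= 1.
    rewrite ler_norml; have := sqr_ge0 (v t).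
    by move=> ?; apply/andP; split; lra.
  rewrite -[leRHS]mul1r; apply: ler_pM => //; first by rewrite invr_ge0 ltW.
  rewrite lef_pV2 ?posrE// lapse2// cutE// lerD2l lerN2 ler_pM2l ?mulr_gt0//.
  by rewrite lef_pV2 ?posrE ?chi_gt0 ?(rs_gt0 HM Hrs)// ge.
- apply: (bmeas_oo (K := 2 * M / (rs - 2 * M)) ab kP_cont) => t tab.
  have r0 : 0 < rs - 2 * M by move: Hrs; lra.
  rewrite kPE// /hP ger0_norm; last by rewrite divr_ge0 ?mulr_ge0 ?(ltW HM)// ltW// den2.
  by rewrite ler_pM2l ?mulr_gt0// lef_pV2 ?posrE ?den2// lerD2r ge.
- apply: (bmeas_oo (K := 0) ab kB_cont) => t tab.
  by rewrite kBE// normr0.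
Qed.

Lemma d_ychi t : a < t < b ->
  is_derive t 1 (fun t => Y (chi t)) (v t / lapse M rs (chi t)).
Proof.
move=> tab; apply: is_derive_eq (dcomp (d_chi tab) (d_ycoord HM Hrs (chi t))) _.
by rewrite /stretch; field; rewrite gt_eqF// lapse_gt0.
Qed.

(** Inside an arc the wall terms vanish, and K + P becomes the convex Lagrangian of
    the coordinate [ycoord]. *)
Lemma arc_cost : exists2 Phi, pcost a b chi = Phi b - Phi a &
  [/\ {within `[a, b], continuous (fun t => Y (chi t))},
      {within `[a, b], continuous Phi} &
      forall t, a < t < b -> is_derive t 1 Phi
        ((v t / lapse M rs (chi t)) ^+ 2 / 2 + pot p (Y (chi t)))].
Proof.
have [tK tP tB] := arc_tame.
have [cK dK] := indefinite ab tK kK_cont.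
have [cP dP] := indefinite ab tP kP_cont.
have [cB dB] := indefinite ab tB kB_cont.
set PK := (fun x => \int[mu]_(t in `[a, x]) kK chi t) in cK dK.
set PP := (fun x => \int[mu]_(t in `[a, x]) kP chi t) in cP dP.
set PB := (fun x => \int[mu]_(t in `[a, x]) kB chi t) in cB dB.
have zB : PB b = PB a.
  apply: (zero_derive_const (ltW ab) cB) => x xab.
  by apply: is_derive_eq (dB x xab) _; rewrite kBE.
have z0 (f : R -> R) : \int[mu]_(t in `[a, a]) f t = 0.
  by rewrite set_itv1 Rintegral_set1.
exists (fun x => 2^-1 * PK x + PP x).
  rewrite /pcost /Kact /Pact /Bact -/(PK b) -/(PP b) -/(PB b) zB.
  by rewrite /PK /PP /PB !z0; ring.
split.
- move=> x; apply: (@continuous_comp (subspace `[a, b]) _ _ chi Y); first exact: cchi.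
  exact: ycoord_cont.
- move=> x; apply: cvgD; last exact: cP.
  by apply: cvgM; [exact: cvg_cst|exact: cK].
- move=> t tab; apply: is_derive_eq (dD (dZ 2^-1 (dK t tab)) (dP t tab)) _.
  rewrite kKE// kPE// pot_ycoord ?ge// exprMn exprVn lapse2// cutE ?ge// /hK /hP.
  have c0 := chi_gt0 tab; have d0 := den2 tab.
  field; rewrite !gt_eqF//.
Qed.

Lemma arc_curve_cost : exists2 Phi, pcost a b chi = Phi b - Phi a &
  curve_cost p (fun t => Y (chi t)) Phi a b.
Proof.
have [Phi e [c1 c2 d]] := arc_cost; exists Phi => //; split => //.
by do 2 eexists; move=> t tab; split; [exact: d_ychi|exact: d|exact: lexx].
Qed.

End one_arc.

End arcs.

(** * Decomposition and construction of paths *)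

Section lipschitz.
Context {R : realType}.
Implicit Types (chi : R -> R) (a b K : R).

Lemma lipschitzP chi a b : [lipschitz chi t | t in `[a, b]] <->
  exists K, forall x y, a <= x -> x <= y -> y <= b -> `|chi y - chi x| <= K * (y - x).
Proof.
split.
  move=> /pinfty_ex_gt0[K K0 h]; exists K => x y ax xy yb.
  have := h (y, x); rewrite /= !in_itv/= [`|y - x|]ger0_norm ?subr_ge0//; apply.
  by rewrite yb (le_trans ax xy) ax (le_trans xy yb).
move=> [K h]; exists K; split; first exact: num_real.
move=> L /ltW KL [x y] /=.
rewrite !in_itv/= => -[/andP[ax xb] /andP[ay yb]].
have [yx|/ltW xy] := leP y x.
  apply: le_trans (h _ _ ay yx xb) _.
  by rewrite ger0_norm ?subr_ge0// ler_wpM2r// subr_ge0.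
rewrite distrC [`|x - y|]distrC; apply: le_trans (h _ _ ax xy yb) _.
by rewrite ger0_norm ?subr_ge0// ler_wpM2r// subr_ge0.
Qed.

Lemma lipschitz_within chi a b : [lipschitz chi t | t in `[a, b]] ->
  {within `[a, b], continuous chi}.
Proof.
move=> /lipschitzP[K h]; apply/subspace_continuousP => x /=; rewrite in_itv/= => /andP[ax xb].
apply/cvgrPdist_lt => e e0.
have K0 : 0 < `|K| + 1 by rewrite ltr_wpDl.
have H : \forall y \near x, `|x - y| < e / (`|K| + 1).
  by apply: (@cvgr_dist_lt _ _ _ (nbhs x) _ id x); [exact: cvg_id|rewrite divr_gt0].
rewrite near_withinE; near=> y => /=; rewrite in_itv/= => /andP[ay yb].
have d : `|x - y| < e / (`|K| + 1) by near: y.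
have m u w : a <= u -> u <= w -> w <= b -> `|chi w - chi u| <= `|K| * `|w - u|.
  move=> au uw wb; apply: le_trans (h _ _ au uw wb) _.
  by rewrite [`|w - u|]ger0_norm ?subr_ge0// ler_wpM2r ?subr_ge0// ler_norm.
have hh : `|chi x - chi y| <= `|K| * `|x - y|.
  have [yx|/ltW xy] := leP y x; first exact: m.
  by rewrite distrC [`|x - y|]distrC; exact: m.
apply: le_lt_trans hh _; move: d; rewrite ltr_pdivlMr// => d.
apply: le_lt_trans d; rewrite mulrC; apply: ler_wpM2l => //; lra.
Unshelve. all: by end_near. Qed.

End lipschitz.

Section paths.
Context {R : realType} (M rs : R) (ph : R -> R).
Hypothesis HM : 0 < M.
Hypothesis Hrs : 2 * M < rs.
Hypothesis mph : measurable_fun [set: R] ph.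
Hypothesis ph1 : forall t, -1 < ph t < 1.
Local Notation p := (schw HM Hrs).
Local Notation Y := (ycoord M rs).
Local Notation rc := (rcoord HM Hrs).
Local Notation beta := (beta M rs ph).
Local Notation pcost := (pcost M rs ph).
Local Notation tame := (tame M rs ph).
Implicit Types (chi : R -> R) (a b c d t : R).

(** Splitting the action at the ends of the parts, where the integrands may take
    junk values, once for all. *)
Lemma path_induction (Psi : R -> R) t0 t1 chi : is_path M rs t0 t1 chi ->
  (forall a b, t0 <= a -> a <= b -> b <= t1 -> (forall t, a <= t <= b -> chi t = rs) ->
     Psi b <= Psi a + (beta a - beta b)) ->
  (forall a b Phi, t0 <= a -> a < b -> b <= t1 ->
     a = t0 \/ chi a = rs -> b = t1 \/ chi b = rs ->
     curve_cost p (fun t => Y (chi t)) Phi a b -> Psi b <= Psi a + (Phi b - Phi a)) ->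
  Psi t1 <= Psi t0 + pcost t0 t1 chi.
Proof.
move=> [/lipschitz_within cchi cge [n [s [k [s0 sn smono parts]]]]] Hst Harc.
have mono i j : (i <= j <= n)%N -> s i <= s j.
  elim: j => [|j IH]; first by rewrite leqn0 => /andP[/eqP->].
  rewrite leq_eqVlt => /andP[/predU1P[->//|ij] jn].
  by apply: le_trans (smono j jn); apply: IH; rewrite -ltnS ij ltnW.
suff H i : (i <= n)%N -> tame chi t0 (s i) /\ Psi (s i) <= Psi t0 + pcost t0 (s i) chi.
  by have [_] := H n (leqnn n); rewrite sn.
elim: i => [|i IH] ni.
  by rewrite s0; split; [exact: tame_refl|rewrite pcost_refl addr0].
have [ti hi] := IH (ltnW ni).
have t0i : t0 <= s i by rewrite -s0; apply: mono; rewrite leq0n ltnW.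
have sii : s i <= s i.+1 by exact: smono.
have i1 : s i.+1 <= t1 by rewrite -sn; apply: mono; rewrite ni leqnn.
have [tm hp] : tame chi (s i) (s i.+1) /\
    Psi (s i.+1) <= Psi (s i) + pcost (s i) (s i.+1) chi.
  have := parts i ni; case: ifP => _; last first.
    move=> st; have [h1 h2] := stay_cost HM Hrs mph ph1 sii st.
    by split => //; rewrite h2; exact: Hst.
  move=> [ch e1 e2]; have [e|ne] := eqVneq (s i) (s i.+1).
    by rewrite -e; split; [exact: tame_refl|rewrite pcost_refl addr0].
  have lt : s i < s i.+1 by rewrite lt_neqAle ne.
  have cc : {within `[s i, s i.+1], continuous chi} by exact: withinS cchi.
  have cg t : s i <= t <= s i.+1 -> rs <= chi t.
    by move=> /andP[h1 h2]; apply: cge; rewrite (le_trans t0i h1) (le_trans h2).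
  split; first exact: (arc_tame ph HM Hrs lt cc cg ch).
  have [Phi E cv] := arc_curve_cost ph HM Hrs lt cc cg ch.
  by rewrite E; exact: Harc.
have tt := tame_cat t0i sii ti tm; split => //.
rewrite (pcost_split t0i sii tt); lra.
Qed.

(** A solution that left the wall at time tau, seen from time a to time b; energy
    below 1/2 makes it a characteristic. *)
Definition arc_of chi a b v tau := [/\ a < b, tau <= a, en p v < 2^-1,
  0 <= sol p v (b - tau) & forall t, a <= t <= b -> chi t = rc (sol p v (t - tau))].

Section one_arc_of.
Variables (chi : R -> R) (a b v tau : R).
Hypothesis H : arc_of chi a b v tau.
Local Notation y t := (sol p v (t - tau)).
Local Notation w t := (vel p v (t - tau)).

Let chiE t : a <= t <= b -> chi t = rc (y t).
Proof. by case: H => _ _ _ _; exact. Qed.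

Let y_ge0 t : a <= t <= b -> 0 <= y t.
Proof.
case: H => ab ta _ yb _ /andP[at_ tb].
by apply: (sol_ge0 _ _ yb); rewrite ?subr_ge0 ?lerD2r// (le_trans ta).
Qed.

Lemma arc_of_ge t : a <= t <= b -> rs <= chi t.
Proof. by move=> tab; rewrite chiE// rcoord_ge// y_ge0. Qed.

Let Ychi t : a <= t <= b -> Y (chi t) = y t.
Proof. by move=> tab; rewrite chiE// rcoordK. Qed.

Let tau0 t : a <= t -> 0 <= t - tau.
Proof. by case: H => _ ta _ _ _ at_; rewrite subr_ge0 (le_trans ta). Qed.

Let w2 t : a <= t <= b -> w t ^+ 2 < (lapse M rs (chi t) ^+ 2)^-1.
Proof.
move=> tab; have /andP[at_ _] := tab; rewrite vel2 ?tau0// -exprVn.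
rewrite -(cspeed_ycoord HM Hrs (arc_of_ge tab)) cspeed2 Ychi//.
by case: H => _ _ e _ _; rewrite ltrD2r; lra.
Qed.

Let d_chi' t : a < t < b -> is_derive t 1 chi (lapse M rs (chi t) ^+ 3 * w t).
Proof.
move=> tab; have [h1 h2] := andP tab.
have tab' : a <= t <= b by rewrite !ltW.
apply: (is_derive_ext_oo tab (f := fun t => rc (y t))).
  by move=> x /andP[ax xb]; rewrite chiE// !ltW.
apply: is_derive_eq (dcomp (dshift (d_sol p v (t - tau))) (d_rcoord HM Hrs _)) _.
by rewrite -chiE// /stretch invrK.
Qed.

Let velE t : a < t < b -> velocity M chi t = lapse M rs (chi t) * w t.
Proof.
move=> tab; have [h1 h2] := andP tab; have tab' : a <= t <= b by rewrite !ltW.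
have [_ e] := d_chi' tab.
rewrite /velocity derive1E e (uE_lapse HM Hrs (arc_of_ge tab')).
by field; rewrite gt_eqF// lapse_gt0.
Qed.

Lemma arc_of_char : characteristic M chi a b.
Proof.
move=> t tab; have [h1 h2] := andP tab; have tab' : a <= t <= b by rewrite !ltW.
have hge := arc_of_ge tab'.
have l0 := lapse_gt0 HM Hrs (chi t).
have [dc _] := d_chi' tab; split; first exact: dc.
  rewrite -ltr_norml velE// -(expr_lt1 (n := 2))// real_normK ?num_real//.
  by rewrite exprMn -ltr_pdivlMl ?exprn_gt0// mulr1 w2.
apply: (is_derive_ext_oo tab (f := fun x => lapse' M (chi x) * w x)).
  move=> x xab; rewrite velE//; move/andP: xab => [/ltW ? /ltW ?].
  by rewrite (lapse'E _ (arc_of_ge _))// ; apply/andP.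
have d1 := dcomp (d_chi' tab) (d_lapse' HM Hrs hge).
have d2 := dshift (d_vel p v (tau0 (ltW h1))).
apply: is_derive_eq (dM d1 d2) _.
rewrite velE// -Ychi// /= /sforce ycoordK (lapse'E _ hge) /pull cutE//.
have c0 : chi t != 0 by rewrite gt_eqF// (lt_le_trans (rs_gt0 HM Hrs)).
by field; rewrite c0 gt_eqF.
Qed.

Lemma arc_of_lip x z : a <= x -> x <= z -> z <= b ->
  `|chi z - chi x| <= cspeed p 0 * (z - x).
Proof.
move=> ax xz zb.
have xab : a <= x <= b by rewrite ax (le_trans xz).
have zab : a <= z <= b by rewrite zb (le_trans ax).
have c0 := cspeed_gt0 p 0.
have wle q : a <= q <= b -> `|w q| <= cspeed p 0.
  move=> qab; rewrite -ler_sqr ?nnegrE ?(ltW c0)// real_normK ?num_real//.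
  have /andP[aq _] := qab; rewrite vel2 ?tau0// cspeed2.
  have := pot_le p (y_ge0 qab); case: H => _ _ e _ _; lra.
have hab q : x <= q <= z -> a <= q <= b.
  by move=> /andP[xq qz]; rewrite (le_trans ax xq) (le_trans qz zb).
have dy q : x <= q <= z -> is_derive q 1 (fun t => y t) (w q).
  by move=> _; apply: dshift; exact: d_sol.
have u1 := dcmp_le xz dy (fun q _ => dlin (cspeed p 0) q).
have u2 := dcmp_le xz (fun q _ => dlin (- cspeed p 0) q) dy.
have yb : `|y z - y x| <= cspeed p 0 * (z - x).
  rewrite ler_norml; apply/andP; split.
    have : - cspeed p 0 * z - - cspeed p 0 * x <= y z - y x.
      apply: u2 => q /hab/wle; rewrite ler_norml => /andP[]//.
    lra.
  have : y z - y x <= cspeed p 0 * z - cspeed p 0 * x.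
    apply: u1 => q /hab/wle; rewrite ler_norml => /andP[]//.
  lra.
apply: le_trans yb; rewrite !chiE//.
have [yy|/ltW yy] := leP (y x) (y z).
  have := rcoord_contract HM Hrs yy; have := rcoord_le HM Hrs yy.
  by rewrite -subr_ge0 => h; rewrite !ger0_norm// subr_ge0.
have := rcoord_contract HM Hrs yy; have := rcoord_le HM Hrs yy.
by rewrite -subr_ge0 => h; rewrite distrC [`|y z - _|]distrC !ger0_norm// subr_ge0.
Qed.

Lemma arc_of_cost : tame chi a b /\
  pcost a b chi = act p v (b - tau) - act p v (a - tau).
Proof.
have ab : a < b by case: H.
have cg := arc_of_ge; have ch := arc_of_char.
have cc : {within `[a, b], continuous chi}.
  by apply: lipschitz_within; apply/lipschitzP; exists (cspeed p 0); exact: arc_of_lip.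
split; first exact: (arc_tame ph HM Hrs ab cc cg ch).
have [Phi -> [_ cP dP]] := arc_cost ph HM Hrs ab cc cg ch.
have ca : {within `[a, b], continuous (fun t => act p v (t - tau))}.
  apply: within_cont => x /andP[ax _].
  by apply: is_derive_cont (dshift (d_act p v (tau0 ax))).
have dD0 t : a < t < b -> is_derive t 1 (fun t => Phi t - act p v (t - tau)) 0.
  move=> tab; have [h1 h2] := andP tab; have tab' : a <= t <= b by rewrite !ltW.
  apply: is_derive_eq (dB (dP t tab) (dshift (d_act p v (tau0 (ltW h1))))) _.
  rewrite Ychi// velE//; field; by rewrite gt_eqF// lapse_gt0.
have cD : {within `[a, b], continuous (fun t => Phi t - act p v (t - tau))}.
  by move=> x; apply: cvgB; [exact: cP|exact: ca].
have := zero_derive_const (ltW ab) cD dD0.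
move: (Phi a) (Phi b) (act _ _ _) (act _ _ _) => *; lra.
Qed.

End one_arc_of.

(** A part of a path together with its action: characteristic or stay. *)
Definition seg chi a b (k : bool) c : Prop := a <= b /\
  if k then exists v tau, arc_of chi a b v tau /\
                          c = act p v (b - tau) - act p v (a - tau)
  else (forall t, a <= t <= b -> chi t = rs) /\ c = beta a - beta b.

Lemma seg_ge chi a b k c t : seg chi a b k c -> a <= t <= b -> rs <= chi t.
Proof.
case: k => -[ab]; last by move=> [h _] tab; rewrite h.
by move=> [v [tau [h _]]]; exact: (arc_of_ge h).
Qed.

Lemma seg_lip chi a b k c : seg chi a b k c -> forall x z, a <= x -> x <= z -> z <= b ->
  `|chi z - chi x| <= cspeed p 0 * (z - x).
Proof.
case: k => -[ab]; first by move=> [v [tau [h _]]]; exact: (arc_of_lip h).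
move=> [h _] x z ax xz zb; rewrite !h ?subrr ?normr0 ?ax ?zb ?(le_trans ax xz) ?(le_trans xz zb)//.
by rewrite mulr_ge0 ?subr_ge0// ltW// cspeed_gt0.
Qed.

Lemma seg_cost chi a b k c : seg chi a b k c -> tame chi a b /\ pcost a b chi = c.
Proof.
case: k => -[ab].
  by move=> [v [tau [h ->]]]; exact: (arc_of_cost h).
by move=> [h ->]; exact: stay_cost.
Qed.

Lemma seg_ext chi chi' a b k c : (forall t, a <= t <= b -> chi t = chi' t) ->
  seg chi a b k c -> seg chi' a b k c.
Proof.
move=> e; case: k => -[ab].
  move=> [v [tau [[h1 h2 h3 h4 h5] E]]]; split => //; exists v, tau; split => //.
  by split => // t tab; rewrite -e// h5.
by move=> [h E]; split => //; split => // t tab; rewrite -e// h.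
Qed.

(** Finite concatenations of parts, which are easier to build than [is_path], whose
    parts must alternate; [desc_parts] inserts the missing trivial parts. *)
Inductive desc chi : R -> R -> R -> Prop :=
| desc1 a b k c : seg chi a b k c -> desc chi a b c
| descS a b d k c c' : seg chi a b k c -> chi b = rs -> desc chi b d c' ->
    desc chi a d (c + c').

Lemma desc_le chi a b c : desc chi a b c -> a <= b.
Proof. by elim=> [{}a {}b k {}c []//|{}a {}b d k {}c c' [ab _] _ _]; exact: le_trans. Qed.

Lemma desc_ge chi a b c : desc chi a b c -> forall t, a <= t <= b -> rs <= chi t.
Proof.
elim=> [{}a {}b k {}c h|{}a {}b d k {}c c' h _ _ IH] t; first exact: seg_ge h.
move=> /andP[at_ td]; have [tb|/ltW bt] := leP t b; last by apply: IH; rewrite bt.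
by apply: (seg_ge h); rewrite at_.
Qed.

Lemma desc_lip chi a b c : desc chi a b c -> forall x z, a <= x -> x <= z -> z <= b ->
  `|chi z - chi x| <= cspeed p 0 * (z - x).
Proof.
elim=> [{}a {}b k {}c h|{}a {}b d k {}c c' h _ _ IH] x z ax xz; first exact: (seg_lip h).
move=> zd; have [zb|/ltW bz] := leP z b; first exact: (seg_lip h).
have [bx|/ltW xb] := leP b x; first exact: IH.
have h1 := seg_lip h ax xb (lexx b); have h2 := IH _ _ (lexx b) bz zd.
apply: le_trans (ler_distD (chi b) _ _) _.
by apply: le_trans (lerD h2 h1) _; rewrite -mulrDr addrA subrK.
Qed.

Lemma desc_cost chi a b c : desc chi a b c -> tame chi a b /\ pcost a b chi = c.
Proof.
elim=> [{}a {}b k {}c /seg_cost//|{}a {}b d k {}c c' h _ h2 [t2 e2]].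
have [t1 e1] := seg_cost h; have ab : a <= b by case: h.
have bd := desc_le h2; have tt := tame_cat ab bd t1 t2; split => //.
by rewrite (pcost_split ab bd tt) e1 e2.
Qed.

Lemma desc_ext chi chi' a b c : desc chi a b c ->
  (forall t, a <= t <= b -> chi t = chi' t) -> desc chi' a b c.
Proof.
elim=> [{}a {}b k {}c h e|{}a {}b d k {}c c' h hb h2 IH e].
  exact: desc1 (seg_ext e h).
have ab : a <= b by case: h.
have bd := desc_le h2.
apply: (@descS _ _ b _ k).
- by apply: seg_ext h => t /andP[at_ tb]; rewrite e// at_ (le_trans tb).
- by rewrite -e// ab bd.
- by apply: IH => t /andP[bt td]; rewrite e// td (le_trans ab).
Qed.

Lemma desc_cat chi a b d c c' : desc chi a b c -> chi b = rs -> desc chi b d c' ->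
  desc chi a d (c + c').
Proof.
move=> h; elim: h c' d => [{}a {}b k {}c h|{}a {}b b' k {}c c'' h hb h2 IH] c' d hb' h'.
  exact: descS h hb' h'.
by rewrite -addrA; apply: (descS h hb); exact: IH.
Qed.

Definition glue b chi1 chi2 t : R := if t <= b then chi1 t else chi2 t.

Lemma desc_glue chi1 chi2 a b d c c' : desc chi1 a b c -> desc chi2 b d c' ->
  chi1 b = rs -> chi2 b = rs -> desc (glue b chi1 chi2) a d (c + c').
Proof.
move=> h1 h2 e1 e2; apply: (@desc_cat _ _ b).
- by apply: desc_ext h1 _ => t /andP[_ tb]; rewrite /glue tb.
- by rewrite /glue lexx.
- apply: desc_ext h2 _ => t /andP[bt _]; rewrite /glue; case: ifP => // tb.
  by have -> : t = b by [apply/eqP; rewrite eq_le tb bt]; rewrite e1 e2.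
Qed.

Definition parts chi t0 t1 (k : bool) (n : nat) (s : nat -> R) :=
  [/\ s 0%N = t0, s n = t1, (forall i, (i < n)%N -> s i <= s i.+1)
    & forall i, (i < n)%N ->
      if k (+) odd i then
        [/\ characteristic M chi (s i) (s i.+1), s i = t0 \/ chi (s i) = rs
          & s i.+1 = t1 \/ chi (s i.+1) = rs]
      else forall t, s i <= t <= s i.+1 -> chi t = rs].

Lemma parts_cons chi a b d k n s : a <= b -> chi b = rs ->
  (if k then characteristic M chi a b else forall t, a <= t <= b -> chi t = rs) ->
  parts chi b d (~~ k) n s ->
  parts chi a d k n.+1 (fun i => if i is j.+1 then s j else a).
Proof.
move=> ab hb hk [s0 sn sm sp]; split => //=.
- by case=> [|i] ni; [rewrite s0|exact: sm].
- case=> [|i] ni /=.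
    by rewrite addbF s0; case: k hk {sp} => // ch; split; [|left|right].
  have := sp i ni; rewrite addNb addbN; case: ifP => // _ [ch e1 e2]; split => //.
  by right; case: e1 => // ->.
Qed.

Lemma desc_parts chi a b c : desc chi a b c -> exists k n s, parts chi a b k n s.
Proof.
elim=> [{}a {}b k {}c [ab h]|{}a {}b d k {}c c' [ab h] hb h2 [k' [n [s ps]]]].
  exists k, 1%N, (fun i => if i is 0%N then a else b); split => //=; case=> // _.
  rewrite addbF; case: k h => [[v [tau [h _]]]|[]//]; split; [|by left|by left].
  exact: (arc_of_char h).
have hk : if k then characteristic M chi a b else forall t, a <= t <= b -> chi t = rs.
  by case: k h => [[v [tau [h _]]]|[]//]; exact: (arc_of_char h).
have [e|ne] := eqVneq k' (~~ k).
  by subst k'; exists k, n.+1; eexists; exact: parts_cons ab hb hk ps.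
have {}ne : k' = k by case: k k' ne {h hk ps} => [] [].
subst k'.
have hd : if ~~ k then characteristic M chi b b else forall t, b <= t <= b -> chi t = rs.
  case: (~~ k) => t; first by move=> /andP[h1 h2']; move: (lt_trans h1 h2'); rewrite ltxx.
  by move=> /andP[h1 h2']; have -> : t = b by [apply/eqP; rewrite eq_le h1 h2'].
have ps' : parts chi b d (~~ ~~ k) n s by rewrite negbK.
have := parts_cons (lexx b) hb hd ps' => ps2.
by exists k, n.+2; eexists; exact: parts_cons ab hb hk ps2.
Qed.

Lemma desc_path chi a b c : desc chi a b c ->
  is_path M rs a b chi /\ pcost a b chi = c.
Proof.
move=> h; have [_ e] := desc_cost h; split => //; split.
- by apply/lipschitzP; exists (cspeed p 0); exact: desc_lip h.
- exact: desc_ge h.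
- have [k [n [s [h1 h2 h3 h4]]]] := desc_parts h.
  by exists n, s, k; split.
Qed.

Lemma desc_stay a b : a <= b -> desc (fun=> rs) a b (beta a - beta b).
Proof. by move=> ab; apply: (@desc1 _ _ _ false); split. Qed.

Lemma desc_arc a b v tau : a < b -> tau <= a -> en p v < 2^-1 ->
  0 <= sol p v (b - tau) ->
  desc (fun t => rc (sol p v (t - tau))) a b (act p v (b - tau) - act p v (a - tau)).
Proof.
move=> ab ta e yb; apply: (@desc1 _ _ _ true); split; first exact: ltW.
by exists v, tau.
Qed.

(** A loop is realized by its solution of Newton's equation, which has energy below
    1/2 because light needs no time from the wall to the wall. *)
Lemma chain_path a b l : cvalid a b l -> exists chi,
  [/\ chi a = rs, chi b = rs & desc chi a b (ccost p beta a b l)].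
Proof.
elim: l a => [|[u v] l IH] a /=.
  by move=> ab; exists (fun=> rs); split => //; exact: desc_stay.
move=> /and3P[au uv vl]; have [chi2 [h1 h2 h3]] := IH v vl.
have st := desc_stay au.
have vb := cvalid_le vl.
have [e|ne] := eqVneq u v.
  subst v; rewrite subrr G0 addr0; exists (glue u (fun=> rs) chi2); split.
  - by rewrite /glue; case: ifP => //; rewrite au.
  - by rewrite /glue; case: ifP.
  - exact: desc_glue.
have lt : u < v by rewrite lt_neqAle ne.
have lt0 : 0 < v - u by rewrite subr_gt0.
have e1 : en p (shoot p (v - u) 0) < 2^-1.
  by apply: (een_lt lt0 (lexx 0)); rewrite light0.
have yb : 0 <= sol p (shoot p (v - u) 0) (v - u) by rewrite shootE.
have lp := desc_arc lt (lexx u) e1 yb.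
rewrite subrr act0 subr0 in lp.
have z1 : rc (sol p (shoot p (v - u) 0) (u - u)) = rs by rewrite subrr sol0 rcoord0.
have z2 : rc (sol p (shoot p (v - u) 0) (v - u)) = rs by rewrite shootE// rcoord0.
have g1 := desc_glue lp h3 z2 h1.
have g1u : glue v (fun t => rc (sol p (shoot p (v - u) 0) (t - u))) chi2 u = rs.
  by rewrite /glue uv.
have g2 := desc_glue st g1 erefl g1u.
eexists; split; last first.
- rewrite -addrA; exact: g2.
- rewrite /glue; case: ifP => // _; case: ifP => // bv.
  by have -> : b = v by [apply/eqP; rewrite eq_le bv vb].
- by rewrite /glue au.
Qed.

End paths.

(** * Lebesgue points and null sets *)

Section lebesgue.
Context {R : realType}.
Local Notation mu := (@lebesgue_measure R).
Implicit Types (f g D y m : R -> R) (a b x t : R).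

Lemma bounded_locint f K : measurable_fun [set: R] f -> (forall t, `|f t| <= K) -> locint f.
Proof.
move=> mf h a b; apply: bmeas_integrable; split; first exact: measurable_funTS.
by exists K.
Qed.

Lemma prim_ae f K : measurable_fun [set: R] f -> (forall t, `|f t| <= K) ->
  {ae mu, forall x, is_derive x 1 (prim f) (f x)}.
Proof.
move=> mf hK; have fi := bounded_locint mf hK.
have li : locally_integrable [set: R] f.
  split => //; first exact: openT.
  move=> A _ cA; have [N [_ /(_ (N + 1))]] := compact_bounded cA.
  rewrite ltrDl ltr01 => /(_ isT) hA.
  have sub : A `<=` `[- (N + 1), N + 1].
    by move=> x /hA /=; rewrite in_itv/= -ler_norml.
  have /integrableP[_] := fi (- (N + 1)) (N + 1); apply: le_lt_trans.
  apply: ge0_subset_integral => //; first exact: compact_measurable.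
  apply/measurable_EFinP; apply: measurableT_comp => //; exact: measurable_funTS.
have := lebesgue_differentiation li.
apply: filterS; first exact: (ae_filter_ringOfSetsType mu).
move=> x lx.
have h : x - 1 < x by lra.
have h2 : x < x + 1 by lra.
have [d e] := @FTC1_lebesgue_pt R f (BLeft (x - 1)) x (x + 1) h2 (fi (x - 1) (x + 1)) h lx.
rewrite derive1E in e; have dd := DeriveDef d e.
apply: is_derive_near (prim_near fi h) _.
exact: is_derive_eq (dD (dC x _) dd) (add0r _).
Qed.

(** The part of B that is mapped into an interval is contained in an interval of
    twice that length. *)
Lemma expanding_null f (A B : set R) : measurable B ->
  (forall x z, B x -> B z -> `|x - z| <= `|f x - f z|) ->
  (forall x, B x -> A (f x)) -> mu A = 0%E -> mu B = 0%E.
Proof.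
move=> mB hf BA A0; apply/eqP; rewrite -measure_le0.
apply/lee_addgt0Pr => e e0; rewrite add0e.
have e20 : (0 < e / 2) by rewrite divr_gt0.
have : (mu A < (e / 2)%:E)%E by rewrite A0 lte_fin.
move=> /ereal_inf_lt[_ [F [mF AF] <-]] hF.
pose c k := xget 0 [set x | B x /\ F k (f x)].
pose J k : set R := `[c k - fine (wlength idfun (F k)),
  c k + fine (wlength idfun (F k))]%classic.
have mJ k : measurable (J k) by exact: measurable_itv.
have muJ k : (mu (J k) <= wlength idfun (F k) + wlength idfun (F k))%E.
  rewrite /J; move: (c k) => c0; have [[a b] _ <-] := mF k.
  rewrite wlength_itv /= !lte_fin; case: ifPn => ab /=; last first.
    by rewrite addr0 subr0 set_itv1 lebesgue_measure_set1 adde0.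
  rewrite lebesgue_measure_itv/= lte_fin; case: ifP => _.
    by rewrite -!EFinD lee_fin; lra.
  by rewrite -!EFinD lee_fin; lra.
have BJ : B `<=` \bigcup_k J k.
  move=> x Bx; have [k _ Fk] := AF _ (BA _ Bx); exists k => //.
  have [Bc Fc] : [set x | B x /\ F k (f x)] (c k) by apply: xgetPex; exists x.
  have := hf _ _ Bx Bc; rewrite /J; move: (c k) Bc Fc Fk => c0 Bc.
  have [[a b] _ <-] := mF k => /=.
  rewrite !in_itv/= => /andP[h3 h4] /andP[h1 h2].
  rewrite wlength_itv /= lte_fin (lt_le_trans h1 h2) /= => hd.
  suff : `|x - c0| <= b - a by rewrite ler_norml => /andP[? ?]; apply/andP; split; lra.
  apply: le_trans hd _; rewrite ler_norml; apply/andP; split; lra.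
have sub := @measure_sigma_subadditive _ _ _ mu B J mJ mB BJ.
apply: le_trans sub _.
apply: (@le_trans _ _ (\sum_(k <oo) (wlength idfun (F k) + wlength idfun (F k)))%E).
  by apply: lee_nneseries => [k _ _|k _]; [exact: measure_ge0|exact: muJ].
rewrite nneseriesD => [|k _ _|k _ _]; try exact: wlength_ge0.
apply: le_trans (leeD (ltW hF) (ltW hF)) _.
by rewrite -EFinD lee_fin; lra.
Qed.

(** In a partition of mesh h the increments of D add up to at most L h times one
    telescoping sum. *)
Lemma partition_const D m L a b : a <= b -> 0 <= L ->
  (forall x z, a <= x -> x <= z -> z <= b ->
     `|D z - D x| <= L * (z - x) * (m x - m z)) -> D a = D b.
Proof.
move=> ab L0 h; have [<-//|ne] := eqVneq a b.
have lt : a < b by rewrite lt_neqAle ne.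
have step n k : (k <= n.+1)%N -> `|D (a + k%:R * ((b - a) / n.+1%:R)) - D a| <=
    L * ((b - a) / n.+1%:R) * (m a - m (a + k%:R * ((b - a) / n.+1%:R))).
  set d := (b - a) / n.+1%:R.
  have d0 : 0 < d by rewrite divr_gt0// subr_gt0.
  have dn : n.+1%:R * d = b - a by rewrite /d mulrC divfK.
  elim: k => [_|k IH kn]; first by rewrite mul0r addr0 !subrr normr0 mulr0.
  have k1 : (k.+1%:R * d = k%:R * d + d) by rewrite -natr1 mulrDl mul1r.
  have kb : k.+1%:R * d <= b - a by rewrite -dn ler_wpM2r ?(ltW d0)// ler_nat.
  have kd : 0 <= k%:R * d by rewrite mulr_ge0// ltW.
  have h1 : a <= a + k%:R * d by rewrite lerDl.
  have h2 : a + k%:R * d <= a + k.+1%:R * d by rewrite k1; lra.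
  have h3 : a + k.+1%:R * d <= b by lra.
  have := h _ _ h1 h2 h3; have := IH (ltnW kn).
  have -> : a + k.+1%:R * d - (a + k%:R * d) = d by rewrite k1; ring.
  have := ler_distD (D (a + k%:R * d)) (D (a + k.+1%:R * d)) (D a).
  move: (D _) (D _) (D a) (m _) (m _) (m a) => *; lra.
apply/eqP; rewrite eq_sym -subr_eq0 -normr_le0; apply/ler_addgt0Pr => e e0; rewrite add0r.
have C0 : 0 <= L * (b - a) * (m a - m b).
  by apply: le_trans (h a b (lexx a) ab (lexx b)); exact: normr_ge0.
pose n := Num.truncn (L * (b - a) * (m a - m b) / e).
have hn : L * (b - a) * (m a - m b) / e < n.+1%:R by exact: truncnS_gt.
have := step n n.+1 (leqnn _).
have -> : n.+1%:R * ((b - a) / n.+1%:R) = b - a by rewrite mulrC divfK.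
rewrite (addrC a) subrK => hh; apply: le_trans hh _.
have -> : L * ((b - a) / n.+1%:R) * (m a - m b) = L * (b - a) * (m a - m b) / n.+1%:R.
  by rewrite mulrA mulrAC.
rewrite ler_pdivrMr//; move: hn; rewrite ltr_pdivrMr// => /ltW.
by rewrite (mulrC e).
Qed.

End lebesgue.

(** * The profile and its evolution *)

Section evolution.
Context {R : realType} (M rs : R) (ph : R -> R).
Hypothesis HM : 0 < M.
Hypothesis Hrs : 2 * M < rs.
Hypothesis mph : measurable_fun [set: R] ph.
Hypothesis ph1 : forall t, -1 < ph t < 1.
Local Notation mu := (@lebesgue_measure R).
Local Notation p := (schw HM Hrs).
Local Notation Y := (ycoord M rs).
Local Notation rc := (rcoord HM Hrs).
Local Notation beta := (beta M rs ph).
Local Notation betap := (betap M rs ph).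
Local Notation pcost := (pcost M rs ph).
Local Notation Z := (wallZ p beta).
Local Notation U := (wallU p Z).
Local Notation S := (wallS p beta).
Implicit Types (chi : R -> R) (a b c d t e r x y z : R).

Let bdom s t : s <= t -> beta t - beta s <= betap t - betap s.
Proof. exact: (betap_dom HM Hrs mph ph1). Qed.
Let bge s t : s <= t -> betap s <= betap t.
Proof. exact: (betap_ge HM Hrs mph ph1). Qed.
Let bbe s t : s <= t -> - pot p 0 * (t - s) <= beta t - beta s.
Proof. exact: (beta_ge HM Hrs mph ph1). Qed.
Let bhalf s t : s <= t -> betap t - betap s <= (t - s) / 2.
Proof. exact: (betap_half HM Hrs mph ph1). Qed.
Let Zup s t : s <= t -> Z t <= Z s + pot p 0 * (t - s).
Proof. exact: (wallZ_up bdom bge bbe). Qed.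
Let Zback s t : s <= t -> Z s <= Z t + (betap t - betap s).
Proof. exact: (wallZ_back p bdom bge). Qed.
Let Zloop s t : s <= t -> Z t <= Z s + loop p (t - s).
Proof. exact: (wallZ_loop p bdom bge). Qed.

Lemma wallS_le_path t0 t1 chi : is_path M rs t0 t1 chi -> chi t0 = rs -> chi t1 = rs ->
  S t0 t1 <= pcost t0 t1 chi.
Proof.
move=> pc c0 c1; have S0 : S t0 t0 = 0 by exact: (wallS_refl p bdom bge).
rewrite -[leRHS]add0r -S0; apply: (path_induction (HM := HM) (Hrs := Hrs) mph ph1 pc).
  move=> a b ta ab _ _; have := wallS_tri p bdom bge ta ab.
  by have := wallS_stay p bdom bge ab; lra.
move=> a b Phi ta ab _ ea eb cc.
have ca : Y (chi a) = 0 by rewrite (_ : chi a = rs) ?ycoord_rs//; case: ea => // ->.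
have cb : Y (chi b) = 0 by rewrite (_ : chi b = rs) ?ycoord_rs//; case: eb => // ->.
have := cost_le (ltW ab) ca cc; rewrite cb => h.
have := wallS_tri p bdom bge ta (ltW ab); have := wallS_loop p bdom bge (ltW ab).
by rewrite /loop; lra.
Qed.

Hypothesis S_Ny : forall N, exists L, forall T, T <= L -> S T 0 <= - N.

Let ZNy N : exists L, forall T, T <= L -> N <= Z T.
Proof. exact: (wallZ_Ny bdom bge S_Ny). Qed.
Let Uwall t : U t 0 = Z t.
Proof. exact: (wallU_wall bhalf Zup Zback Zloop ZNy). Qed.

(** Both kinds of parts satisfy the dynamic programming inequality, so the whole
    path does. *)
Lemma wallU_le_path t0 t1 chi : is_path M rs t0 t1 chi ->
  U t1 (Y (chi t1)) <= U t0 (Y (chi t0)) + pcost t0 t1 chi.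
Proof.
move=> pc.
apply: (path_induction (HM := HM) (Hrs := Hrs) mph ph1 (Psi := fun t => U t (Y (chi t))) pc).
  move=> a b ta ab bt st; rewrite (st a) ?(st b) ?lexx ?ab// ycoord_rs !Uwall.
  exact: (wallZ_stay p bdom bge ab).
by move=> a b Phi ta ab bt _ _ cc; exact: (wallU_extend Zup ZNy (ltW ab) cc).
Qed.

(** The part after time t0 of the optimal motion that leaves the wall at time
    tau <= t0. *)
Lemma arc_from_wall tau t0 t1 s y : 0 < s -> 0 <= y -> light p y < s ->
  tau <= t0 -> t0 < t1 -> t1 - tau = s ->
  exists chi c, [/\ desc ph HM Hrs chi t0 t1 c, Y (chi t1) = y, (tau = t0 -> chi t0 = rs) &
    U t0 (Y (chi t0)) + c <= Z tau + cost p s y].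
Proof.
move=> s0 y0 ls tt tt1 ts; set v := shoot p s y.
have e1 : en p v < 2^-1 := een_lt s0 y0 ls.
have yb : 0 <= sol p v (t1 - tau) by rewrite ts shootE.
have := desc_arc ph tt1 tt e1 yb; set chi := fun t => _ => h.
exists chi; eexists; split; first exact: h.
- by rewrite /chi rcoordK ts shootE.
- by move=> e; rewrite /chi e subrr sol0 rcoord0.
rewrite /chi rcoordK ts -/v /cost -/v.
have [e|ne] := eqVneq tau t0; first by rewrite e subrr sol0 act0 Uwall; lra.
have h1 : 0 < t0 - tau by rewrite subr_gt0 lt_neqAle ne.
have := wallU_le Zup ZNy t0 (sol p v (t0 - tau)) h1.
have -> : t0 - (t0 - tau) = tau by ring.
by have := cost_sol p v (ltW h1); lra.
Qed.

(** A nearly optimal motion slower than light either leaves the wall before time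
    t0, and is cut there, or is preceded by a nearly optimal past of its
    departure, which [wallZ_past] cuts at time t0. *)
Lemma path_near_wallU t0 t1 r e : t0 < t1 -> rs < r -> 0 < e ->
  exists chi, [/\ is_path M rs t0 t1 chi, chi t1 = r &
    U t0 (Y (chi t0)) + pcost t0 t1 chi <= U t1 (Y r) + e].
Proof.
move=> tt rr e0; have e20 : 0 < e / 2 by rewrite divr_gt0.
have y0 := ycoord_gt0 HM Hrs rr; set y := Y r in y0 *.
suff [chi [c [dc cE hc]]] : exists chi c, [/\ desc ph HM Hrs chi t0 t1 c,
    Y (chi t1) = y & U t0 (Y (chi t0)) + c <= U t1 y + e].
  have [h1 h2] := desc_path mph ph1 dc; exists chi; split => //.
    exact: (ycoord_inj HM Hrs).
  by rewrite h2.
have [s [s0 ls hs]] := wallU_near_subluminal bhalf Zup Zback ZNy t1 y0 e20.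
set tau := t1 - s in hs.
have ts : t1 - tau = s by rewrite /tau; ring.
have [tau0|t0tau] := ltP tau t0.
  have [chi [c [h1 h2 _ h3]]] := arc_from_wall s0 (ltW y0) ls (ltW tau0) tt ts.
  by exists chi, c; split => //; lra.
have tau1 : tau < t1 by rewrite /tau; lra.
have [chi3 [c3 [d3 E3 /(_ erefl) W3 h3]]] :=
  arc_from_wall s0 (ltW y0) ls (lexx tau) tau1 ts.
have {}h3 : c3 <= cost p s y by move: h3; rewrite W3 ycoord_rs Uwall; lra.
have [u [v [l [[ut0 t0v vt] vl hl]]]] := wallZ_past bdom bge bbe S_Ny t0tau e20.
have [chi2 [a2 b2 d2]] := chain_path ph HM Hrs vl.
have d23 := desc_glue d2 d3 b2 W3; set chi := glue _ _ _ in d23.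
have chi1 : Y (chi t1) = y by rewrite /chi /glue leNgt tau1.
have chiv : chi v = rs by rewrite /chi /glue vt.
have [E|ne] := eqVneq t0 v.
  exists chi; eexists; split; first by rewrite E; exact: d23.
    by [].
  rewrite E chiv ycoord_rs Uwall.
  have uv : u <= v by rewrite -E.
  by have := Zloop uv; lra.
have lt : t0 < v by rewrite lt_neqAle ne.
have vu : 0 < v - u by rewrite subr_gt0 (le_lt_trans ut0).
have lv : light p 0 < v - u by rewrite light0.
have [chi1' [c1 [d1 E1 _ h1]]] := arc_from_wall vu (lexx 0) lv ut0 lt erefl.
have W1 : chi1' v = rs by apply: (ycoord_inj HM Hrs); rewrite E1 ycoord_rs.
exists (glue v chi1' chi); eexists; split; first exact: desc_glue d1 d23 W1 chiv.
  by rewrite /glue ifF// leNgt (le_lt_trans vt tau1).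
rewrite {1}/glue (ltW lt); move: hl h1; rewrite /loop => hl h1.
move: (U t0 _) (ccost _ _ _ _ _) (cost p _ 0) h1 hl => ? ? ? ? ?; lra.
Qed.

Let Usg t : supergrad (U t) (vmin p Z t).
Proof. by move=> y0 y00; exact: (wallU_semiconcave bhalf Zup Zback ZNy t y00). Qed.

Let vB t y : 0 < y -> `|vmin p Z t y| <= cspeed p 0.
Proof.
move=> y0; rewrite -ler_sqr ?nnegrE ?(ltW (cspeed_gt0 _ _))// real_normK ?num_real//.
apply: le_trans (vmin2 bhalf Zup Zback ZNy t y0) _.
by rewrite !cspeed2 lerD2l ler_pM2l// pot_le// ltW.
Qed.

Definition slope t y : R := rgrad (vmin p Z t) y.

(** The right derivative of U in y, rescaled to the velocity of the arriving
    characteristic. *)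
Definition profile t r : R := if rs < r then lapse M rs r * slope t (Y r) else 0.

(* The profile (g = lapse) and the integrand of its potential (g = stretch). *)
Let weighted (g : R -> R) t r : R := if rs < r then g r * slope t (Y r) else 0.

Lemma slope_quot t y : 0 < y ->
  (fun n : nat => n.+1%:R * (U t (y + n.+1%:R^-1) - U t y)) n @[n --> \oo] --> slope t y.
Proof. by move=> y0; exact: (rgrad_quot (Usg t) (@vB t) y0). Qed.

Let slopeB t y : 0 < y -> `|slope t y| <= cspeed p 0.
Proof. exact: (rgrad_bound (Usg t) (@vB t)). Qed.

Let weighted_meas g t : continuous g -> measurable_fun [set: R] (weighted g t).
Proof.
move=> cg; set D : set R := `]rs, +oo[%classic.
have DE r : (r \in D) = (rs < r) by rewrite /D mem_setE in_itv/= andbT.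
rewrite (_ : weighted g t = (fun r => g r * slope t (Y r)) \_ D); last first.
  by apply/funext => r; rewrite patchE DE.
have mD : measurable D by exact: measurable_itv.
apply/(measurable_restrictT _ mD).
apply: (@measurable_fun_cvg _ _ _ D
  (fun n r => g r * (n.+1%:R * (U t (Y r + n.+1%:R^-1) - U t (Y r))))); last first.
  move=> r; rewrite /D/= in_itv/= andbT => rr; apply: cvgM; first exact: cvg_cst.
  exact: slope_quot (ycoord_gt0 HM Hrs rr).
move=> n; apply: open_continuous_measurable_fun; first exact: interval_open.
move=> r; rewrite DE => rr; have y0 := ycoord_gt0 HM Hrs rr.
have n0 : 0 < (n.+1%:R^-1 : R) by rewrite invr_gt0.
have cU : forall z, 0 < z -> {for z, continuous (U t)}.
  by move=> z z0; exact: (supergrad_cont (Usg t) (@vB t) z0).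
have cY : {for r, continuous Y} by exact: (ycoord_cont HM Hrs).
apply: cvgM; first exact: cg.
apply: cvgM; first exact: cvg_cst.
apply: cvgB.
  apply: (@continuous_comp _ _ _ (fun r => Y r + n.+1%:R^-1) (U t)).
    by apply: cvgD; [exact: cY|exact: cvg_cst].
  by apply: cU; rewrite addr_gt0.
by apply: (@continuous_comp _ _ _ Y (U t)); [exact: cY|exact: cU].
Qed.

Let weighted_bound g t C : 0 <= C -> (forall r, `|g r| <= C) ->
  forall r, `|weighted g t r| <= C * cspeed p 0.
Proof.
move=> C0 hg r; rewrite /weighted; case: ifP => [rr|_].
  by rewrite normrM ler_pM// slopeB// ycoord_gt0.
by rewrite normr0 mulr_ge0// ltW// cspeed_gt0.
Qed.

Let kern := weighted (stretch M rs).

Let kern_meas t : measurable_fun [set: R] (kern t).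
Proof. exact: weighted_meas (stretch_cont HM Hrs). Qed.

Let kernB t r : `|kern t r| <= stretch M rs rs * cspeed p 0.
Proof.
apply: weighted_bound; first exact: ltW (stretch_gt0 HM Hrs _).
by move=> x; rewrite ger0_norm ?stretch_le// ltW// stretch_gt0.
Qed.

Let kern_locint t : locint (kern t).
Proof. exact: bounded_locint (kern_meas t) (kernB t). Qed.

Let kernE t r : (1 - 2 * M / r) ^- 2 * profile t r = kern t r.
Proof.
rewrite /profile /kern /weighted; case: ifP => rr; last by rewrite mulr0.
have := lapse2 HM Hrs r; rewrite cutE ?(ltW rr)// => <-; rewrite /stretch.
by field; rewrite gt_eqF// lapse_gt0.
Qed.

Let prim_stretch c a b : a <= b ->
  prim (fun x => c * stretch M rs x) b - prim (fun x => c * stretch M rs x) a =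
  c * (Y b - Y a).
Proof.
move=> ab; rewrite mulrBr.
apply: (@deriv_eq _ _ (fun x => c * Y x) (fun x => c * stretch M rs x) _ _ ab).
  move=> x _; apply: is_derive_primc => z; apply: cvgM; first exact: cvg_cst.
  exact: (stretch_cont HM Hrs).
by move=> x _; apply: dZ; exact: (d_ycoord HM Hrs).
Qed.

Let stretchc_locint c : locint (fun x => c * stretch M rs x).
Proof.
apply: continuous_locint => z; apply: cvgM; first exact: cvg_cst.
exact: (stretch_cont HM Hrs).
Qed.

(* On a small interval both sides are (Y z - Y x) times a value of the slope
   between those at the ends, up to the semiconcavity constants. *)
Let wallU_prim_away t a r : rs < a -> a <= r ->
  U t (Y r) - U t (Y a) = prim (kern t) r - prim (kern t) a.
Proof.
move=> ra ar; have ya := ycoord_gt0 HM Hrs ra.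
have sg : supergrad (U t) (slope t) by exact: (supergrad_rgrad (Usg t) (@vB t)).
have [K1 K10 hK1] := sg _ ya.
have [K2 K20 hK2] := supergrad_mono sg ya.
pose K := K1 + K2.
suff : U t (Y a) - prim (kern t) a = U t (Y r) - prim (kern t) r by lra.
apply: (@partition_const _ (fun x => U t (Y x) - prim (kern t) x)
  (fun x => slope t (Y x) - 2 * K * Y x) (stretch M rs rs)) => //.
  exact: ltW (stretch_gt0 HM Hrs _).
move=> x z ax xz zr.
have yx : Y a <= Y x by exact: ycoord_le.
have yz : Y x <= Y z by exact: ycoord_le.
have up := hK1 _ (Y z) yx; have dn := hK1 _ (Y x) (le_trans yx yz).
have mo u w : Y a <= u -> u <= w -> slope t w <= slope t u + K2 * (w - u).
  by move=> h1 h2; have := hK2 _ _ h1 h2; move: (slope t w) (slope t u) => *; lra.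
have lo : (slope t (Y z) - K2 * (Y z - Y x)) * (Y z - Y x) <=
    prim (kern t) z - prim (kern t) x.
  rewrite -prim_stretch//; apply: prim_le => // q /andP[xq qz].
  rewrite /kern /weighted (lt_le_trans ra (le_trans ax xq)) mulrC.
  apply: ler_wpM2l; first exact: ltW (stretch_gt0 HM Hrs _).
  have h1 : Y x <= Y q by exact: ycoord_le.
  have h2 : Y q <= Y z by exact: ycoord_le.
  have := mo _ _ (le_trans yx h1) h2.
  have : K2 * (Y z - Y q) <= K2 * (Y z - Y x) by apply: ler_wpM2l => //; lra.
  lra.
have hi : prim (kern t) z - prim (kern t) x <=
    (slope t (Y x) + K2 * (Y z - Y x)) * (Y z - Y x).
  rewrite -prim_stretch//; apply: prim_le => // q /andP[xq qz].
  rewrite /kern /weighted (lt_le_trans ra (le_trans ax xq)) [leRHS]mulrC.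
  apply: ler_wpM2l; first exact: ltW (stretch_gt0 HM Hrs _).
  have h1 : Y x <= Y q by exact: ycoord_le.
  have h2 : Y q <= Y z by exact: ycoord_le.
  have := mo _ _ yx h1.
  have : K2 * (Y q - Y x) <= K2 * (Y z - Y x) by apply: ler_wpM2l => //; lra.
  lra.
have mxz := mo _ _ yx yz.
have dY : Y z - Y x <= stretch M rs rs * (z - x) by exact: ycoord_lip.
have k2 : 0 <= K1 * (Y z - Y x) by rewrite mulr_ge0// subr_ge0.
have k3 : 0 <= K2 * (Y z - Y x) by rewrite mulr_ge0// subr_ge0.
apply: le_trans (_ : _ <= (Y z - Y x) *
    ((slope t (Y x) - 2 * K * Y x) - (slope t (Y z) - 2 * K * Y z))) _; last first.
  by apply: ler_wpM2r => //; rewrite /K; lra.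
move: up dn lo hi; rewrite /K.
move: (U t (Y x)) (U t (Y z)) (prim _ z) (prim _ x) (slope t (Y x)) (slope t (Y z)) => *.
by rewrite ler_norml; apply/andP; split; nra.
Qed.

(** The semiconcavity of U is uniform away from the wall only; towards the wall
    both sides are continuous. *)
Lemma wallU_prim t r : rs <= r ->
  U t (Y r) - Z t = prim (kern t) r - prim (kern t) rs.
Proof.
move=> rr; have [<-|ne] := eqVneq rs r; first by rewrite ycoord_rs Uwall !subrr.
have {ne rr} rr : rs < r by rewrite lt_neqAle ne.
set C1 := (1 + pot p 0) * stretch M rs rs; set C2 := stretch M rs rs * cspeed p 0.
have C20 : 0 <= C2 by exact: le_trans (normr_ge0 _) (kernB t 0).
have C10 : 0 <= C1.
  apply: mulr_ge0; last exact: ltW (stretch_gt0 HM Hrs _).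
  by apply: addr_ge0 => //; exact: pot_ge0.
have hk c : rs <= c -> `|prim (kern t) c - prim (kern t) rs| <= C2 * (c - rs).
  move=> rc; rewrite ler_norml.
  have h1 := prim_le (s := rs) (t := c) (kern_locint t) (locint_cst C2)
    (fun x _ => le_trans (ler_norm _) (kernB t x)) rc.
  have h2 : prim (fun=> - C2) c - prim (fun=> - C2) rs <= prim (kern t) c - prim (kern t) rs.
    apply: prim_le => //; first exact: locint_cst.
    by move=> x _; have := kernB t x; rewrite ler_norml => /andP[].
  by rewrite !prim_cst// in h1 h2; apply/andP; split; lra.
apply/eqP; rewrite -subr_eq0 -normr_le0; apply/ler_addgt0Pr => e e0; rewrite add0r.
have CC : 0 < C1 + C2 + 1 by exact: ltr_wpDl (addr_ge0 C10 C20) ltr01.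
pose a := Num.min r (rs + e / (C1 + C2 + 1)).
have d0 : 0 < e / (C1 + C2 + 1) by rewrite divr_gt0.
have ra : rs < a by rewrite lt_min rr ltrDl.
have ar : a <= r by rewrite ge_min lexx.
have ae : a <= rs + e / (C1 + C2 + 1) by rewrite ge_min lexx orbT.
have h1 := wallU_prim_away t ra ar.
have h2 := wallU_near_wall bhalf Zup Zback Zloop ZNy t (ycoord_gt0 HM Hrs ra).
have h3 := hk _ (ltW ra).
have h4 : (1 + pot p 0) * Y a <= C1 * (a - rs).
  rewrite /C1 -mulrA; apply: ler_wpM2l; first by rewrite addr_ge0 ?pot_ge0.
  by have := ycoord_lip HM Hrs (ltW ra); rewrite ycoord_rs subr0.
have h5 : (C1 + C2) * (a - rs) <= e.
  apply: (@le_trans _ _ ((C1 + C2 + 1) * (e / (C1 + C2 + 1)))).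
    apply: ler_pM; [exact: addr_ge0|by rewrite subr_ge0 ltW|by rewrite lerDl|].
    by rewrite lerBlDl.
  by rewrite mulrC divfK// gt_eqF.
have -> : U t (Y r) - Z t - (prim (kern t) r - prim (kern t) rs) =
   (U t (Y a) - Z t) - (prim (kern t) a - prim (kern t) rs) by lra.
apply: le_trans (ler_normB _ _) _; lra.
Qed.

Lemma Wpot_profile t r : rs <= r -> Wpot M rs (profile t) r = U t (Y r) - Z t.
Proof.
move=> rr; rewrite wallU_prim// prim_itv//.
by apply: eq_Rintegral => x _; rewrite kernE.
Qed.

(** The lower bound is [wallU_le_path] and the upper one [path_near_wallU]: the
    potential of the profile at time t0 is U up to a constant. *)
Lemma value_profile t0 t1 r : t0 < t1 -> rs < r ->
  value M rs ph (profile t0) t0 t1 r = U t1 (Y r) - Z t0.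
Proof.
move=> tt rr.
have actE chi : is_path M rs t0 t1 chi -> action M rs ph (profile t0) t0 t1 chi =
    U t0 (Y (chi t0)) - Z t0 + pcost t0 t1 chi.
  move=> [_ h _]; rewrite /action Wpot_profile; last by rewrite h// lexx ltW.
  by rewrite /pcost; lra.
apply: inf_eq.
  by move=> _ [chi [pc <-] <-]; rewrite actE//; have := wallU_le_path pc; lra.
move=> e e0; have [chi [pc cr h]] := path_near_wallU tt rr e0.
exists (action M rs ph (profile t0) t0 t1 chi); first by exists chi.
by rewrite actE//; lra.
Qed.

Lemma value_derive t0 t1 : t0 < t1 ->
  {ae mu, forall r, rs < r ->
    derivable (value M rs ph (profile t0) t0 t1) r 1 /\
    profile t1 r =
      (1 - 2 * M / r) ^+ 2 * derive1 (value M rs ph (profile t0) t0 t1) r}.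
Proof.
move=> tt; have := prim_ae (kern_meas t1) (kernB t1).
apply: filterS; first exact: (ae_filter_ringOfSetsType mu).
move=> r dk rr.
have d : is_derive r 1 (value M rs ph (profile t0) t0 t1) (kern t1 r).
  have d1 := dD dk (dC r (Z t1 - Z t0 - prim (kern t1) rs)); rewrite addr0 in d1.
  apply: is_derive_near d1.
  apply: (@near_in_oo _ rs (r + 1)); first by rewrite rr ltrDl ltr01.
  move=> x /andP[rx _]; rewrite value_profile//.
  by have := wallU_prim t1 (ltW rx); lra.
split; first by case: d.
have -> : derive1 (value M rs ph (profile t0) t0 t1) r = kern t1 r.
  by rewrite derive1E; case: d.
rewrite -kernE mulrA divff ?mul1r// expf_neq0//.
by have := lapse2_gt0 HM Hrs r; rewrite cutE ?(ltW rr)// => /gt_eqF->.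
Qed.

Lemma profile_meas t : measurable_fun [set: R] (profile t).
Proof. exact: weighted_meas (lapse_cont HM Hrs). Qed.

Lemma profile_in_D t : in_D rs (profile t).
Proof.
move=> r rr; have y0 := ycoord_gt0 HM Hrs rr; split.
  have lim : lapse M rs x * slope t (Y x) @[x --> r^'+] --> profile t r.
    rewrite /profile rr; apply: cvgM.
      by apply: cvg_at_right_filter; exact: (lapse_cont HM Hrs).
    apply: (@cvg_comp _ _ _ Y (slope t) _ (Y r)^'+); last exact: (rgrad_right (Usg t) y0).
    move=> A hA; have cY : {for r, continuous Y} by exact: (ycoord_cont HM Hrs).
    have hx : \forall x \near r, Y r < Y x -> A (Y x) by exact: cY _ hA.
    suff : \forall x \near r, r < x -> A (Y x) by [].
    by apply: filterS hx => x h rx; apply: h; exact: ycoord_lt.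
  apply: cvg_trans lim; apply: near_eq_cvg; near=> x; rewrite /profile ifT//.
  apply: lt_trans rr _; near: x; exact: nbhs_right_gt.
have : cvg (slope t z @[z --> (Y r)^'-]) by exact: (rgrad_left (Usg t) (@vB t) y0).
move=> /cvg_ex[l hl]; apply/cvg_ex; exists (lapse M rs r * l).
have lim : lapse M rs x * slope t (Y x) @[x --> r^'-] --> lapse M rs r * l.
  apply: cvgM; first by apply: cvg_at_left_filter; exact: (lapse_cont HM Hrs).
  apply: (@cvg_comp _ _ _ Y (slope t) _ (Y r)^'-); last exact: hl.
  move=> A hA; have cY : {for r, continuous Y} by exact: (ycoord_cont HM Hrs).
  have hx : \forall x \near r, Y x < Y r -> A (Y x) by exact: cY _ hA.
  suff : \forall x \near r, x < r -> A (Y x) by [].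
  by apply: filterS hx => x h rx; apply: h; exact: ycoord_lt.
apply: cvg_trans lim; apply: near_eq_cvg; near=> x; rewrite /profile.
have -> : rs < x by near: x; exact: nbhs_left_gt.
by [].
Unshelve. all: by end_near. Qed.

(** The rate of gain exists outside a null set of times, and the departure time of
    light is an expanding function of the radius of arrival. *)
Lemma light_ae t : {ae mu, forall r, rs < r ->
  is_derive (t - light p (Y r)) 1 betap (gainp M rs ph (t - light p (Y r)))}.
Proof.
have mg : measurable_fun [set: R] (gainp M rs ph).
  by apply: measurable_maxr; [exact: (gain_meas M rs mph)|exact: measurable_cst].
have bg x : `|gainp M rs ph x| <= 2^-1.
  by rewrite ger0_norm ?gainp_ge0// ltW// (gainp_lt HM Hrs ph1).
have [A [mA A0 hA]] := prim_ae mg bg.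
pose f r := t - light p (Y r); pose D : set R := `]rs, +oo[%classic.
have oD : open D by exact: interval_open.
have mD : measurable D by exact: measurable_itv.
have mf : measurable_fun D f.
  apply: open_continuous_measurable_fun => // r; rewrite mem_setE in_itv/= andbT => rr.
  apply: cvgB; first exact: cvg_cst.
  exact: (is_derive_cont (d_light_ycoord HM Hrs (ltW rr))).
have mB : measurable (D `&` f @^-1` A) by exact: mf.
exists (D `&` f @^-1` A); split => //.
  apply: (expanding_null (f := f) mB _ _ A0); last by move=> x [].
  have main x z : rs < x -> x <= z -> `|x - z| <= `|f x - f z|.
    move=> rx xz; have := light_ycoord_expand HM Hrs (ltW rx) xz.
    have -> : f x - f z = light p (Y z) - light p (Y x) by rewrite /f; ring.
    move=> h; rewrite distrC ger0_norm ?subr_ge0//.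
    exact: le_trans h (ler_norm _).
  move=> x z [+ _] [+ _]; rewrite /D/= !in_itv/= !andbT => rx rz.
  by have [zx|/ltW xz] := leP z x; [rewrite distrC (distrC (f x)); exact: main|exact: main].
move=> r /= /not_implyP[rr nd]; split; first by rewrite /D/= in_itv/= andbT.
by apply: hA => /= h; apply: nd.
Qed.

(** Almost everywhere U is differentiable, so the slope is the velocity of a
    minimizer. Its energy is at most 1/2. If it were 1/2, the minimizer would
    be light, and [light_ae] gives a rate of gain at its departure, which is
    below 1/2: a contradiction to [wallU_min_een_lt]. *)
Lemma profile_lt1 t : {ae mu, forall r, rs <= r -> -1 < profile t r < 1}.
Proof.
have := light_ae t; have := prim_ae (kern_meas t) (kernB t).
apply: filterS2; first exact: (ae_filter_ringOfSetsType mu).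
move=> r dk dl rr.
rewrite -ltr_norml /profile; case: ifPn => [{}rr|_]; last by rewrite normr0.
have y0 := ycoord_gt0 HM Hrs rr.
have l0 := lapse_gt0 HM Hrs r.
have dUY : is_derive r 1 (fun x => U t (Y x)) (kern t r).
  have d1 := dD dk (dC r (Z t - prim (kern t) rs)); rewrite addr0 in d1.
  apply: is_derive_near d1.
  apply: (@near_in_oo _ rs (r + 1)); first by rewrite rr ltrDl ltr01.
  by move=> x /andP[rx _]; have := wallU_prim t (ltW rx); lra.
have dU : is_derive (Y r) 1 (U t) (slope t (Y r)).
  have dr := d_rcoord HM Hrs (Y r).
  rewrite -{1}(ycoordK HM Hrs r) in dUY.
  have d2 := dcomp dr dUY.
  have -> : U t = (fun y => U t (Y (rc y))) by apply/funext => y; rewrite rcoordK.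
  apply: is_derive_eq d2 _; rewrite /kern /weighted rr ycoordK.
  by field; rewrite gt_eqF// stretch_gt0.
rewrite (supergrad_derive (Usg t) y0 dU) /vmin.
have [s0 hs] := sminP bhalf Zup Zback ZNy t y0.
move: (smin p Z t (Y r)) s0 hs => s s0 hs.
have e1 : een p s (Y r) < 2^-1.
  have le := wallU_min_een_le bhalf Zup Zback ZNy s0 hs.
  rewrite lt_neqAle le andbT; apply/eqP => e.
  have es := een_eq s0 (ltW y0) e; have db := dl rr; rewrite -es in db.
  have := wallU_min_een_lt Zup Zback ZNy s0 hs db (gainp_lt HM Hrs ph1 _).
  by rewrite e ltxx.
rewrite -(expr_lt1 (n := 2))// real_normK ?num_real// exprMn fvel2//.
rewrite -ltr_pdivlMl ?exprn_gt0// mulr1 -exprVn -(cspeed_ycoord HM Hrs (ltW rr)) cspeed2.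
by move: e1; lra.
Qed.

Lemma profile_in_U t : in_U rs (profile t).
Proof.
split; last exact: profile_lt1.
move=> b; apply: (bounded_locint (profile_meas t)
  (weighted_bound (g := lapse M rs) t ler01 _)) => r.
by rewrite ger0_norm ?lapse_le1// ltW// lapse_gt0.
Qed.

Lemma profile_evolution t0 t1 : t0 < t1 ->
  evolution M rs ph t0 t1 (profile t0) (profile t1).
Proof.
move=> tt; split; [exact: profile_in_U|exact: profile_in_D|exact: value_derive].
Qed.

End evolution.

(** * Translations in time *)

Section translation.
Context {R : realType}.
Local Notation mu := (@lebesgue_measure R).
Implicit Types (f : R -> R) (a b c h t : R).

Lemma measurable_shift h : measurable_fun [set: R] (fun x : R => x + h).
Proof. by apply: measurable_funD => //; exact: measurable_cst. Qed.

Lemma lebesgue_shift h (A : set R) : measurable A ->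
  mu ((fun x => x + h) @^-1` A) = mu A.
Proof.
move=> mA.
have ms : @measurable_fun _ _ (measurableTypeR R) (measurableTypeR R) setT
  (fun x : R => x + h) := measurable_shift h.
pose nu : {measure set (measurableTypeR R) -> \bar R} :=
  measure_function_pushforward__canonical__measure_function_Measure mu ms.
apply/esym; apply: (@lebesgue_measure_unique R nu _ A mA).
move=> _ [[a b] _ <-].
rewrite /nu /= /pushforward /=.
rewrite (_ : _ @^-1` _ = `]a - h, b - h]%classic); last first.
  by apply/seteqP; split=> x /=; rewrite !in_itv/= ltrBlDr lerBrDr.
rewrite !lebesgue_measure_itv /= !lte_fin ltrD2r; case: ifP => // _.
by rewrite -!EFinB; congr EFin; ring.
Qed.

Lemma Rintegral_shift f K h a b : measurable_fun [set: R] f -> (forall t, `|f t| <= K) ->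
  \int[mu]_(x in `[a, b]) f (x + h) = \int[mu]_(x in `[a + h, b + h]) f x.
Proof.
move=> mf hK.
have pre : (fun x => x + h) @^-1` `[a + h, b + h]%classic = `[a, b]%classic.
  by apply/seteqP; split=> x /=; rewrite !in_itv/= !lerD2r.
have mfh : measurable_fun [set: R] (fun x => f (x + h)).
  exact: measurableT_comp mf (measurable_shift h).
have ii : mu.-integrable ((fun x => x + h) @^-1` `[a + h, b + h]%classic)
    ((EFin \o f) \o (fun x => x + h)).
  by rewrite pre; exact: (bounded_locint mfh (fun x => hK (x + h))).
have mD : measurable (`[a + h, b + h]%classic : set R) by exact: measurable_itv.
have mE : measurable_fun [set: R] (EFin \o f) by exact/measurable_EFinP.
have := @integral_pushforward _ _ (measurableTypeR R) (measurableTypeR R)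
  R _ (measurable_shift h) mu _ (EFin \o f) mE ii mD.
rewrite pre /Rintegral => e; congr fine; rewrite -[LHS]e.
apply: eq_measure_integral; first exact: measurable_shift.
by move=> ms A mA _; exact: lebesgue_shift.
Qed.

Lemma prim_shift f K h a b : measurable_fun [set: R] f -> (forall t, `|f t| <= K) ->
  prim (fun x => f (x + h)) b - prim (fun x => f (x + h)) a =
  prim f (b + h) - prim f (a + h).
Proof.
move=> mf hK.
have mfh : measurable_fun [set: R] (fun x => f (x + h)).
  exact: measurableT_comp mf (measurable_shift h).
have i1 := bounded_locint mf hK.
have i2 := bounded_locint mfh (fun x => hK (x + h)).
have main c d : c <= d -> prim (fun x => f (x + h)) d - prim (fun x => f (x + h)) c =
    prim f (d + h) - prim f (c + h).
  by move=> cd; rewrite !prim_itv ?lerD2r// (Rintegral_shift h c d mf hK).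
have [/main//|/ltW/main e] := leP a b.
by rewrite -opprB e opprB.
Qed.

End translation.

Section shift.
Context {R : realType} (p : convex_potential R).
Implicit Types (beta : R -> R) (a b c h s t : R) (l : seq (R * R)).

(** Everything depends on the increments of the gain only. *)
Definition shifted beta beta' h :=
  forall a b, beta' b - beta' a = beta (b + h) - beta (a + h).

Lemma shifted_sym beta beta' h : shifted beta beta' h -> shifted beta' beta (- h).
Proof. by move=> H a b; rewrite H !subrK. Qed.

Lemma wallS_shift beta beta' h a b : shifted beta beta' h ->
  wallS p beta' a b = wallS p beta (a + h) (b + h).
Proof.
have sub (f g : R -> R) (k c d : R) : shifted f g k ->
    [set ccost p g c d l | l in [set l | cvalid c d l]] `<=`
    [set ccost p f (c + k) (d + k) l | l in [set l | cvalid (c + k) (d + k) l]].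
  move=> H _ [l /= vl <-]; exists [seq (x.1 + k, x.2 + k) | x <- l].
    elim: l c vl => [|[u v] l IH] c /=; first by rewrite lerD2r.
    by move=> /and3P[cu uv /IH vl]; rewrite !lerD2r cu uv.
  elim: l c vl => [|[u v] l IH] c /=; first by move=> _; have := H d c; lra.
  move=> /and3P[cu uv /IH ->].
  have -> : v + k - (u + k) = v - u by ring.
  by have := H u c; lra.
move=> H; congr inf; apply/seteqP; split; first exact: sub.
have := sub _ _ _ (a + h) (b + h) (shifted_sym H).
by rewrite !addrK; exact.
Qed.

Lemma busemann_shift beta beta' h s t : shifted beta beta' h ->
  busemann p beta' s t = busemann p beta (s + h) (t + h).
Proof.
move=> H; congr inf; apply/seteqP; split => _ [T /= Ts <-].
  by exists (T + h); rewrite /= ?lerD2r// -!(wallS_shift _ _ H).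
exists (T - h); first by rewrite /= lerBlDr.
by rewrite !(wallS_shift _ _ H) subrK.
Qed.

Variables beta beta' betap betap' : R -> R.
Variable h : R.
Hypothesis H : shifted beta beta' h.
Hypothesis betap_dom : forall s t, s <= t -> beta t - beta s <= betap t - betap s.
Hypothesis betap_ge : forall s t, s <= t -> betap s <= betap t.
Hypothesis beta_ge : forall s t, s <= t -> - pot p 0 * (t - s) <= beta t - beta s.
Hypothesis wallS_Ny : forall N, exists L, forall T, T <= L -> wallS p beta T 0 <= - N.

Lemma wallS_Ny_shift N : exists L, forall T, T <= L -> wallS p beta' T 0 <= - N.
Proof.
have [L _ hL] := wallS_Ny_at betap_dom betap_ge wallS_Ny h N.
exists (L - h) => T TL; rewrite (wallS_shift _ _ H) add0r; apply: hL; lra.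
Qed.

Hypothesis betap_dom' : forall s t, s <= t -> beta' t - beta' s <= betap' t - betap' s.
Hypothesis betap_ge' : forall s t, s <= t -> betap' s <= betap' t.
Hypothesis beta_ge' : forall s t, s <= t -> - pot p 0 * (t - s) <= beta' t - beta' s.

Lemma wallZ_shift t : wallZ p beta' t = wallZ p beta (t + h) - wallZ p beta h.
Proof.
have [t0|/ltW t0] := leP 0 t.
  have := wallZB p betap_dom' betap_ge' t0.
  rewrite (busemann_shift _ _ H) -(wallZB p betap_dom betap_ge) ?lerD2r//.
  by rewrite (wallZ0 p betap_dom' betap_ge') subr0 add0r.
have := wallZB p betap_dom' betap_ge' t0.
rewrite (busemann_shift _ _ H) -(wallZB p betap_dom betap_ge) ?lerD2r//.
by rewrite (wallZ0 p betap_dom' betap_ge') !add0r; lra.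
Qed.

Lemma wallU_shift t y :
  wallU p (wallZ p beta') t y = wallU p (wallZ p beta) (t + h) y - wallZ p beta h.
Proof.
have Zup s u (su : s <= u) := wallZ_up betap_dom betap_ge beta_ge su.
have ZNy := wallZ_Ny betap_dom betap_ge wallS_Ny.
have Zup' s u (su : s <= u) := wallZ_up betap_dom' betap_ge' beta_ge' su.
have ZNy' := wallZ_Ny betap_dom' betap_ge' wallS_Ny_shift.
apply/eqP; rewrite eq_le; apply/andP; split.
  rewrite lerBrDr; apply: wallU_ge => s s0.
  have := wallU_le Zup' ZNy' t y s0; rewrite wallZ_shift.
  by have -> : t - s + h = t + h - s by [ring]; lra.
apply: wallU_ge => s s0; rewrite wallZ_shift.
have := wallU_le Zup ZNy (t + h) y s0.
by have -> : t - s + h = t + h - s by [ring]; lra.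
Qed.

End shift.

(** * Measurability *)

Section measurability.
Context {d : measure_display} {T : measurableType d} {R : realType}.
Local Notation mu := (@lebesgue_measure R).

(** Stated by strict sublevel sets, so that an infimum over an uncountable set
    qualifies as soon as countably many members approximate it. *)
Lemma measurable_fun_inf_countable (I : countType) (D : set T) (F : I -> T -> R) (f : T -> R) :
  (forall i, measurable_fun D (F i)) ->
  (forall x, D x -> forall c, f x < c <-> exists i, F i x < c) ->
  measurable_fun D f.
Proof.
move=> mF h mD; apply: (measurability _ (RGenInftyO.measurableE R)) => //.
move=> _ [_ [c ->] <-].
rewrite (_ : _ `&` _ = \bigcup_k (if @unpickle I k is Some i
    then D `&` F i @^-1` `]-oo, c[%classic else set0)).
  apply: bigcupT_measurable => k; case: unpickle => [i|//].
  by apply: mF => //; exact: measurable_itv.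
apply/seteqP; split=> x.
  move=> [Dx]; rewrite /= in_itv/= => /(h x Dx)[i Fi].
  by exists (pickle i) => //; rewrite pickleK; split => //=; rewrite in_itv/=.
move=> [k _]; case: unpickle => [i|//] [Dx]; rewrite /= in_itv/= => Fi.
by split => //=; rewrite in_itv/=; apply/(h x Dx); exists i.
Qed.

Lemma measurable_fun_section_integral (f : T * measurableTypeR R -> R) (A : set R) :
  measurable A -> measurable_fun [set: T * measurableTypeR R] f -> (forall q, 0 <= f q) ->
  measurable_fun [set: T] (fun x => \int[mu]_(y in A) f (x, y)).
Proof.
move=> mA mf f0.
pose F (q : T * measurableTypeR R) : \bar R := (f q * \1_A q.2)%:E.
have mF : measurable_fun [set: T * measurableTypeR R] F.
  apply/measurable_EFinP; apply: measurable_funM => //.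
  exact: (measurableT_comp (measurable_indic mA) measurable_snd).
have F0 q : (0 <= F q)%E by rewrite lee_fin mulr_ge0.
have := @measurable_fun_fubini_tonelli_F _ _ _ _ R mu F mF F0 => mI.
rewrite (_ : (fun x => _) = fine \o fubini_F mu F).
  by apply: measurableT_comp mI; exact: fine_measurable.
apply/funext => x /=; rewrite /Rintegral /fubini_F integral_mkcond.
congr fine; apply: eq_integral => y _; rewrite /F patchE indicE.
by case: ifP => _; rewrite ?mulr1 ?mulr0.
Qed.

Lemma measurable_fun_section_prim (f : T * measurableTypeR R -> R) K b :
  measurable_fun [set: T * measurableTypeR R] f -> (forall q, `|f q| <= K) ->
  measurable_fun [set: T] (fun x => prim (fun y => f (x, y)) b).
Proof.
move=> mf hK.
have mfK : measurable_fun [set: T * measurableTypeR R] (fun q => f q + K).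
  by apply: measurable_funD => //; exact: measurable_cst.
have fK0 q : 0 <= f q + K by have := hK q; rewrite ler_norml => /andP[]; lra.
have msec x : measurable_fun [set: R] (fun y => f (x, y)).
  exact: (measurable_fun_pair2 x mf).
have loc x := bounded_locint (msec x) (fun y => hK (x, y)).
have locK x : locint (fun y => f (x, y) + K).
  apply: (@bounded_locint _ _ (K + K)); first by apply: measurable_funD => //; exact: measurable_cst.
  move=> y; rewrite (ger0_norm (fK0 (x, y))).
  by have := le_trans (ler_norm _) (hK (x, y)); lra.
have e x a c : a <= c -> prim (fun y => f (x, y)) c - prim (fun y => f (x, y)) a =
    \int[mu]_(y in `[a, c]) (f (x, y) + K) - K * (c - a).
  move=> ac; rewrite prim_itv// RintegralD//; [|exact: loc|exact: locint_cst].
  by rewrite -(prim_cst K ac) prim_itv//; [ring|exact: locint_cst].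
have [b0|/ltW b0] := leP 0 b.
  rewrite (_ : (fun x => _) = (fun x => \int[mu]_(y in `[0, b]) (f (x, y) + K) - K * (b - 0))).
    apply: measurable_funB; last exact: measurable_cst.
    exact: (measurable_fun_section_integral (f := fun q => f q + K)).
  by apply/funext => x; rewrite -e// prim0 subr0.
rewrite (_ : (fun x => _) = (fun x => K * (0 - b) - \int[mu]_(y in `[b, 0]) (f (x, y) + K))).
  apply: measurable_funB; first exact: measurable_cst.
  exact: (measurable_fun_section_integral (f := fun q => f q + K)).
by apply/funext => x; have := e x _ _ b0; rewrite prim0 => h; lra.
Qed.

End measurability.

Section rational_chains.
Context {R : realType} (p : convex_potential R) (beta : R -> R).
Hypothesis beta_ge : forall s t, s <= t -> - pot p 0 * (t - s) <= beta t - beta s.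
Implicit Types (a b : R) (l : seq (R * R)).

Definition ratl (l : seq (rat * rat)) : seq (R * R) := [seq (ratr x.1, ratr x.2) | x <- l].

(** Longer loops cost more, so shrinking the loops of a chain a little, to make
    their endpoints rational, only adds the cost of some short stays. *)
Lemma ccost_rat a b l e : cvalid a b l -> 0 < e ->
  exists2 l', cvalid a b (ratl l') & ccost p beta a b (ratl l') <= ccost p beta a b l + e.
Proof.
elim: l a e => [|[u v] l IH] a e /=; first by exists [::] => //=; lra.
move=> /and3P[au uv vl] e0; have e20 : 0 < e / 2 by rewrite divr_gt0.
have [l' vl' hl'] := IH v _ vl e20.
have weaken x y c l0 : x <= y -> cvalid y c l0 -> cvalid x c l0 /\
    ccost p beta x c l0 = ccost p beta y c l0 + (beta x - beta y).
  move=> xy; case: l0 => [|[u0 v0] l0] /=.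
    by move=> yc; split; [exact: le_trans yc|ring].
  by move=> /and3P[yu -> ->]; split; [rewrite (le_trans xy yu)|ring].
have [e'|ne] := eqVneq u v.
  have [h1 h2] := weaken a v b _ (le_trans au uv) vl'.
  exists l' => //; rewrite h2 e' subrr G0; lra.
have lt : u < v by rewrite lt_neqAle ne.
have q0 := pot_ge0 p 0.
(* Two additional stays of length d must cost at most e / 2. *)
pose d := Num.min ((v - u) / 2) (e / (4 * (pot p 0 + 1))).
have d0 : 0 < d by rewrite lt_min !divr_gt0 ?subr_gt0// mulr_gt0// ltr_wpDl.
have d1 : d <= (v - u) / 2 by rewrite ge_min lexx.
have d2 : pot p 0 * d <= e / 4.
  have : d <= e / (4 * (pot p 0 + 1)) by rewrite ge_min lexx orbT.
  rewrite ler_pdivlMr; last by rewrite mulr_gt0// ltr_wpDl.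
  by move: (d) d0 q0 => x; nra.
have ud : u < u + d by rewrite ltrDl.
have vd : v - d < v by rewrite ltrBlDr ltrDl.
have [r1] := rat_in_itvoo ud; rewrite in_itv/= => /andP[ur1 r1u].
have [r2] := rat_in_itvoo vd; rewrite in_itv/= => /andP[r2v vr2].
have r12 : (ratr r1 : R) <= ratr r2 by lra.
have [h1 h2] := weaken _ _ b _ (ltW vr2) vl'.
exists ((r1, r2) :: l'); first by rewrite /= (le_trans au (ltW ur1)) r12.
have r0 : 0 <= (ratr r2 : R) - ratr r1 by rewrite subr_ge0.
have rr : (ratr r2 : R) - ratr r1 <= v - u by lra.
have := loop_nondecr p r0 rr; have := beta_ge (ltW ur1); have := beta_ge (ltW vr2).
have : pot p 0 * (ratr r1 - u) <= pot p 0 * d by apply: ler_wpM2l => //; lra.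
have : pot p 0 * (v - ratr r2) <= pot p 0 * d by apply: ler_wpM2l => //; lra.
rewrite /= h2.
move: (loop p _) (loop p _) (ccost _ _ _ _ _) (ccost _ _ _ _ _) hl' => ? ? ? ?.
move: (beta a) (beta u) (beta v) (beta (ratr r1)) (beta (ratr r2)) d2 => *; lra.
Qed.

End rational_chains.

Section random_potential.
Context {d : measure_display} {Omega : measurableType d} {R : realType}.
Variables (p : convex_potential R) (beta betap : Omega -> R -> R).
Hypothesis beta_meas : forall t, measurable_fun [set: Omega] (fun o => beta o t).
Hypothesis betap_dom :
  forall o s t, s <= t -> beta o t - beta o s <= betap o t - betap o s.
Hypothesis betap_ge : forall o s t, s <= t -> betap o s <= betap o t.
Hypothesis beta_ge :
  forall o s t, s <= t -> - pot p 0 * (t - s) <= beta o t - beta o s.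
Hypothesis betap_half :
  forall o s t, s <= t -> betap o t - betap o s <= (t - s) / 2.
Implicit Types (o : Omega) (a b s t y c e : R).

Let bdom o s t : s <= t -> beta o t - beta o s <= betap o t - betap o s.
Proof. exact: betap_dom. Qed.
Let bge o s t : s <= t -> betap o s <= betap o t.
Proof. exact: betap_ge. Qed.
Let bbe o s t : s <= t -> - pot p 0 * (t - s) <= beta o t - beta o s.
Proof. exact: beta_ge. Qed.
Let bhalf o s t : s <= t -> betap o t - betap o s <= (t - s) / 2.
Proof. exact: betap_half. Qed.

Lemma ccost_meas a b l : measurable_fun [set: Omega] (fun o => ccost p (beta o) a b l).
Proof.
elim: l a => [|[u v] l IH] a /=; first by apply: measurable_funB; exact: beta_meas.
apply: measurable_funD; last exact: IH.
apply: measurable_funD; last exact: measurable_cst.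
by apply: measurable_funB; exact: beta_meas.
Qed.

Lemma wallS_meas a b : a <= b -> measurable_fun [set: Omega] (fun o => wallS p (beta o) a b).
Proof.
move=> ab; pose vl l := if cvalid a b (ratl l) then @ratl R l else [::].
have vlP l : cvalid a b (vl l) by rewrite /vl; case: ifP.
apply: (measurable_fun_inf_countable (F := fun l o => ccost p (beta o) a b (vl l))).
  by move=> l; exact: ccost_meas.
move=> o _ c; split; last first.
  by move=> [l]; apply: le_lt_trans; exact: (wallS_le p (@bdom o) (@bge o)).
move=> h; have e0 : 0 < (c - wallS p (beta o) a b) / 2 by lra.
have [l v1 h1] := wallS_near p (@bdom o) (@bge o) ab e0.
have [l' v2 h2] := ccost_rat (@bbe o) v1 e0.
by exists l'; rewrite /vl v2; lra.
Qed.

Lemma busemann_meas s t : s <= t ->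
  measurable_fun [set: Omega] (fun o => busemann p (beta o) s t).
Proof.
move=> st.
apply: (measurable_fun_inf_countable (F := fun (n : nat) o =>
  wallS p (beta o) (s - n%:R) t - wallS p (beta o) (s - n%:R) s)).
  move=> n; have sn : s - n%:R <= s by rewrite gerBl.
  by apply: measurable_funB; apply: wallS_meas => //; exact: le_trans st.
move=> o _ c; split; last first.
  move=> [n]; apply: le_lt_trans; apply: (busemann_le p (@bdom o) (@bge o)) => //.
  by rewrite gerBl.
move=> h; have e0 : 0 < c - busemann p (beta o) s t by rewrite subr_gt0.
have [T0 T0s hT] := busemann_near p (@bdom o) (@bge o) st e0.
exists (Num.truncn (s - T0)).+1.
have hn := truncnS_gt (s - T0).
have := hT (s - (Num.truncn (s - T0)).+1%:R); lra.
Qed.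

Lemma wallZ_meas t : measurable_fun [set: Omega] (fun o => wallZ p (beta o) t).
Proof.
rewrite /wallZ; have [t0|/ltW t0] := leP 0 t; first exact: busemann_meas.
apply: (measurableT_comp (f := fun x : R => - x)); last exact: busemann_meas.
exact: oppr_measurable.
Qed.

(** The paths along which waiting at the wall is profitable without bound. *)
Definition good o := forall N, exists L, forall T, T <= L -> wallS p (beta o) T 0 <= - N.

(** Between two integer times the cost changes by a bounded amount. *)
Lemma goodP o : good o <-> forall N : nat, exists L : nat, forall n : nat,
  wallS p (beta o) (- (L + n)%:R) 0 <= - N%:R.
Proof.
split=> [h N|h N].
  have [L hL] := h N%:R; exists (Num.truncn (- L)).+1 => n; apply: hL.
  have := truncnS_gt (- L); have : (0 : R) <= n%:R by [].
  by rewrite natrD; lra.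
have q0 := pot_ge0 p 0; pose N' := (Num.truncn (N + pot p 0)).+1.
have hN : N + pot p 0 < N'%:R by exact: truncnS_gt.
have [L hL] := h N'; exists (- L%:R) => T TL.
have T0 : 0 <= - T by have : (0 : R) <= L%:R by []; move: TL; lra.
pose m := Num.truncn (- T); have /andP[m1 m2] := truncn_itv T0.
have Lm : (L <= m)%N by rewrite -ltnS -(ltr_nat R); apply: le_lt_trans m2; lra.
have Tm : T <= - m%:R by lra.
have m0 : - m%:R <= (0 : R) by rewrite oppr_le0.
have := hL (m - L)%N; rewrite subnKC// => h1.
have h2 := wallS_tri p (@bdom o) (@bge o) Tm m0.
have h3 := wallS_stay p (@bdom o) (@bge o) Tm.
have h4 := @bbe o _ _ Tm.
have : pot p 0 * (- m%:R - T) <= pot p 0 * 1.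
  by apply: ler_wpM2l => //; move: m2; rewrite -/m -natr1; lra.
by move: h1 h2 h3 h4 hN; lra.
Qed.

Lemma good_meas : measurable [set o | good o].
Proof.
rewrite (_ : [set o | good o] = \bigcap_(N : nat) \bigcup_(L : nat) \bigcap_(n : nat)
    ([set: Omega] `&` [set o | wallS p (beta o) (- (L + n)%:R) 0 <= - N%:R])).
  apply: bigcapT_measurable => N; apply: bigcupT_measurable => L.
  apply: bigcapT_measurable => n; apply: measurable_fun_le => //.
  by apply: wallS_meas; rewrite oppr_le0.
apply/seteqP; split=> o /=.
  by move=> /goodP h N _; have [L hL] := h N; exists L => // n _; split => //; exact: hL.
by move=> h; apply/goodP => N; have [L _ hL] := h N I; exists L => n; have [] := hL n I.
Qed.

Lemma wallU_meas : measurable_fun ([set o | good o] `*` [set: measurableTypeR R])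
  (fun q : Omega * measurableTypeR R => wallU p (wallZ p (beta q.1)) 0 q.2).
Proof.
pose s (q : rat) : R := if 0 < ratr q :> R then ratr q else 1.
have s0 q : 0 < s q by rewrite /s; case: ifP.
apply: (measurable_fun_inf_countable (F := fun (q : rat) (x : Omega * measurableTypeR R) =>
  wallZ p (beta x.1) (0 - s q) + cost p (s q) x.2)).
  move=> q; apply: measurable_funTS; apply: measurable_funD.
    exact: (measurableT_comp (wallZ_meas _) measurable_fst).
  apply: (measurableT_comp _ measurable_snd).
  exact: continuous_measurable_fun (cost_conty (s0 q)).
move=> q0 [/= go _] c; case: q0 go => o y /= go.
have Zup s1 u (su : s1 <= u) := wallZ_up (@bdom o) (@bge o) (@bbe o) su.
have Zback s1 u (su : s1 <= u) := wallZ_back p (@bdom o) (@bge o) su.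
have ZNy := wallZ_Ny (@bdom o) (@bge o) go.
split; last by move=> [q]; apply: le_lt_trans; exact: (wallU_le Zup ZNy).
move=> h; have e0 : 0 < c - wallU p (wallZ p (beta o)) 0 y by rewrite subr_gt0.
have [s1 s10 hs] := wallU_near Zup ZNy 0 y e0.
have {}hs : wallZ p (beta o) (0 - s1) + cost p s1 y < c by move: hs; lra.
have cs := hopf_conts (@bhalf o) Zup Zback (t := 0) (y := y) s10.
have : \forall s' \near s1, wallZ p (beta o) (0 - s') + cost p s' y < c.
  by apply: (@cvgr_lt _ _ _ _ (fun s => wallZ p (beta o) (0 - s) + cost p s y) _ cs c hs).
move=> [/= r r0 hr].
have sr : s1 < s1 + r by rewrite ltrDl.
have [q] := rat_in_itvoo sr.
rewrite in_itv/= => /andP[q1 q2]; exists q; rewrite /s (lt_trans s10 q1).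
by apply: hr => /=; rewrite ltr_distlC; apply/andP; split; lra.
Qed.

End random_potential.

(** * The stationary solution *)

Lemma quotients_shift (R : realType) (U V : R -> R) (c y k l : R) :
  (forall z, U z = V z - c) ->
  n.+1%:R * (U (y + n.+1%:R^-1) - U y) @[n --> \oo] --> k ->
  n.+1%:R * (V (y + n.+1%:R^-1) - V y) @[n --> \oo] --> l -> k = l.
Proof.
move=> UV cU cV; apply: (cvg_unique (@Rhausdorff R) cU).
apply: cvg_trans cV; apply: near_eq_cvg; apply: nearW => n.
by rewrite !UV; congr (_ * _); ring.
Qed.

Lemma eq_profile (R : realType) (M rs : R) (HM : 0 < M) (Hrs : 2 * M < rs)
    (f g : R -> R) (s t r : R) :
  (forall y, 0 < y -> slope f HM Hrs s y = slope g HM Hrs t y) ->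
  profile f HM Hrs s r = profile g HM Hrs t r.
Proof.
move=> h; rewrite /profile; have [rr|_] := boolP (rs < r); last by [].
exact: congr1 (h _ (ycoord_gt0 HM Hrs rr)).
Qed.

Section stationary_solution.
Context {d : measure_display} {Omega : measurableType d} {R : realType}.
Variables (P : probability Omega R) (theta : R -> Omega -> Omega).
Variables (phi : {RV P >-> R}) (M rs : R).
Hypothesis HM : 0 < M.
Hypothesis Hrs : 2 * M < rs.
Hypothesis Htheta : measure_preserving_flow P theta.
Hypothesis Hphi : forall o, -1 < phi o < 1.
Local Notation mu := (@lebesgue_measure R).
Local Notation p := (schw HM Hrs).
Local Notation Y := (ycoord M rs).
Local Notation ph := (sample_path theta phi).
Local Notation beta o := (beta M rs (ph o)).
Local Notation betap o := (betap M rs (ph o)).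
Implicit Types (o : Omega) (a b h s t r y : R).

Let flow_meas : measurable_fun [set: Omega * measurableTypeR R] (fun q => theta q.2 q.1).
Proof.
have [_ _ mt _] := Htheta.
exact: (measurableT_comp mt (measurable_fun_pair measurable_snd measurable_fst)).
Qed.

Let ph_meas2 : measurable_fun [set: Omega * measurableTypeR R] (fun q => ph q.1 q.2).
Proof. exact: (measurableT_comp (measurable_funPT phi) flow_meas). Qed.

Let mph o : measurable_fun [set: R] (ph o).
Proof. exact: (measurable_fun_pair2 o ph_meas2). Qed.

Let ph1 o t : -1 < ph o t < 1.
Proof. exact: Hphi. Qed.

Let ph_shift h o t : ph (theta h o) t = ph o (t + h).
Proof. by have [_ ts _ _] := Htheta; rewrite /sample_path ts. Qed.

Let bdom o s t : s <= t -> beta o t - beta o s <= betap o t - betap o s.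
Proof. exact: (betap_dom HM Hrs (mph o) (ph1 o)). Qed.
Let bge o s t : s <= t -> betap o s <= betap o t.
Proof. exact: (betap_ge HM Hrs (mph o) (ph1 o)). Qed.
Let bbe o s t : s <= t -> - pot p 0 * (t - s) <= beta o t - beta o s.
Proof. exact: (beta_ge HM Hrs (mph o) (ph1 o)). Qed.
Let bhalf o s t : s <= t -> betap o t - betap o s <= (t - s) / 2.
Proof. exact: (betap_half HM Hrs (mph o) (ph1 o)). Qed.

Let gainB o t : `|gain M rs (ph o) t| <= pot p 0 + 2^-1.
Proof.
rewrite ler_norml.
have := gain_ge (ph o) HM Hrs t; have := gain_lt HM Hrs (ph1 o) t.
by have := pot_ge0 p 0 => *; apply/andP; split; lra.
Qed.

Let beta_meas t : measurable_fun [set: Omega] (fun o => beta o t).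
Proof.
apply: (measurable_fun_section_prim (f := fun q => gain M rs (ph q.1) q.2)
  (K := pot p 0 + 2^-1)); last by move=> q; exact: gainB.
apply: measurable_funM; first exact: measurable_cst.
apply: measurable_funM; last exact: measurable_cst.
apply: measurable_funB; last exact: measurable_cst.
apply: measurable_funX; apply: measurable_maxr; first exact: ph_meas2.
exact: measurable_cst.
Qed.

Let beta_shift h o : shifted (beta o) (beta (theta h o)) h.
Proof.
have -> : beta (theta h o) = prim (fun x => gain M rs (ph o) (x + h)).
  apply: (congr1 (@prim R)); apply/funext => x.
  by rewrite /gain ph_shift.
by move=> a b; exact: (prim_shift h a b (gain_meas M rs (mph o)) (gainB o)).
Qed.

Local Notation G := (good p (fun o => beta o)).

Let good_shift h o : G o -> G (theta h o).
Proof. by move=> go; exact: (wallS_Ny_shift (beta_shift h o) (@bdom o) (@bge o) go). Qed.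

Let slope_shift t o y : G o -> 0 < y ->
  slope (ph (theta t o)) HM Hrs 0 y = slope (ph o) HM Hrs t y.
Proof.
move=> go y0; have go' := good_shift t go.
have c1 := slope_quot (mph _) (ph1 _) go' (t := 0) y0.
have c2 := slope_quot (mph _) (ph1 _) go (t := t) y0.
have e z : wallU p (wallZ p (beta (theta t o))) 0 z =
    wallU p (wallZ p (beta o)) t z - wallZ p (beta o) t.
  rewrite (wallU_shift (beta_shift t o) (@bdom o) (@bge o) (@bbe o) go
    (@bdom _) (@bge _) (@bbe _)).
  by rewrite add0r.
exact: (quotients_shift e c1 c2).
Qed.

(** The profile at time 0 generated by the whole past of the boundary condition;
    the null set of bad paths gets the zero profile. *)
Definition past_profile o r : R := if `[< G o >] then profile (ph o) HM Hrs 0 r else 0.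

Lemma past_profile_shift t o : G o ->
  past_profile (theta t o) = profile (ph o) HM Hrs t.
Proof.
move=> go; apply/funext => r; rewrite /past_profile asboolT; last exact: good_shift.
by apply: eq_profile => y; exact: slope_shift.
Qed.

Lemma past_profile_in_U o : in_U rs (past_profile o).
Proof.
have [go|ng] := pselect (G o).
  rewrite (_ : past_profile o = profile (ph o) HM Hrs 0).
    exact: (profile_in_U (mph o) (ph1 o) go).
  by apply/funext => r; rewrite /past_profile asboolT.
rewrite (_ : past_profile o = fun=> 0); last first.
  by apply/funext => r; rewrite /past_profile asboolF.
split; first by move=> b; exact: locint_cst.
by apply: aeW => r _; rewrite oppr_lt0 ltr01.
Qed.

Lemma past_profile_meas : measurable_fun [set: Omega * measurableTypeR R]
  (fun q => past_profile q.1 q.2).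
Proof.
pose D : set (Omega * measurableTypeR R) := [set o | G o] `*` `]rs, +oo[%classic.
have mG : measurable [set o | G o].
  exact: (good_meas beta_meas bdom bge bbe).
have mD : measurable D by apply: measurableX => //; exact: measurable_itv.
have DE q : (q \in D) = `[< G q.1 >] && (rs < q.2).
  apply/idP/andP; rewrite inE /D /= in_itv/= andbT.
    by move=> [? ?]; split => //; exact/asboolP.
  by move=> [/asboolP ? ?]; split.
rewrite (_ : (fun q => _) =
  (fun q => lapse M rs q.2 * slope (ph q.1) HM Hrs 0 (Y q.2)) \_ D); last first.
  apply/funext => q; rewrite patchE DE /past_profile /profile.
  by case: asbool => //=; case: ifP.
apply/(measurable_restrictT _ mD).
pose U (q : Omega * measurableTypeR R) := wallU p (wallZ p (beta q.1)) 0 q.2.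
have mU : measurable_fun ([set o | G o] `*` [set: measurableTypeR R]) U.
  exact: (wallU_meas beta_meas bdom bge bbe bhalf).
have mE : measurable ([set o | G o] `*` [set: measurableTypeR R]).
  exact: measurableX.
have mUk c : measurable_fun D (fun q => U (q.1, Y q.2 + c)).
  apply: (measurable_comp mE _ mU).
    by move=> _ [q [/= gq _] <-]; split.
  apply: measurable_funTS; apply: measurable_fun_pair; first exact: measurable_fst.
  apply: measurable_funD; last exact: measurable_cst.
  apply: (measurableT_comp _ measurable_snd).
  exact: continuous_measurable_fun (ycoord_cont HM Hrs).
have mUk0 : measurable_fun D (fun q => U (q.1, Y q.2)).
  by have := mUk 0; rewrite (_ : (fun q => _) = (fun q => U (q.1, Y q.2)))//;
     apply/funext => q; rewrite addr0.
apply: (@measurable_fun_cvg _ _ _ D (fun n q => lapse M rs q.2 *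
  (n.+1%:R * (U (q.1, Y q.2 + n.+1%:R^-1) - U (q.1, Y q.2))))).
  move=> n; apply: measurable_funM.
    apply: measurable_funTS; apply: (measurableT_comp _ measurable_snd).
    exact: continuous_measurable_fun (lapse_cont HM Hrs).
  apply: measurable_funM; first exact: measurable_cst.
  exact: measurable_funB.
move=> q [/= gq]; rewrite in_itv/= andbT => rq.
apply: cvgM; first exact: cvg_cst.
exact: (slope_quot (mph _) (ph1 _) gq (t := 0) (ycoord_gt0 HM Hrs rq)).
Qed.

Lemma past_profile_process : U_process rs (fun o t => past_profile (theta t o)).
Proof.
split; first by move=> o t; exact: past_profile_in_U.
move=> t b g /integrableP[/measurable_EFinP mg _].
have mI : measurable (`[rs, b]%classic : set R) by exact: measurable_itv.
pose g' := g \_ `[rs, b]%classic.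
have mg' : measurable_fun [set: R] g' by exact/(measurable_restrictT _ mI).
pose f (q : Omega * measurableTypeR R) := `|past_profile (theta t q.1) q.2 - g' q.2|.
have mf : measurable_fun [set: Omega * measurableTypeR R] f.
  apply: measurableT_comp; first exact: normr_measurable.
  apply: measurable_funB; last exact: (measurableT_comp mg' measurable_snd).
  have mt : measurable_fun [set: Omega] (theta t).
    exact: (measurable_fun_pair1 t flow_meas).
  apply: (measurableT_comp past_profile_meas
    (measurable_fun_pair (measurableT_comp mt measurable_fst) measurable_snd)).
have := measurable_fun_section_integral mI mf (fun q => normr_ge0 _).
apply: eq_measurable_fun => o _; apply: eq_Rintegral => r rI.
by rewrite /f /g' patchE rI.
Qed.

Lemma good_of_rate o rho : rho < 0 ->
  ((0 - t0)^-1%:E * Sact M rs (ph o) t0 0)%E @[t0 --> -oo] --> rho%:E -> G o.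
Proof.
move=> rho0 cS.
have z0 : rho < rho / 2 by lra.
have nb : nbhs rho%:E [set x : \bar R | (x < (rho / 2)%:E)%E].
  have h : \forall r \near rho, r < rho / 2.
    by apply: (@cvgr_lt _ _ (nbhs rho) _ id rho) => //; exact: cvg_id.
  by apply: filterS h => r; rewrite /= lte_fin.
have [L [_ hL]] := cS _ nb.
move=> N; exists (Num.min (Num.min (L - 1) (-1)) (N / (rho / 2))) => T.
rewrite !le_min => /andP[/andP[TL T1] TN].
have T0 : 0 < (0 - T)^-1 by rewrite invr_gt0; lra.
have lo : ((wallS p (beta o) T 0)%:E <= Sact M rs (ph o) T 0)%E.
  apply: le_ereal_inf_tmp => _ [chi [pc c0 c1] <-]; rewrite lee_fin.
  exact: (wallS_le_path HM Hrs (mph o) (ph1 o) pc c0 c1).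
have LT : T < L by lra.
have := hL T LT => /= h1.
have T0e : (0 <= (0 - T)^-1%:E)%E by rewrite lee_fin ltW.
have := le_lt_trans (lee_wpmul2l T0e lo) h1.
rewrite -EFinM lte_fin mulrC ltr_pdivrMr; last by rewrite -invr_gt0.
have r2 : rho / 2 < 0 by lra.
by move: TN; rewrite ler_ndivlMr// => h2 h3; lra.
Qed.

End stationary_solution.

Theorem theorem5p2 (R : realType) (d : measure_display)
  (Omega : measurableType d) (P : probability Omega R)
  (theta : R -> Omega -> Omega) (phi : {RV P >-> R}) (M rs rho : R)
  (HM : 0 < M) (Hrs : 2 * M < rs)
  (Htheta : ergodic_flow P theta)
  (Hphi : forall o, -1 < phi o < 1)
  (Hrho : forall t1 : R, {ae P, forall o,
     ((t1 - t0)^-1%:E * Sact M rs (sample_path theta phi o) t0 t1)%E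
       @[t0 --> -oo] --> rho%:E})
  (Hrho_le0 : rho <= 0) (Hrho_neq0 : rho <> 0) :
  exists u : Omega -> R -> R -> R,
    global_solution M rs P theta phi u /\ stationary rs theta u.
Proof.
have [flow _] := Htheta.
have rho0 : rho < 0 by rewrite lt_neqAle Hrho_le0 andbT; exact/eqP.
exists (fun o t => past_profile theta phi HM Hrs (theta t o)); split; last first.
  by have [theta0 _ _ _] := flow; move=> o t r _; rewrite theta0.
split; first exact: past_profile_process.
have := Hrho 0; apply: filterS => o /(good_of_rate HM Hrs flow Hphi rho0) go t0 t1 t01.
rewrite !(past_profile_shift flow Hphi _ go).
have [_ _ mt _] := flow.
have mph : measurable_fun [set: R] (sample_path theta phi o).
  exact: measurableT_comp (measurable_funPT phi) (measurable_fun_pair1 o mt).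
exact: (profile_evolution mph (fun t => Hphi (theta t o)) go t01).
Qed.
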